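(* Let $A\in\mathbb{Z}^{3\times n}$ be a pointed integer matrix whose columns span $\mathbb{Z}^3$ as a lattice, i.e. $\mathbb{Z}A=\mathbb{Z}^3$. Then for every parameter $\beta\in\mathbb{C}^3$, \[ \frac{\operatorname{rank}(M_A(\beta))}{\operatorname{vol}(A)}<2 . \] Moreover, this bound is sharp: there exist such $A$ and $\beta$ for which the ratio $\operatorname{rank}(M_A(\beta))/\operatorname{vol}(A)$ is arbitrarily close to $2$.
   Context: A matrix $A=(a_{i,j})\in\mathbb{Z}^{d\times n}$ with columns $a_1,\dots,a_n$ is pointed if all columns lie in a single open linear halfspace of $\mathbb{R}^d$ (a halfspace not containing the origin). Let $D$ be the Weyl algebra on $\mathbb{C}^n$, generated by $x_1,\dots,x_n,\partial_1,\dots,\partial_n$. The toric ideal of $A$ is $I_A=\langle \partial^u-\partial^v \mid u,v\in\mathbb{N}^n,\ Au=Av\rangle\subseteq\mathbb{C}[\partial_1,\dots,\partial_n]$, and the Euler operators are $E_i=\sum_{j=1}^n a_{i,j}x_j\partial_j$ for $i=1,\dots,d$. For $\beta\in\mathbb{C}^d$, the $A$-hypergeometric (GKZ) $D$-module is $M_A(\beta)=D/D\cdot\langle I_A,E_1-\beta_1,\dots,E_d-\beta_d\rangle$; it is holonomic, and its rank $\operatorname{rank}(M_A(\beta))$ is the (finite) dimension of the space of germs of holomorphic solutions at a generic (nonsingular) point. $\Delta_A\subseteq\mathbb{R}^d$ denotes the convex hull of the columns of $A$ and the origin, and $\operatorname{vol}(A)$ is the normalized volume of $\Delta_A$ with respect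 to $\mathbb{Z}^d$, i.e. $d!$ times the Euclidean volume of $\Delta_A$ (so a lattice simplex whose vertices form an affine basis of $\mathbb{Z}^d$ has normalized volume $1$). *)

(* Defs.v *)
From HB Require Import structures.
From mathcomp Require Import all_boot all_order all_algebra.
From mathcomp Require Import all_classical all_reals.
From mathcomp Require Import ereal measure lebesgue_measure lebesgue_integral.
From mathcomp Require Import lebesgue_integral_fubini.
From mathcomp Require Import complex.

Set Implicit Arguments.
Unset Strict Implicit.
Unset Printing Implicit Defensive.

Import Order.TTheory GRing.Theory Num.Theory.
Local Open Scope ring_scope.

(* A germ of a holomorphic function at a point p of C^n is encoded by *)
(* its (convergent) Taylor coefficients c : multi-index -> C, i.e.    *)
(* f(x) = sum_alpha c(alpha) (x - p)^alpha.                           *)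

Definition mi (n : nat) := {ffun 'I_n -> nat}.

Definition mi_deg n (a : mi n) : nat := (\sum_(j < n) a j)%N.

Definition mi_inc n (a : mi n) (j : 'I_n) : mi n :=
  [ffun k => (a k + (k == j))%N].
Definition mi_dec n (a : mi n) (j : 'I_n) : mi n :=
  [ffun k => (a k - (k == j))%N].

Section GKZ.
Variable R : realType.
Local Notation C := (R[i]).

Definition series (n : nat) := mi n -> C.

Definition convergent n (c : series n) : Prop :=
  exists rho : C, exists M : C, 0 < rho /\
    forall a : mi n, `|c a| * rho ^+ mi_deg a <= M.

Definition pd n (j : 'I_n) (c : series n) : series n :=
  fun a => (a j).+1%:R * c (mi_inc a j).

Definition pdpow n (u : mi n) (c : series n) : series n :=
  foldr (fun j g => iter (u j) (pd j) g) c (enum 'I_n).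

(* multiplication by the coordinate x_j, for a series centered at p
   (x_j = p_j + (x_j - p_j)) *)
Definition mulx n (p : 'I_n -> C) (j : 'I_n) (c : series n) : series n :=
  fun a => p j * c a + (if (0 < a j)%N then c (mi_dec a j) else 0).

Definition Amul d n (A : 'M[int]_(d, n)) (u : mi n) : 'I_d -> int :=
  fun i => \sum_(j < n) A i j * (u j)%:Z.

Definition euler d n (A : 'M[int]_(d, n)) (p : 'I_n -> C) (i : 'I_d)
  (c : series n) : series n :=
  fun a => \sum_(j < n) (A i j)%:~R * mulx p j (pd j c) a.

(* c is (the Taylor series at p of) a germ of holomorphic solution of
   M_A(beta): it is annihilated by the binomial generators d^u - d^v
   (Au = Av) of the toric ideal I_A and by E_i - beta_i. *)
Definition gkz_solution d n (A : 'M[int]_(d, n)) (beta : 'I_d -> C)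
  (p : 'I_n -> C) (c : series n) : Prop :=
  [/\ convergent c,
      (forall u v : mi n, (forall i, Amul A u i = Amul A v i) ->
                          pdpow u c =1 pdpow v c)
    & (forall i, euler A p i c =1 (fun a => beta i * c a))].

Definition lin_indep n k (f : 'I_k -> series n) : Prop :=
  forall lam : 'I_k -> C,
    (forall a, \sum_(l < k) lam l * f l a = 0) -> forall l, lam l = 0.

Definition sol_dim d n (A : 'M[int]_(d, n)) (beta : 'I_d -> C)
  (p : 'I_n -> C) (r : nat) : Prop :=
  (exists f : 'I_r -> series n,
      (forall l, gkz_solution A beta p (f l)) /\ lin_indep f) /\
  (forall f : 'I_r.+1 -> series n,
      (forall l, gkz_solution A beta p (f l)) -> ~ lin_indep f).

Definition peval n (h : seq (C * mi n)) (p : 'I_n -> C) : C :=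
  \sum_(t <- h) t.1 * \prod_(j < n) p j ^+ t.2 j.

(* rank(M_A(beta)) = r : the solution space has dimension r at every
   point outside the zero set of some nonzero polynomial (a generic
   point). *)
Definition gkz_rank d n (A : 'M[int]_(d, n)) (beta : 'I_d -> C) (r : nat)
  : Prop :=
  exists h : seq (C * mi n),
    (exists q, peval h q != 0) /\
    forall p, peval h p != 0 -> sol_dim A beta p r.

End GKZ.

Definition pointed (R : realType) d n (A : 'M[int]_(d, n)) : Prop :=
  exists w : 'I_d -> R, forall j : 'I_n,
    0 < \sum_(i < d) w i * (A i j)%:~R.

Definition spans_lattice d n (A : 'M[int]_(d, n)) : Prop :=
  forall z : 'I_d -> int, exists lam : 'I_n -> int,
    forall i, z i = \sum_(j < n) lam j * A i j.

(* Delta_A = conv(0, a_1, ..., a_n) in R^3 (as R * R * R) *)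
Definition DeltaA3 (R : realType) n (A : 'M[int]_(3, n)) : set (R * R * R) :=
  [set x | exists lam : 'I_n -> R,
     (forall j, 0 <= lam j) /\ \sum_(j < n) lam j <= 1 /\
     x = (\sum_(j < n) lam j * (A 0 j)%:~R,
          \sum_(j < n) lam j * (A 1 j)%:~R,
          \sum_(j < n) lam j * (A 2%:R j)%:~R)].

(* normalized volume: 3! times the Lebesgue measure of Delta_A *)
Definition vol3 (R : realType) n (A : 'M[int]_(3, n)) : R :=
  6%:R * fine ((((@lebesgue_measure R) \x (@lebesgue_measure R))
                  \x (@lebesgue_measure R)) (@DeltaA3 R n A))%E.

Arguments pointed R {d n} A.
Arguments vol3 R {n} A.

(* Main.v *)
(* With u(A alpha) = alpha! c_alpha, a series solution of M_A(beta) at p becomes a function u on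
   the semigroup NA with sum_k A_ik p_k u(b + a_k) = (beta_i - b_i) u(b).
   Along p_k = t^(w_k), with w generic, this system degenerates for t -> 0 to one in which only
   the columns in a common cell of the regular triangulation of w with b survive.  There
   u(b + a_j) = gamma_j(b) u(b) on every half-open simplicial cone, so that u is determined by
   its values at finitely many points: in each residue class modulo a cell, one for each minimal
   set of crossed zeros of gamma, an antichain of subsets of a three-element set.  At most one
   class of a cell needs three values, and the class of 0 needs only one, which gives fewer than
   twice the sum of the indices of the cells.  Since the leading part of the system is invertible,
   being determined by these values is an open algebraic condition on p, and it bounds the generic
   rank; counting lattice points shows that the indices sum to at most the normalized volume.
   For sharpness, take the columns (0,0,k), (1,0,0), (0,1,0), (1,0,1), (0,1,1) and beta = 0: the
   two facets meeting in the segment from 0 to (0,0,k) carry k + 1 solutions each, which share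
   only the constants, so that the rank is at least 2k + 1 while the volume is k + O(1). *)
Require Import Defs.
From HB Require Import structures.
From mathcomp Require Import all_boot all_order all_algebra.
From mathcomp Require Import all_classical all_reals.
From mathcomp Require Import ereal measure lebesgue_measure lebesgue_integral.
From mathcomp Require Import lebesgue_integral_fubini measurable_realfun.
From mathcomp Require Import complex.
From mathcomp Require Import lra ring zify.

Set Implicit Arguments.
Unset Strict Implicit.
Unset Printing Implicit Defensive.

Import Order.TTheory GRing.Theory Num.Theory.
Local Open Scope ring_scope.

(** * Bases and regular triangulations *)

(** The dimension of the solution space is read off from finite subsets of NA on which every
    solution is determined. The obstacle is that the equations form an infinite system, while
    openness in p is available for finite systems only. A gauge [psi] on NA overcomes it twice:
    below each level there are finitely many unknowns, and at high levels the terms that raise the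
    gauge by exactly 1 form a leading system whose coefficients do not depend on b, so that finitely
    many equations control all levels. The same leading system yields factorial growth of u, hence
    convergence of every formal solution at a generic point, so that the example can be treated with
    formal series. A determining set of least size has as many points as the solution space has
    dimensions, and this makes the dimension constant off a hypersurface. The vector q does more
    than select the half-open cells: the costs of the cells at q order them in such a way that the
    limit system becomes triangular. *)

Section Bases.
Variables (R : realFieldType) (d n : nat) (A : 'M[R]_(d, n)).
Implicit Types (s : {set 'I_n}) (C : 'M[R]_(n, d)) (x : 'cV[R]_d).

(* [s] indexes a basis of columns, and [C] sends a vector to its coordinates in it,
   with rows zero outside [s]. *)
Definition is_basis s C : Prop :=
  [/\ forall j i, j \notin s -> C j i = 0, A *m C = 1%:M &
      forall k, k \in s -> C *m col k A = delta_mx k 0].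

Definition basis s : bool := `[< exists C, is_basis s C >].

Definition coordmx s : 'M[R]_(n, d) :=
  if pselect (exists C, is_basis s C) is left h then projT1 (cid h) else 0.

Lemma coordmxP s : basis s -> is_basis s (coordmx s).
Proof.
move=> /asboolP bs; rewrite /coordmx; case: pselect => // h.
exact: (projT2 (cid h)).
Qed.

Lemma coordmx_out s x j : basis s -> j \notin s -> (coordmx s *m x) j 0 = 0.
Proof.
move=> /coordmxP[h _ _] js; rewrite mxE big1 // => i _; by rewrite h ?mul0r.
Qed.

Lemma coordmxK s x : basis s -> A *m (coordmx s *m x) = x.
Proof. by move=> /coordmxP[_ h _]; rewrite mulmxA h mul1mx. Qed.

Lemma coordmx_col s k j : basis s -> k \in s ->
  (coordmx s *m col k A) j 0 = (j == k)%:R.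
Proof. by move=> /coordmxP[_ _ h] ks; rewrite h // mxE andbT. Qed.

Lemma mulmx_sum_col (mu : 'cV[R]_n) : A *m mu = \sum_j mu j 0 *: col j A.
Proof.
apply/colP => i; rewrite mxE summxE; apply: eq_bigr => j _.
by rewrite !mxE mulrC.
Qed.

Lemma coordmx_comb s (mu : 'cV[R]_n) : basis s ->
  (forall j, j \notin s -> mu j 0 = 0) -> coordmx s *m (A *m mu) = mu.
Proof.
move=> bs h; rewrite mulmx_sum_col mulmx_sumr; apply/colP => i.
rewrite summxE (bigD1 i) //= big1 => [|j ji].
  rewrite addr0 -scalemxAr mxE; have [is_|is_] := boolP (i \in s).
    by rewrite coordmx_col // eqxx mulr1.
  by rewrite h // mul0r.
rewrite -scalemxAr mxE; have [js|js] := boolP (j \in s).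
  by rewrite coordmx_col // eq_sym (negPf ji) mulr0.
by rewrite h // mul0r.
Qed.

Lemma is_basis_basis s C : is_basis s C -> basis s.
Proof. by move=> h; apply/asboolP; exists C. Qed.

(** The traces of [A *m C] and [C *m A] agree: the first is d, and the diagonal of the second
    product is the indicator of s. *)
Lemma card_basis s : basis s -> #|s| = d.
Proof.
move=> bs; have [h1 h2 h3] := coordmxP bs.
have : \tr (A *m coordmx s) = \tr (coordmx s *m A) by rewrite mxtrace_mulC.
rewrite h2 mxtrace1 /mxtrace => /eqP.
rewrite (_ : \sum_(i < n) _ = (#|s|)%:R) ?eqr_nat => [/eqP //|].
rewrite (bigID (mem s)) /= [X in _ + X]big1 ?addr0 => [|i is_].
  rewrite (eq_bigr (fun => 1)) => [|i is_]; first by rewrite sumr_const.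
  have := coordmx_col i bs is_; rewrite eqxx !mxE /= => E.
  by apply: etrans E; apply: eq_bigr => j _; rewrite !mxE.
by rewrite mxE big1 // => j _; rewrite h1 ?mul0r.
Qed.

Lemma pivot s k l : basis s -> k \in s -> l \notin s ->
  let g := coordmx s *m col l A in
  g k 0 != 0 ->
  basis (l |: s :\ k) /\ forall x,
   coordmx (l |: s :\ k) *m x =
     coordmx s *m x + ((coordmx s *m x) k 0 / g k 0) *: (delta_mx l 0 - g).
Proof.
move=> bs ks ls g gk0.
have [h1 h2 h3] := coordmxP bs.
(* Exchanging column k for column l changes the coordinates by a rank-one correction, as in a
   simplex pivot. *)
pose C' := coordmx s + (g k 0)^-1 *: ((delta_mx l 0 - g) *m row k (coordmx s)).
have gl : g l 0 = 0 by rewrite /g coordmx_out.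
have lk : l != k by apply: contraNneq ls => ->.
have C'E j i : C' j i = coordmx s j i + (g k 0)^-1 * (((j == l)%:R - g j 0) * coordmx s k i).
  rewrite {}/C'; move: g gk0 gl => g _ _.
  by rewrite !mxE big_ord1 !mxE andbT.
have C'x x : C' *m x = coordmx s *m x + ((coordmx s *m x) k 0 / g k 0) *: (delta_mx l 0 - g).
  rewrite [C' *m x](mulmxDl (coordmx s)); congr (_ + _).
  rewrite -scalemxAl -mulmxA -row_mul [row _ _]mx11_scalar mul_mx_scalar scalerA.
  by congr (_ *: _); rewrite mulrC; congr (_ / _); rewrite mxE.
have isb : is_basis (l |: s :\ k) C'.
  split.
  - move=> j i; rewrite !inE negb_or negb_and negbK => /andP[jl].
    rewrite C'E (negPf jl) /= sub0r => /orP[/eqP->|js].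
      by rewrite mulNr mulrN mulKf ?subrr.
    have -> : g j 0 = 0 by rewrite /g coordmx_out.
    by rewrite h1 // oppr0 mul0r mulr0 addr0.
  - rewrite /C' mulmxDr h2 -scalemxAr mulmxA mulmxBr /g coordmxK // colE subrr.
    by rewrite mul0mx scaler0 addr0.
  - move=> i; rewrite !inE => /orP[/eqP->|/andP[ik is_]].
      rewrite C'x -/g divff // scale1r addrC subrK //.
    rewrite C'x coordmx_col // [k == i]eq_sym (negPf ik) mul0r scale0r addr0.
    exact: h3.
have bs' := is_basis_basis isb.
split => // x; rewrite -C'x.
have [_ h2' _] := isb.
rewrite -{1}(mul1mx x) -h2' -mulmxA coordmx_comb // => j js.
have [h1' _ _] := isb.
by rewrite mxE big1 // => i _; rewrite h1' ?mul0r.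
Qed.

Definition indep s := forall mu : 'cV[R]_n,
  (forall j, j \notin s -> mu j 0 = 0) -> A *m mu = 0 -> mu = 0.

Lemma indep_basis s : (exists B : 'M[R]_(n, d), A *m B = 1%:M) ->
  indep s -> exists2 s' : {set 'I_n}, s \subset s' & basis s'.
Proof.
move=> [B AB] inds.
have [s' /maxsetP[/asboolP inds' maxs'] ss'] :
    {s' | maxset (fun s => `[< indep s >]) s' & s \subset s'}.
  by apply: maxset_exists; apply/asboolP.
exists s' => //.
have span l : exists g : 'cV[R]_n, (forall j, j \notin s' -> g j 0 = 0) /\ A *m g = col l A.
  have [ls'|ls'] := boolP (l \in s').
    exists (delta_mx l 0); split; last by rewrite colE.
    by move=> j js; rewrite mxE andbT; case: eqP js => // ->; rewrite ls'.
  have /asboolP : ~~ `[< indep (l |: s') >].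
    apply/negP => /maxs' /(_ (finset.subsetUr _ _)) E.
    by move: ls'; rewrite -E finset.setU11.
  move=> /existsNP[mu] /not_implyP[mus] /not_implyP[Amu mu0].
  have mul0 : mu l 0 != 0.
    apply/negP => /eqP mul; apply: mu0; apply: inds' => // j js.
    have [->//|jl] := eqVneq j l.
    by apply: mus; rewrite !inE negb_or jl.
  exists (delta_mx l 0 - (mu l 0)^-1 *: mu); split.
    move=> j js; rewrite !mxE andbT; have [->|jl] := eqVneq j l.
      by rewrite mulVf // subrr.
    by rewrite (mus j) ?mulr0 ?subr0 // !inE negb_or jl.
  by rewrite mulmxBr -scalemxAr Amu scaler0 subr0 colE.
have /choice[G GP] := span.
pose C : 'M[R]_(n, d) := (\matrix_(j, l) G l j 0) *m B.
have AG : A *m (\matrix_(j, l) G l j 0) = A.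
  apply/matrixP => i l; have [_ /colP/(_ i)] := GP l.
  by rewrite !mxE => <-; apply: eq_bigr => j _; rewrite mxE.
apply: (@is_basis_basis _ C); split.
- move=> j i js; rewrite !mxE big1 // => l _; rewrite mxE.
  by have [-> //] := GP l; rewrite mul0r.
- by rewrite /C mulmxA AG.
- move=> k ks; apply/eqP; rewrite -subr_eq0; apply/eqP; apply: inds'.
    move=> j js; rewrite !mxE andbT big1 => [|i _].
      by case: eqP js => [->|_ _]; rewrite ?ks // subr0.
    rewrite !mxE big1 ?mul0r // => l _; rewrite mxE.
    by have [-> //] := GP l; rewrite mul0r.
  by rewrite mulmxBr -colE mulmxA /C mulmxA AG AB mul1mx subrr.
Qed.

Lemma caratheodory (lam : 'cV[R]_n) : (exists B : 'M[R]_(n, d), A *m B = 1%:M) ->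
  (forall j, 0 <= lam j 0) ->
  exists s, basis s /\ forall j, 0 <= (coordmx s *m (A *m lam)) j 0.
Proof.
move=> hB lam0.
pose supp (m : 'cV[R]_n) : {set 'I_n} := [set j | m j 0 != 0].
suff [mu [mu0 Amu imu]] : exists mu : 'cV[R]_n,
    [/\ forall j, 0 <= mu j 0, A *m mu = A *m lam & indep (supp mu)].
  have [s sub bs] := indep_basis hB imu.
  exists s; split=> // j; rewrite -Amu coordmx_comb // => i is_.
  apply/eqP; apply: contraNT is_ => mui; apply: (fintype.subsetP sub); by rewrite inE.
have [m] := ubnP #|supp lam|; elim: m => // m IH in lam lam0 *.
rewrite ltnS => lem.
have [ind|] := pselect (indep (supp lam)); first by exists lam.
move=> /existsNP[mu] /not_implyP[mus] /not_implyP[Amu mu0].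
have [k muk] : exists k, 0 < mu k 0 \/ mu k 0 < 0.
  apply: contrapT => H; apply: mu0; apply/colP => i; rewrite [RHS]mxE.
  have [//|/eqP] := eqVneq (mu i 0) 0.
  by move=> /eqP; rewrite neq_lt => /orP[] ?; case: H; exists i; [right|left].
wlog {muk} muk : mu mus Amu mu0 / 0 < mu k 0.
  move=> W; case: muk => muk; first exact: (W mu).
  apply: (W (- mu)).
  - by move=> j js; rewrite mxE mus // oppr0.
  - by rewrite mulmxN Amu oppr0.
  - by move=> /eqP; rewrite oppr_eq0 => /eqP.
  - by rewrite mxE oppr_gt0.
(* The smallest ratio over the positive entries of the dependence [mu] is the step that empties a
   coordinate while the others stay nonnegative. *)
have [i mui imin] := @Order.TotalTheory.arg_minP _ _ _ k (fun j => 0 < mu j 0)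
  (fun j => lam j 0 / mu j 0) muk.
pose t := lam i 0 / mu i 0.
have t0 : 0 <= t by rewrite divr_ge0 // ltW.
have lam'0 j : 0 <= (lam - t *: mu) j 0.
  rewrite !mxE subr_ge0; have [muj|muj] := ltP 0 (mu j 0).
    by rewrite -ler_pdivlMr // imin.
  by rewrite (le_trans _ (lam0 j)) // mulr_ge0_le0.
have [|mu' [m1 m2 m3]] := IH (lam - t *: mu) lam'0.
  rewrite (leq_trans _ lem) // proper_card //; apply/fintype.properP; split.
    apply/fintype.subsetP => j; rewrite !inE; apply: contra => /eqP lj.
    by rewrite !mxE lj mus ?inE ?lj ?eqxx // mulr0 subrr.
  exists i; rewrite inE.
    by apply/negP => /eqP li; move: mui; rewrite mus ?ltxx // inE li eqxx.
  by rewrite negbK !mxE /t divfK ?subrr // gt_eqF.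
exists mu'; split=> //.
by rewrite m2 mulmxBr -scalemxAr Amu scaler0 subr0.
Qed.

End Bases.

Section Fan.
Variables (R : realFieldType) (d n : nat) (A : 'M[R]_(d, n)).
Variables (w : 'I_n -> R) (q : 'cV[R]_d).
Implicit Types (s : {set 'I_n}) (x : 'cV[R]_d).

Definition co s x j : R := (coordmx A s *m x) j 0.
Definition cost s x : R := \sum_j w j * co s x j.
(* [s] is a cell of the regular triangulation of the cone induced by the heights [w]. *)
Definition fan s : bool :=
  basis A s && [forall l, (l \notin s) ==> (cost s (col l A) < w l)].
Definition incone s x : bool := [forall j, 0 <= co s x j].
(* [x] lies in the simplicial cone of [s] from which the facets not visible
   from [q] are removed: [x + eps q] is interior for all small [eps > 0] *)
Definition hopen s x : bool :=
  [forall j, (j \in s) ==> (0 < co s x j) || (co s x j == 0) && (0 < co s q j)].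

Lemma fan_basis s : fan s -> basis A s. Proof. by case/andP. Qed.

Lemma coD s x x' j : co s (x + x') j = co s x j + co s x' j.
Proof. by rewrite /co mulmxDr mxE. Qed.
Lemma coB s x x' j : co s (x - x') j = co s x j - co s x' j.
Proof. by rewrite /co mulmxBr !mxE. Qed.
Lemma coZ s (k : R) x j : co s (k *: x) j = k * co s x j.
Proof. by rewrite /co -scalemxAr mxE. Qed.
Lemma co0 s j : co s 0 j = 0. Proof. by rewrite /co mulmx0 mxE. Qed.
Lemma co_sum s I (r : seq I) (P : pred I) (F : I -> 'cV[R]_d) j :
  co s (\sum_(i <- r | P i) F i) j = \sum_(i <- r | P i) co s (F i) j.
Proof. by rewrite /co mulmx_sumr summxE. Qed.
Lemma co_notin s x j : basis A s -> j \notin s -> co s x j = 0.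
Proof. exact: coordmx_out. Qed.
Lemma co_col s k j : basis A s -> k \in s -> co s (col k A) j = (j == k)%:R.
Proof. exact: coordmx_col. Qed.
Lemma co_expand s x : basis A s -> x = \sum_j co s x j *: col j A.
Proof. by move=> bs; rewrite -mulmx_sum_col coordmxK. Qed.
Lemma co_inj s x x' : basis A s -> (forall j, j \in s -> co s x j = co s x' j) -> x = x'.
Proof.
move=> bs h; rewrite (co_expand x bs) (co_expand x' bs).
apply: eq_bigr => j _; have [js|js] := boolP (j \in s); first by rewrite h.
by rewrite !co_notin // !scale0r.
Qed.

Lemma costD s x x' : cost s (x + x') = cost s x + cost s x'.
Proof. by rewrite /cost -big_split; apply: eq_bigr => j _; rewrite coD mulrDr. Qed.
Lemma costZ s (k : R) x : cost s (k *: x) = k * cost s x.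
Proof. by rewrite /cost mulr_sumr; apply: eq_bigr => j _; rewrite coZ mulrCA. Qed.
Lemma cost_sum s I (r : seq I) (P : pred I) (F : I -> 'cV[R]_d) :
  cost s (\sum_(i <- r | P i) F i) = \sum_(i <- r | P i) cost s (F i).
Proof.
apply: (big_morph (cost s) (costD s)).
by rewrite /cost big1 // => j _; rewrite co0 mulr0.
Qed.

Lemma cost_col s j : basis A s -> j \in s -> cost s (col j A) = w j.
Proof.
move=> bs js; rewrite /cost (bigD1 j) //= big1 => [|i ij].
  by rewrite co_col // eqxx mulr1 addr0.
by rewrite co_col // (negPf ij) mulr0.
Qed.

Lemma cost_col_lt s j : fan s -> j \notin s -> cost s (col j A) < w j.
Proof. by move=> /andP[_ /forallP/(_ j)/implyP]. Qed.

Lemma cost_col_le s j : fan s -> cost s (col j A) <= w j.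
Proof.
move=> fs; have [js|js] := boolP (j \in s); last exact/ltW/cost_col_lt.
by rewrite cost_col // fan_basis.
Qed.

(** The factors [w j - cost s' (col j A)] are the reduced costs of s'. If s' is a cell they vanish
    on s' and are positive off it; comparisons between cells rest on these signs. *)
Lemma cost_diff s s' x : basis A s ->
  cost s x - cost s' x = \sum_j co s x j * (w j - cost s' (col j A)).
Proof.
move=> bs; rewrite {2}(co_expand x bs) cost_sum -sumrB.
by apply: eq_bigr => j _; rewrite costZ mulrBr mulrC.
Qed.

Lemma hopen_incone s x : basis A s -> hopen s x -> incone s x.
Proof.
move=> bs /forallP h; apply/forallP => j; have [js|js] := boolP (j \in s).
  by move: (h j); rewrite js /= => /orP[/ltW //|/andP[/eqP ->]].
by rewrite co_notin.
Qed.

Lemma cost_le s s' x : basis A s -> fan s' -> incone s x -> cost s' x <= cost s x.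
Proof.
move=> bs fs' /forallP h; rewrite -subr_ge0 cost_diff // sumr_ge0 // => j _.
by rewrite mulr_ge0 // subr_ge0 cost_col_le.
Qed.

Lemma cost_eq_supp s s' x : basis A s -> fan s' -> incone s x -> cost s' x = cost s x ->
  forall j, 0 < co s x j -> j \in s'.
Proof.
move=> bs fs' /forallP h E j cj; apply: contraT => js'.
suff : 0 < cost s x - cost s' x by rewrite E subrr ltxx.
rewrite cost_diff // (bigD1 j) //= ltr_pwDl //.
  by rewrite mulr_gt0 // subr_gt0 cost_col_lt.
rewrite sumr_ge0 // => i _.
by rewrite mulr_ge0 // subr_ge0 cost_col_le.
Qed.

Lemma co_supp_eq s s' x : basis A s -> basis A s' -> incone s x ->
  (forall j, 0 < co s x j -> j \in s') -> co s x =1 co s' x.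
Proof.
move=> bs bs' /forallP h sub j.
have xE : x = A *m (\col_i co s x i).
  by rewrite mulmx_sum_col {1}(co_expand x bs); apply: eq_bigr => i _; rewrite mxE.
rewrite {2}xE {2}/co coordmx_comb //; first by rewrite mxE.
move=> i is'; rewrite mxE; apply/eqP; apply: contraNT is' => ci.
  by apply: sub; rewrite lt_neqAle eq_sym ci h.
Qed.

Lemma co_uniq s s' x : fan s -> fan s' -> incone s x -> incone s' x ->
  co s x =1 co s' x.
Proof.
move=> fs fs' h h'; apply: co_supp_eq => //; try exact: fan_basis.
apply: cost_eq_supp => //; first exact: fan_basis.
by apply/eqP; rewrite eq_le !cost_le // fan_basis.
Qed.

Lemma incone_cost_eq s s' x : fan s -> fan s' -> incone s x ->
  (cost s' x == cost s x) = incone s' x.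
Proof.
move=> fs fs' h; apply/eqP/idP => [E|h'].
  apply/forallP => j; rewrite -(@co_supp_eq s) ?(fan_basis) //.
    by move/forallP: h.
  exact: (cost_eq_supp (fan_basis fs) fs' h E).
by apply/eqP; rewrite eq_le !cost_le // fan_basis.
Qed.

(** At the indices of s outside s' the vector x has coordinate 0, so [hopen] makes q positive there;
    on the common indices the reduced costs of s' vanish. The difference of the costs of q is
    therefore a sum of positive terms. *)
Lemma hopen_lt s s' x : fan s -> fan s' -> s != s' -> hopen s x -> incone s' x ->
  cost s' q < cost s q.
Proof.
move=> fs fs' ss' hx ix'; have bs := fan_basis fs; have bs' := fan_basis fs'.
have ix := hopen_incone bs hx.
have sup : forall j, 0 < co s x j -> j \in s'.
  by apply: cost_eq_supp => //; apply/eqP; rewrite incone_cost_eq.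
have qpos j : j \in s -> j \notin s' -> 0 < co s q j.
  move=> js js'; move/forallP: hx => /(_ j); rewrite js /= => /orP[/sup|/andP[_ //]].
  by rewrite (negPf js').
have [j js js'] : exists2 j, j \in s & j \notin s'.
  apply/fintype.subsetPn; apply: contra ss' => sub; rewrite eqEcard sub.
  by rewrite (card_basis bs) (card_basis bs') leqnn.
rewrite -subr_gt0 cost_diff // (bigD1 j) //= ltr_pwDl //.
  by rewrite mulr_gt0 ?qpos // subr_gt0 cost_col_lt.
apply: sumr_ge0 => i _; have [is_|is_] := boolP (i \in s); last first.
  by rewrite co_notin // mul0r.
have [is'|is'] := boolP (i \in s'); first by rewrite cost_col // subrr mulr0.
by rewrite mulr_ge0 // ?ltW ?qpos // subr_gt0 cost_col_lt.
Qed.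

Lemma hopen_uniq s s' x : fan s -> fan s' -> hopen s x -> hopen s' x -> s = s'.
Proof.
move=> fs fs' h h'; apply/eqP; apply: contraT => ss'.
have lt1 := hopen_lt fs fs' ss' h (hopen_incone (fan_basis fs') h').
rewrite eq_sym in ss'.
have := hopen_lt fs' fs ss' h' (hopen_incone (fan_basis fs) h).
by rewrite ltNge (ltW lt1).
Qed.

Hypothesis spanA : exists B : 'M[R]_(n, d), A *m B = 1%:M.
Hypothesis pointA : exists h : 'rV[R]_d, forall j, 0 < (h *m col j A) 0 0.
Hypothesis gen_w : forall s l, basis A s -> l \notin s -> cost s (col l A) != w l.
Hypothesis gen_q : forall s j, basis A s -> j \in s -> co s q j != 0.
Hypothesis q_cone : exists mu : 'cV[R]_n, (forall j, 0 <= mu j 0) /\ q = A *m mu.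

(** A feasible basis of least cost is a cell, since an index violating the fan condition could be
    pivoted in at smaller cost. Pointedness supplies the positive entry for the ratio test, and
    genericity of x a positive step. *)
Lemma fan_pivot x : (exists lam : 'cV[R]_n, (forall j, 0 <= lam j 0) /\ x = A *m lam) ->
  (forall s j, basis A s -> j \in s -> co s x j != 0) ->
  exists2 s, fan s & incone s x.
Proof.
move=> [lam [lam0 xE]] gx.
have [s0 [bs0 h0]] := caratheodory spanA lam0.
have {}h0 : basis A s0 && incone s0 x by rewrite bs0 /=; apply/forallP => j; rewrite /co xE.
have [s /andP[bs hs] min] := @Order.TotalTheory.arg_minP _ _ _ s0
  (fun s => basis A s && incone s x) (cost^~ x) h0.
exists s => //; rewrite /fan bs /=; apply/forallP => l; apply/implyP => ls.
rewrite lt_neqAle gen_w //= leNgt; apply/negP => lt_w.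
pose g := coordmx A s *m col l A.
have [k gk] : exists k, 0 < g k 0.
  apply: contrapT => H; have [h hP] := pointA.
  have gle k : g k 0 <= 0 by rewrite leNgt; apply/negP => gk; apply: H; exists k.
  have := hP l; rewrite (co_expand (col l A) bs) mulmx_sumr summxE ltNge => /negP; apply.
  apply: sumr_le0 => j _; rewrite -scalemxAr mxE mulr_le0_ge0 //; first exact: gle.
  exact: ltW.
have [i gi imin] := @Order.TotalTheory.arg_minP _ _ _ k (fun j => 0 < g j 0)
  (fun j => co s x j / g j 0) gk.
have is_ : i \in s.
  by apply: contraT => is_; move: gi; rewrite /g coordmx_out // ltxx.
have [bs' piv] := pivot bs is_ ls (lt0r_neq0 gi).
set t := co s x i / g i 0 in imin.
have xi0 : 0 < co s x i.
  by rewrite lt_neqAle eq_sym gx //=; move/forallP: hs.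
have t0 : 0 < t by rewrite divr_gt0.
have coE j : co (l |: s :\ i) x j = co s x j + t * ((j == l)%:R - g j 0).
  rewrite /co piv mxE [in X in _ + X]mxE [in X in _ * X]mxE /t; congr (_ + _ * _).
  by rewrite [in LHS]mxE andbT [in X in _ + X]mxE.
have := min (l |: s :\ i); rewrite bs' /= leNgt => H.
have : cost (l |: s :\ i) x < cost s x.
  rewrite -subr_lt0 /cost -sumrB.
  rewrite (eq_bigr (fun j => t * (w j * (j == l)%:R - w j * co s (col l A) j))); last first.
    by move=> j _; rewrite coE -/(co s (col l A) j) /g -/(co s _ j); ring.
  rewrite -mulr_sumr pmulr_rlt0 // sumrB subr_lt0.
  rewrite (bigD1 l) //= big1 => [|j jl]; first by rewrite eqxx mulr1 addr0.
  by rewrite (negPf jl) mulr0.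
apply/negP; apply: H; apply/forallP => j; rewrite coE.
have cj : 0 <= co s x j by move/forallP: hs.
have [gj|gj] := ltP 0 (g j 0).
  have := imin j gj; rewrite ler_pdivlMr // => tg.
  have t1 : 0 <= t * (j == l)%:R by rewrite mulr_ge0 // ltW.
  by rewrite mulrBr; lra.
apply: addr_ge0 => //; apply: mulr_ge0; first exact: ltW.
by rewrite subr_ge0 (le_trans gj).
Qed.

Lemma fan_cover x : (exists lam : 'cV[R]_n, (forall j, 0 <= lam j 0) /\ x = A *m lam) ->
  exists2 s, fan s & hopen s x.
Proof.
move=> [lam [lam0 xE]].
(* [M] exceeds every ratio of coordinates of q and x, so adding [M^-1 *: q] changes no sign of a
   nonzero coordinate of x. Ratios with denominator 0 count as 0. *)
pose M := 1 + \sum_s \sum_j `|co s q j / co s x j|.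
have M0 : 0 < M by rewrite ltr_pwDl // sumr_ge0 // => s _; rewrite sumr_ge0.
have Mlt s j : `|co s q j / co s x j| < M.
  rewrite /M addrC; apply: (@le_lt_trans _ _ (\sum_s \sum_j `|co s q j / co s x j|)).
    rewrite (bigD1 s) //= (bigD1 j) //= -addrA lerDl addr_ge0 // sumr_ge0 // => i _.
    by rewrite sumr_ge0.
  by rewrite ltrDl.
have small s j : co s x j != 0 -> `|M^-1 * co s q j| < `|co s x j|.
  move=> xj; have := Mlt s j; rewrite normrM normfV ltr_pdivrMr ?normr_gt0 //.
  by rewrite normrM normfV (gtr0_norm M0) ltr_pdivrMl.
have [||s fs hs] := @fan_pivot (x + M^-1 *: q).
- have [mu [mu0 qE]] := q_cone; exists (lam + M^-1 *: mu); split.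
    by move=> j; rewrite !mxE addr_ge0 // mulr_ge0 // invr_ge0 ltW.
  by rewrite mulmxDr -scalemxAr -qE xE.
- move=> s j bs js; rewrite coD coZ.
  have [->|xj] := eqVneq (co s x j) 0.
    by rewrite add0r mulf_neq0 ?gen_q // invr_eq0 gt_eqF.
  apply: contraTN (small s j xj) => /eqP; rewrite addrC => /eqP; rewrite addr_eq0 => /eqP ->.
  by rewrite normrN ltxx.
exists s => //; have bs := fan_basis fs.
apply/forallP => j; apply/implyP => js.
move/forallP: hs => /(_ j); rewrite coD coZ.
have [->|xj] := eqVneq (co s x j) 0.
  rewrite ltxx add0r pmulr_rge0 ?invr_gt0 //= => h.
  by rewrite lt_neqAle eq_sym gen_q.
rewrite orbF ltNge => h; apply/negP => xj0.
have := small s j xj; rewrite (ler0_norm xj0).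
by move=> /(le_lt_trans (ler_norm _)); lra.
Qed.

End Fan.

(** * Generic integral weights *)

Lemma common_nonroot (F : numDomainType) (I : finType) (P : I -> {poly F}) :
  (forall i, P i != 0) -> exists m : nat, forall i, (P i).[m%:R] != 0.
Proof.
move=> P0; pose Q := \prod_i P i.
have Q0 : Q != 0 by apply/prodf_neq0 => i _.
pose rs := [seq (m%:R : F) | m <- iota 0 (size Q)].
have : ~~ all (root Q) rs.
  apply/negP => allr.
  have := max_poly_roots Q0 allr; rewrite map_inj_uniq ?iota_uniq.
    by rewrite size_map size_iota ltnn => /(_ isT).
  by move=> x y /eqP; rewrite eqr_nat => /eqP.
move=> /allPn[_ /mapP[m _ ->]]; rewrite rootE /Q horner_prod => h.
exists m => i; apply: contra h => /eqP Pi.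
by rewrite (bigD1 i) //= Pi mul0r.
Qed.

Lemma fin_nat_bound (R : realType) (I : finType) (f : I -> R) :
  exists M : nat, forall i, f i < M%:R.
Proof.
exists (\sum_i Num.bound `|f i|)%N => i.
apply: (@lt_le_trans _ _ (Num.bound `|f i|)%:R).
  by apply: le_lt_trans (ler_norm _) _; apply: archi_boundP.
by rewrite ler_nat (bigD1 i) //= leq_addr.
Qed.

Section Integrality.
Variables (R : realType) (n : nat).

(** Cramer's rule: the determinant of the basis minor clears the denominators. With [#|s|] rows this
    minor is square by its type. *)
Lemma basis_denominator_aux (s : {set 'I_n}) (A : 'M[int]_(#|s|, n)) :
  basis (map_mx intr A : 'M[R]_(_, _)) s ->
  exists2 D : nat, (0 < D)%N & forall (b : 'cV[int]_(#|s|)) j,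
    exists z : int, D%:R * co (map_mx intr A : 'M[R]_(_, _)) s (map_mx intr b) j = z%:~R.
Proof.
move=> bs; set AR := (map_mx intr A : 'M[R]_(_, _)) in bs *.
pose f : 'I_#|s| -> 'I_n := enum_val.
pose M := colsub f A; pose MR := (map_mx intr M : 'M[R]_#|s|).
have [h1 h2 _] := coordmxP bs.
have MC : MR *m rowsub f (coordmx AR s) = 1%:M.
  rewrite -h2; apply/matrixP => i k; rewrite !mxE.
  rewrite [RHS](bigID (mem s)) /= [X in _ = _ + X]big1 ?addr0; last first.
    by move=> j js; rewrite h1 ?mulr0.
  by rewrite [RHS]big_enum_val; apply: eq_bigr => j _; rewrite !mxE.
have detE : \det MR = (\det M)%:~R by rewrite det_map_mx.
have det0 : \det M != 0.
  apply/negP => /eqP E.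
  have /det0P[v v0 vM] : \det MR == 0 by rewrite detE E.
  by move: v0; rewrite -(mulmx1 v) -MC mulmxA vM mul0mx eqxx.
exists `|\det M|%N; first by rewrite absz_gt0.
move=> b j.
have [js|js] := boolP (j \in s); last by exists 0; rewrite co_notin // mulr0.
have adjE : \det MR *: rowsub f (coordmx AR s) = \adj MR.
  by rewrite -[RHS]mulmx1 -MC mulmxA mul_adj_mx mul_scalar_mx.
have : exists z : int, \det MR * co AR s (map_mx intr b) j = z%:~R.
  exists ((\adj M *m b) (enum_rank_in js j) 0).
  have fj : f (enum_rank_in js j) = j by rewrite /f enum_rankK_in.
  have -> : (((\adj M *m b) (enum_rank_in js j) 0)%:~R : R) =
    (\adj MR *m map_mx intr b) (enum_rank_in js j) 0.
    by rewrite /MR -map_mx_adj -map_mxM [RHS]mxE.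
  rewrite -adjE -scalemxAl mxE; congr (_ * _); rewrite /co !mxE.
  by apply: eq_bigr => i _; rewrite [in RHS]mxE fj.
move=> [z zE]; rewrite pmulrn.
have [->|->] : `|\det M|%N = \det M :> int \/ `|\det M|%N = - \det M :> int by lia.
  by exists z; rewrite -detE.
by exists (- z); rewrite !intrN mulNr -detE zE.
Qed.

Lemma basis_denominator d (A : 'M[int]_(d, n)) :
  exists2 D : nat, (0 < D)%N & forall (s : {set 'I_n}) (b : 'cV[int]_d) j,
    basis (map_mx intr A : 'M[R]_(_, _)) s ->
    exists z : int, D%:R * co (map_mx intr A : 'M[R]_(_, _)) s (map_mx intr b) j = z%:~R.
Proof.
have H s : exists D : nat, (0 < D)%N /\ (basis (map_mx intr A : 'M[R]_(_, _)) s ->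
    forall (b : 'cV[int]_d) j,
    exists z : int, D%:R * co (map_mx intr A : 'M[R]_(_, _)) s (map_mx intr b) j = z%:~R).
  have [bs|] := boolP (basis (map_mx intr A : 'M[R]_(_, _)) s); last by exists 1%N.
  have E := card_basis bs; case: d / E A bs => A bs.
  by have [D D0 DP] := basis_denominator_aux bs; exists D; split.
have [D DP] := choice H.
exists (\prod_s D s)%N; first by apply: prodn_gt0 => s; have [] := DP s.
move=> s b j bs; have [_ /(_ bs b j)[z zE]] := DP s.
exists (Posz (\prod_(t | t != s) D t) * z).
by rewrite (bigD1 s) //= mulnC natrM -mulrA zE intrM.
Qed.

End Integrality.

Section Weights.
Variables (R : realType) (d n : nat) (A : 'M[int]_(d, n)).
Let AR : 'M[R]_(d, n) := map_mx intr A.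

(** The heights are [D * (M + X ^ j)]. The powers of X make them generic and D clears the
    denominators of all costs. The large constant M yields the last clause, since it charges for
    every excess of a coordinate sum over 1; this is what makes the cells, joined to the origin,
    fill the polytope and not only the cone. *)
Lemma generic_weights : exists (w : 'I_n -> nat) (q : 'cV[R]_d),
  let w' j := (w j)%:R : R in
  [/\ forall s l, basis AR s -> l \notin s -> cost AR w' s (col l AR) != w' l,
      forall s j, basis AR s -> j \in s -> co AR s q j != 0,
      exists mu : 'cV[R]_n, (forall j, 0 <= mu j 0) /\ q = AR *m mu,
      forall s (b : 'cV[int]_d), basis AR s ->
        exists z : int, cost AR w' s (map_mx intr b) = z%:~R &
      forall s l, fan AR w' s -> \sum_j co AR s (col l AR) j <= 1].
Proof.
have [D D0 DP] := basis_denominator R A.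
have colE l : col l AR = map_mx intr (col l A) by rewrite map_col.
pose P (sl : {set 'I_n} * 'I_n) : {poly R} :=
  if basis AR sl.1 && (sl.2 \notin sl.1) then
    'X^(sl.2) - \sum_j (co AR sl.1 (col sl.2 AR) j)%:P * 'X^j
  else 1.
have [sl|X XP] := @common_nonroot R _ P.
  rewrite /P; case: ifP => [/andP[bs ls]|_]; last exact: oner_neq0.
  apply/negP => /eqP /polyP /(_ sl.2); rewrite coef0 coefB coefXn eqxx coef_sum.
  rewrite big1 => [|j _]; first by rewrite subr0 => /eqP; rewrite oner_eq0.
  rewrite coefCM coefXn; case: eqP => [/val_inj <-|_]; last by rewrite mulr0.
  by rewrite co_notin // mul0r.
pose Q (sl : {set 'I_n} * 'I_n) : {poly R} :=
  if basis AR sl.1 && (sl.2 \in sl.1) then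
    \sum_k (co AR sl.1 (col k AR) sl.2)%:P * 'X^k
  else 1.
have [sl|Y YP] := @common_nonroot R _ Q.
  rewrite /Q; case: ifP => [/andP[bs ls]|_]; last exact: oner_neq0.
  apply/negP => /eqP /polyP /(_ sl.2); rewrite coef0 coef_sum.
  rewrite (bigD1 sl.2) //= coefCM coefXn eqxx mulr1 co_col // eqxx big1 => [|j jl].
    by rewrite addr0 => /eqP; rewrite oner_eq0.
  by rewrite coefCM coefXn eq_sym (inj_eq val_inj) (negPf jl) mulr0.
pose err s (l : 'I_n) : R := X%:R ^+ (l : nat) - \sum_j co AR s (col l AR) j * X%:R ^+ (j : nat).
have [M MP] := fin_nat_bound (fun sl : {set 'I_n} * 'I_n => D%:R * `|err sl.1 sl.2|).
have DR : 0 < D%:R :> R by rewrite ltr0n.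
exists (fun j : 'I_n => D * (M + X ^ j))%N, (\sum_(k : 'I_n) Y%:R ^+ (k : nat) *: col k AR).
have costE s (l : 'I_n) : cost AR (fun j : 'I_n => (D * (M + X ^ j))%:R) s (col l AR) -
    (D * (M + X ^ l))%:R = D%:R * (M%:R * (\sum_j co AR s (col l AR) j - 1) - err s l).
  rewrite /cost /err natrM natrD natrX.
  rewrite (eq_bigr (fun j => D%:R * (M%:R * co AR s (col l AR) j +
    co AR s (col l AR) j * X%:R ^+ (j : nat)))); last first.
    by move=> j _; rewrite natrM natrD natrX; ring.
  by rewrite -mulr_sumr big_split /= -mulr_sumr; ring.
have intS s l : basis AR s -> exists z : int, D%:R * (\sum_j co AR s (col l AR) j - 1) = z%:~R.
  move=> bs; have /choice[z zE] : forall j, exists z : int, D%:R * co AR s (col l AR) j = z%:~R.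
    by move=> j; rewrite colE; apply: DP.
  exists (\sum_j z j - D%:Z); rewrite mulrBr mulr1 mulr_sumr intrB rmorph_sum /= -pmulrn.
  by congr (_ - _); apply: eq_bigr => j _.
(* A coordinate sum other than 1 differs from 1 by at least [1/D], which tells how large M has to
   be. *)
have gap s l : basis AR s -> \sum_j co AR s (col l AR) j != 1 ->
    `|err s l| < M%:R * `|\sum_j co AR s (col l AR) j - 1|.
  move=> bs S1; have [z zE] := intS s l bs.
  have z0 : z != 0.
    by apply: contraNneq S1 => z0; move/eqP: zE; rewrite z0 mulf_eq0 gt_eqF //= subr_eq0.
  have : D%:R * `|\sum_j co AR s (col l AR) j - 1| >= 1.
    rewrite -{1}(gtr0_norm DR) -normrM zE -intr_norm -[1]/(1%:~R) ler_int; lia.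
  have /= := MP (s, l); set e := `|err s l|; set S := `|_|.
  have e0 : 0 <= e by exact: normr_ge0.
  have S0 : 0 <= S by exact: normr_ge0.
  move=> h1 h2; apply: (@le_lt_trans _ _ (e * (D%:R * S))).
    by rewrite ler_peMr.
  have Sp : 0 < S by rewrite lt_neqAle S0 andbT; apply: contraTneq h2 => <-; rewrite mulr0 -ltNge.
  by rewrite mulrCA mulrA ltr_pM2r.
have Pnz s l : basis AR s -> l \notin s -> err s l != 0.
  move=> bs ls; have := XP (s, l); rewrite /P /= bs ls /= !hornerE horner_sum.
  by rewrite /err; under eq_bigr do rewrite !hornerE.
split.
- move=> s l bs ls; rewrite -subr_eq0 costE mulf_neq0 //; first by rewrite gt_eqF.
  have [S1|S1] := eqVneq (\sum_j co AR s (col l AR) j) 1.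
    by rewrite S1 subrr mulr0 sub0r oppr_eq0 Pnz.
  rewrite subr_eq0; apply: contraTneq (gap s l bs S1) => <-.
  by rewrite normrM normr_nat ltxx.
- move=> s j bs js; have := YP (s, j); rewrite /Q /= bs js /= horner_sum co_sum.
  by congr (_ != _); apply: eq_bigr => k _; rewrite !hornerE coZ mulrC.
- exists (\col_(k < n) Y%:R ^+ (k : nat)); split; first by move=> j; rewrite mxE exprn_ge0.
  by rewrite mulmx_sum_col; apply: eq_bigr => j _; rewrite mxE.
- move=> s b bs; have /choice[z zE] : forall j, exists z : int, D%:R * co AR s (map_mx intr b) j = z%:~R.
    by move=> j; apply: DP.
  exists (\sum_(j < n) (M + X ^ j)%:Z * z j); rewrite rmorph_sum /=; apply: eq_bigr => j _.
  by rewrite intrM -zE natrM -pmulrn; ring.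
- move=> s l fs; have bs := fan_basis fs; rewrite leNgt; apply/negP => S1.
  have ls : l \notin s.
    apply: contraTN S1 => ls; rewrite (bigD1 l) //= co_col // eqxx big1 ?addr0 ?ltxx // => j jl.
    by rewrite co_col // (negPf jl).
  have := cost_col_lt fs ls; rewrite -subr_lt0 costE pmulr_rlt0 // subr_lt0.
  have := gap s l bs; rewrite gt_eqF // => /(_ isT).
  rewrite (gtr0_norm (_ : 0 < _ - 1)) ?subr_gt0 // => h1 h2.
  by have := lt_trans h1 h2; rewrite ltNge ler_norm.
Qed.

End Weights.

(** * The limit system *)

Section Semigroup.
Variables (d n : nat) (A : 'M[int]_(d, n)).

Definition lcomb (u : {ffun 'I_n -> nat}) : 'cV[int]_d := \sum_j col j A *+ u j.
Definition NA (b : 'cV[int]_d) : bool := `[< exists u, b = lcomb u >].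

Lemma NAP b : reflect (exists u, b = lcomb u) (NA b).
Proof. exact: asboolP. Qed.

Lemma NA_lcomb u : NA (lcomb u). Proof. by apply/NAP; exists u. Qed.

Lemma lcombD (u v : {ffun 'I_n -> nat}) : lcomb [ffun j => u j + v j]%N = lcomb u + lcomb v.
Proof. by rewrite /lcomb -big_split; apply: eq_bigr => j _; rewrite ffunE mulrnDr. Qed.

Lemma lcomb0 : lcomb [ffun=> 0%N] = 0.
Proof. by rewrite /lcomb big1 // => j _; rewrite ffunE. Qed.

Lemma lcomb1 k : lcomb [ffun j => (j == k) : nat] = col k A.
Proof.
rewrite /lcomb (bigD1 k) //= ffunE eqxx big1 ?addr0 // => j jk.
by rewrite ffunE (negPf jk).
Qed.

Lemma NA0 : NA 0. Proof. by rewrite -lcomb0; apply: NA_lcomb. Qed.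
Lemma NA_col k : NA (col k A). Proof. by rewrite -lcomb1; apply: NA_lcomb. Qed.
Lemma NAD b b' : NA b -> NA b' -> NA (b + b').
Proof. by move=> /NAP[u ->] /NAP[v ->]; rewrite -lcombD; apply: NA_lcomb. Qed.
Lemma NA_mul b m : NA b -> NA (b *+ m).
Proof.
by move=> h; elim: m => [|m IH]; rewrite ?mulr0n ?NA0 // mulrS NAD.
Qed.
Lemma NA_sum I (r : seq I) (F : I -> 'cV[int]_d) : (forall i, NA (F i)) ->
  NA (\sum_(i <- r) F i).
Proof.
by move=> h; elim/big_ind: _ => // [|x y]; [exact: NA0|exact: NAD].
Qed.

End Semigroup.

Section Limit.
Variables (R : realType) (d n : nat) (A : 'M[int]_(d, n)).
Variables (w : 'I_n -> R) (q : 'cV[R]_d) (beta : 'I_d -> R[i]).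
Let AR : 'M[R]_(d, n) := map_mx intr A.
Notation L := 'cV[int]_d.
Notation rc := (real_complex R).
Implicit Types (s : {set 'I_n}) (b : L).

Definition toR b : 'cV[R]_d := map_mx intr b.
Definition cz s b j : R := co AR s (toR b) j.
Lemma czE s b j : cz s b j = co AR s (toR b) j. Proof. by []. Qed.
Definition Fan s := fan AR w s.
Definition Cone s b := incone AR s (toR b).
Lemma ConeE s b : Cone s b = incone AR s (toR b). Proof. by []. Qed.
Definition Hopen s b := hopen AR q s (toR b).

(* [b] and [a_k] lie in a common cell. *)
Definition star b k : bool := [exists s, [&& Fan s, Cone s b & k \in s]].

(* The j-th coordinate of beta - b in the basis [s]; by [limsol_step] it is the factor by
   which a solution of the limit system is multiplied from b to b + a_j. *)
Definition gam s b j : R[i] :=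
  \sum_i rc (coordmx AR s j i) * (beta i - (b i 0)%:~R).

(* The Euler equations in the limit t -> 0 along the curve p_k = t^(w_k), where only
   the terms with [star b k] survive. *)
Definition limsol (u : L -> R[i]) := forall b, NA A b -> forall i,
  \sum_(k | star b k) (A i k)%:~R * u (b + col k A) = (beta i - (b i 0)%:~R) * u b.

Lemma toRD b b' : toR (b + b') = toR b + toR b'.
Proof. by rewrite /toR map_mxD. Qed.
Lemma toR_col k : toR (col k A) = col k AR.
Proof. by rewrite /toR map_col. Qed.
Lemma toR_inj : injective toR.
Proof. by move=> b b' /matrixP h; apply/matrixP => i j; have := h i j; rewrite !mxE => /intr_inj. Qed.

Lemma czD s b b' j : cz s (b + b') j = cz s b j + cz s b' j.
Proof. by rewrite /cz toRD coD. Qed.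
Lemma czB s b b' j : cz s (b - b') j = cz s b j - cz s b' j.
Proof. by rewrite /cz /toR map_mxB coB. Qed.
Lemma cz0 s j : cz s 0 j = 0.
Proof. by rewrite /cz /toR map_mx0 co0. Qed.
Lemma czMn s b m j : cz s (b *+ m) j = cz s b j *+ m.
Proof. by elim: m => [|m IH]; rewrite ?mulr0n ?cz0 // !mulrS czD IH. Qed.
Lemma cz_sum s I (r : seq I) (Q : pred I) (F : I -> L) j :
  cz s (\sum_(i <- r | Q i) F i) j = \sum_(i <- r | Q i) cz s (F i) j.
Proof. by apply: (big_morph (fun b => cz s b j)) => [b b'|]; rewrite ?czD ?cz0. Qed.
Lemma cz_col s k j : basis AR s -> k \in s -> cz s (col k A) j = (j == k)%:R.
Proof. by move=> bs ks; rewrite /cz toR_col co_col. Qed.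
Lemma cz_inj s b b' : basis AR s -> (forall j, j \in s -> cz s b j = cz s b' j) -> b = b'.
Proof. by move=> bs h; apply: toR_inj; apply: (co_inj bs). Qed.

Lemma gamE s b j : gam s b j = \sum_i rc (coordmx AR s j i) * beta i - rc (cz s b j).
Proof.
rewrite /gam /cz /co mxE rmorph_sum -sumrB; apply: eq_bigr => i _.
by rewrite mulrBr /= rmorphM /= mxE rmorph_int.
Qed.

Lemma gamD s b b' j : gam s (b + b') j = gam s b j - rc (cz s b' j).
Proof. by rewrite !gamE czD rmorphD /= opprD addrA. Qed.

Lemma Fan_basis s : Fan s -> basis AR s. Proof. exact: fan_basis. Qed.

Lemma Cone_add s b k : Fan s -> Cone s b -> k \in s -> Cone s (b + col k A).
Proof.
move=> fs /forallP h ks; apply/forallP => j.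
by rewrite -[co _ _ _ _]/(cz s _ _) czD cz_col ?Fan_basis // addr_ge0 // ?ler0n //; apply: h.
Qed.

Lemma Hopen_Cone s b : Fan s -> Hopen s b -> Cone s b.
Proof. by move=> fs; apply: hopen_incone; apply: Fan_basis. Qed.

Lemma Hopen_add s b k : Fan s -> Hopen s b -> k \in s -> Hopen s (b + col k A).
Proof.
move=> fs /forallP h ks; apply/forallP => j; apply/implyP => js.
have := h j; rewrite js /= -![co _ _ (toR _) _]/(cz s _ _) czD cz_col ?Fan_basis //.
case: (j =P k) => [_|_]; last by rewrite addr0.
by move=> /orP[h1|/andP[/eqP -> _]]; rewrite ?add0r ?ltr01 // addr_gt0.
Qed.

(** The coordinates of [b + a_k] in the two cells agree by [co_uniq]. Those of b and of [a_k] in s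
    are nonnegative, so nothing cancels and both supports lie in s'. *)
Lemma star_cone b k s' : star b k -> Fan s' -> Cone s' (b + col k A) ->
  Cone s' b /\ k \in s'.
Proof.
move=> /existsP[s /and3P[fs hb ks]] fs' h'.
have bs := Fan_basis fs; have bs' := Fan_basis fs'.
have E := co_uniq fs fs' (Cone_add fs hb ks) h'.
have sup j : j \notin s' -> cz s (b + col k A) j = 0.
  by move=> js'; rewrite /cz E co_notin.
have cb j : 0 <= cz s b j by move/forallP: hb => /(_ j).
split; last first.
  apply: contraT => /sup; rewrite czD cz_col // eqxx => /eqP.
  by rewrite gt_eqF // ltr_wpDl.
apply/forallP => j; rewrite -(@co_supp_eq _ _ _ _ s) //; first exact: cb.
move=> i ci.
apply: contraT => /sup; rewrite czD cz_col // => /eqP.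
by rewrite gt_eqF // ltr_pwDl // ler0n.
Qed.

(** Row j of [coordmx] applied to the equations at b isolates [u (b + a_j)] among the columns of the
    cell; columns outside the cell survive as corrections. *)
Lemma limsol_coord u s b j : limsol u -> Fan s -> NA A b -> j \in s -> Cone s b ->
  u (b + col j A) + \sum_(k | star b k && (k \notin s))
     rc (co AR s (col k AR) j) * u (b + col k A) = gam s b j * u b.
Proof.
move=> lu fs Nb js hb; have bs := Fan_basis fs.
have starS k : k \in s -> star b k by move=> ks; apply/existsP; exists s; rewrite fs hb ks.
transitivity (\sum_i rc (coordmx AR s j i) *
   \sum_(k | star b k) (A i k)%:~R * u (b + col k A)); last first.
  by rewrite /gam mulr_suml; apply: eq_bigr => i _; rewrite lu // mulrA.
under [RHS]eq_bigr do rewrite mulr_sumr.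
rewrite exchange_big /=.
have E k : \sum_i rc (coordmx AR s j i) * ((A i k)%:~R * u (b + col k A)) =
    rc (co AR s (col k AR) j) * u (b + col k A).
  rewrite /co mxE rmorph_sum mulr_suml; apply: eq_bigr => i _ /=.
  by rewrite mulrA rmorphM /= !mxE rmorph_int.
under [RHS]eq_bigr do rewrite E.
rewrite [RHS](bigID (mem s)) /=; congr (_ + _).
rewrite (bigD1 j) /= ?starS // big1 ?addr0.
  by rewrite co_col // eqxx rmorph1 mul1r.
move=> k /andP[/andP[_ ks] kj].
by rewrite co_col // eq_sym (negPf kj) rmorph0 mul0r.
Qed.

(** Each correction sits in a half-open cell that is cheaper at q by [hopen_lt], where u is already
    known to vanish. *)
Lemma limsol_step u s b j : limsol u -> Fan s -> NA A b -> Hopen s b -> j \in s ->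
  (forall x : L, NA A x -> (exists t, [/\ Fan t, Hopen t x & cost AR w t q < cost AR w s q]) ->
     u x = 0) ->
  (forall x : L, NA A x -> exists2 t, Fan t & Hopen t x) ->
  u (b + col j A) = gam s b j * u b.
Proof.
move=> lu fs Nb hb js low cov.
rewrite -(limsol_coord lu fs Nb js (Hopen_Cone fs hb)) big1 ?addr0 // => k /andP[sk ks].
rewrite low ?mulr0 ?NAD ?NA_col //.
have [|t ft ht] := cov (b + col k A); first by rewrite NAD ?NA_col.
have [ht' kt] := star_cone sk ft (Hopen_Cone ft ht).
exists t; split=> //; apply: hopen_lt hb ht' => //.
by apply: contraNneq ks => ->.
Qed.

Definition cong s b b' := forall j, j \in s -> exists z : int, cz s b j - cz s b' j = z%:~R.

(* A zero factor has been crossed on the way to [b] exactly when j is in [pset s b]. *)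
Definition pset s b : {set 'I_n} :=
  [set j in s | `[< exists t : nat, gam s b j = - t.+1%:R >]].

Lemma psetP s b j : reflect (j \in s /\ exists t : nat, gam s b j = - t.+1%:R) (j \in pset s b).
Proof. by rewrite inE; apply: (iffP andP) => -[-> /asboolP]. Qed.

Section Piece.
Variables (u : L -> R[i]) (s : {set 'I_n}).
Hypothesis fs : Fan s.
Hypothesis step : forall b j, NA A b -> Hopen s b -> j \in s ->
  u (b + col j A) = gam s b j * u b.
Let bs := Fan_basis fs.

Lemma mul_step b j m : NA A b -> Hopen s b -> j \in s ->
  [/\ u (b + col j A *+ m) = (\prod_(t < m) (gam s b j - t%:R)) * u b,
    NA A (b + col j A *+ m) & Hopen s (b + col j A *+ m)].
Proof.
move=> Nb hb js; elim: m => [|m [IH1 IH2 IH3]].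
  by rewrite mulr0n addr0 big_ord0 mul1r.
rewrite mulrSr addrA; split.
- rewrite step // IH1 big_ord_recr /= mulrA [_ * (gam s b j - _)]mulrC; congr (_ * _ * _).
  by rewrite gamD czMn cz_col // eqxx rmorph_nat.
- by rewrite NAD ?NA_col.
- exact: Hopen_add.
Qed.

Lemma seq_step (l : seq 'I_n) b (m : 'I_n -> nat) : NA A b -> Hopen s b ->
  uniq l -> {subset l <= s} ->
  [/\ u (b + \sum_(j <- l) col j A *+ m j) =
        (\prod_(j <- l) \prod_(t < m j) (gam s b j - t%:R)) * u b,
    NA A (b + \sum_(j <- l) col j A *+ m j) & Hopen s (b + \sum_(j <- l) col j A *+ m j)].
Proof.
move=> Nb hb; elim: l => [|i l IH] /=; first by rewrite !big_nil addr0 mul1r.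
move=> /andP[il ul] sub; have is_ : i \in s by rewrite sub ?mem_head.
have [|IH1 IH2 IH3] := IH ul; first by move=> x xl; rewrite sub // inE xl orbT.
rewrite big_cons addrCA addrC; have [S1 S2 S3] := mul_step (m i) IH2 IH3 is_.
split=> //; rewrite S1 IH1 big_cons mulrA; congr (_ * _ * _).
apply: eq_bigr => t _; congr (_ - _).
rewrite gamD cz_sum big_seq big1 ?rmorph0 ?subr0 // => j jl.
have js : j \in s by rewrite sub // inE jl orbT.
have ij : (i == j) = false by apply: contraNF il => /eqP ->.
by rewrite czMn cz_col // ij mul0rn.
Qed.

(** Both points are moved inside the cell to the coordinatewise maximum of the two. A zero factor on
    the way from b would put its index into [pset s b'] but not into [pset s b], so the inclusion
    makes c nonzero. *)
Lemma join_step b b' : NA A b -> Hopen s b -> NA A b' -> Hopen s b' -> cong s b' b ->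
  pset s b' \subset pset s b ->
  exists2 c, c != 0 & c * u b =
    (\prod_(j in s) \prod_(t < `|Num.max 0%R (Num.floor (cz s b j - cz s b' j))|) (gam s b' j - t%:R)) * u b'.
Proof.
move=> Nb hb Nb' hb' cg sub.
have /choice[z zE] : forall j, exists z : int, j \in s -> cz s b' j - cz s b j = z%:~R.
  by move=> j; have [/cg[z]|_] := boolP (j \in s); [exists z|exists 0].
pose m j := `|Num.max 0%R (z j)|%N.
pose m' j := `|Num.max 0%R (Num.floor (cz s b j - cz s b' j))|%N.
have m'E j : j \in s -> m' j = `|Num.max 0%R (- z j)|%N.
  by move=> js; rewrite /m' -opprB zE // -intrN intrKfloor.
have us : uniq (enum s) by apply: enum_uniq.
have ss : {subset enum s <= s} by move=> j; rewrite mem_enum.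
have [E1 _ _] := seq_step m Nb hb us ss.
have [E2 _ _] := seq_step m' Nb' hb' us ss.
exists (\prod_(j in s) \prod_(t < m j) (gam s b j - t%:R)).
  apply/prodf_neq0 => j js; apply/prodf_neq0 => t _; rewrite subr_eq0.
  move: (ltn_ord t); move: (nat_of_ord t) => {}t tm.
  apply/negP => /eqP gt.
  have mz : z j = m j by move: tm; rewrite /m; lia.
  have : j \in pset s b'.
    apply/psetP; split=> //; exists (m j - t.+1)%N.
    have -> : b' = b + (b' - b) by rewrite addrC subrK.
    rewrite gamD gt.
    have -> : cz s (b' - b) j = (m j)%:R.
      have := zE j js; rewrite mz -pmulrn => <-.
      by apply/eqP; rewrite eq_sym subr_eq -czD subrK.
    rewrite rmorph_nat (_ : m j = (t + (m j - t.+1).+1)%N); last by lia.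
    by rewrite [in LHS]natrD opprD addrA subrr sub0r; congr (- _%:R); lia.
  move=> /(fintype.subsetP sub) /psetP[_ [t']]; rewrite gt => /eqP.
  by rewrite -subr_eq0 opprK -natrD pnatr_eq0 addnS.
rewrite -!big_enum /= -[LHS]E1 -E2; congr u.
apply: (cz_inj bs) => i is_; rewrite !czD !cz_sum.
have D (f : 'I_n -> nat) : \sum_(j <- enum s) cz s (col j A *+ f j) i = (f i)%:R.
  rewrite (bigD1_seq i) //= ?mem_enum // czMn cz_col // eqxx big_seq_cond big1 ?addr0 //.
  move=> j /andP[js ji]; rewrite czMn cz_col ?ss // eq_sym (negPf ji) mul0rn //.
rewrite !D m'E // /m.
have key : cz s b' i - cz s b i =
    (`|Num.max 0%R (z i)|%N)%:R - (`|Num.max 0%R (- z i)|%N)%:R.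
  by rewrite zE // !pmulrn -intrB; congr (_%:~R); lia.
by move: key; lra.
Qed.

(** If b has crossed a zero that b' has not, the path from b' to the common point contains this zero
    factor, so u vanishes at b whatever its value at b'. *)
Lemma piece_zero b b' : NA A b -> Hopen s b -> NA A b' -> Hopen s b' -> cong s b' b ->
  pset s b' \subset pset s b -> u b' = 0 \/ pset s b' != pset s b -> u b = 0.
Proof.
move=> Nb hb Nb' hb' cg sub; have [c c0 E] := join_step Nb hb Nb' hb' cg sub.
suff h : u b' = 0 \/ pset s b' != pset s b -> c * u b = 0.
  by move=> /h /eqP; rewrite mulf_eq0 (negPf c0) => /eqP.
rewrite E => -[->|ne]; first by rewrite mulr0.
have [j jb jb'] : exists2 j, j \in pset s b & j \notin pset s b'.
  by apply/fintype.subsetPn; apply: contra ne => sub'; rewrite finset.eqEsubset sub.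
have [js [t gt]] := psetP _ _ _ jb.
have [z zE] := cg j js.
have gb' : gam s b' j = (- (t.+1%:Z) - z)%:~R.
  have -> : b' = b + (b' - b) by rewrite addrC subrK.
  rewrite gamD gt intrB intrN -pmulrn; congr (_ - _).
  have -> : cz s (b' - b) j = z%:~R by rewrite -zE; apply/eqP; rewrite eq_sym subr_eq -czD subrK.
  by rewrite rmorph_int.
have neg : 0 <= - t.+1%:Z - z.
  rewrite leNgt; apply: contra jb' => h; apply/psetP; split=> //.
  exists (absz (t.+1%:Z + z)%R).-1; rewrite gb' pmulrn -intrN; congr (_%:~R); lia.
apply/eqP; rewrite mulf_eq0; apply/orP; left; apply/eqP.
rewrite (bigD1 j) //=; apply/eqP; rewrite mulf_eq0; apply/orP; left.
have -> : Num.floor (cz s b j - cz s b' j) = - z.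
  by rewrite -opprB zE -intrN intrKfloor.
have lt : (absz (- t.+1%:Z - z)%R < absz (Num.max 0 (- z))%R)%N by lia.
have e0 : gam s b' j - (absz (- t.+1%:Z - z)%R)%:R = 0.
  by apply/eqP; rewrite gb' pmulrn -intrB intr_eq0; lia.
by rewrite (bigD1 (Ordinal lt)) //= e0 mul0r.
Qed.

End Piece.

(** Induction on the number of cells that are cheaper at q. Within one cell [piece_zero] carries the
    vanishing from the representatives to all points. *)
Lemma limsol_det (reps : {set 'I_n} -> seq L) u :
  (forall x : L, NA A x -> exists2 t, Fan t & Hopen t x) ->
  (forall s b, Fan s -> NA A b -> Hopen s b ->
     exists b', [/\ NA A b', Hopen s b', cong s b' b, pset s b' \subset pset s b &
       (b' \in reps s) || (pset s b' != pset s b)]) ->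
  limsol u -> (forall s r, Fan s -> r \in reps s -> u r = 0) ->
  forall b, NA A b -> u b = 0.
Proof.
move=> cov rep lu ur.
suff H m s b : (#|[set t | Fan t && (cost AR w t q < cost AR w s q)%R]| < m)%N -> Fan s ->
    NA A b -> Hopen s b -> u b = 0.
  by move=> b Nb; have [s fs hb] := cov b Nb; apply: (H _ s b (ltnSn _)).
elim: m s b => // m IH s b; rewrite ltnS => lem fs Nb hb.
have [b' [Nb' hb' cg sub alt]] := rep s b fs Nb hb.
apply: (@piece_zero u s fs _ b b') => //; last first.
  by case/orP: alt => h; [left; apply: ur h|right].
move=> x j Nx hx js; apply: (limsol_step lu) => // y Ny [t [ft hty lt]].
apply: (IH t) => //; apply: leq_trans lem; apply: proper_card.
apply/fintype.properP; split.
  by apply/fintype.subsetP => v; rewrite !inE => /andP[-> h]; apply: lt_trans lt.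
by exists t; rewrite inE ft ?lt // ltxx.
Qed.

End Limit.

(* The subsets of a set with at most three elements split into that many chains. *)
Lemma card_antichain3 (T : finType) (J : {set T}) (F : {set {set T}}) :
  (0 < #|J| <= 3)%N -> (forall P, P \in F -> P \subset J) ->
  {in F &, forall P Q : {set T}, P \subset Q -> P = Q} -> (#|F| <= #|J|)%N.
Proof.
move=> /andP[J0 J3] sub anti.
have [x [y [z [xJ Jxyz]]]] : exists x y z, x \in J /\ J \subset [set x; y; z].
  case E : (enum J) => [|x l]; first by move: J0; rewrite cardE E.
  exists x, (nth x l 0), (nth x l 1); split; first by rewrite -mem_enum E mem_head.
  apply/fintype.subsetP => t; rewrite -mem_enum E !inE => /orP[/eqP->|tl]; first by rewrite eqxx.
  have : (size l <= 2)%N by move: J3; rewrite cardE E.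
  case: l tl {E} => [//|a [|b [|//]]] /=; rewrite !inE => /= tl _.
    by rewrite tl orbT.
  by case/orP: tl => ->; rewrite ?orbT.
(* [f] labels the chains: {y}, {y,z} under y; {z}, {x,z} under z; the empty set, {x}, {x,y}, {x,y,z}
   under x. *)
pose f (P : {set T}) := if (y \in P) && (x \notin P) then y
  else if (z \in P) && (y \notin P) then z else x.
have memJ P t : P \in F -> t \in P -> t \in [set x; y; z].
  by move=> /sub PJ tP; apply: (fintype.subsetP Jxyz); apply: (fintype.subsetP PJ).
have incl (P Q : {set T}) : P \in F -> (x \in P -> x \in Q) -> (y \in P -> y \in Q) ->
    (z \in P -> z \in Q) -> P \subset Q.
  move=> PF hx hy hz; apply/fintype.subsetP => t tP.
  by have := memJ _ _ PF tP; rewrite !inE => /orP[/orP[]|] /eqP E; subst t; auto.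
rewrite -(card_in_imset (f := f)); last first.
  move=> P Q PF QF fPQ; have [PQ|PQ] : P \subset Q \/ Q \subset P; last 2 first.
  - exact: anti.
  - by apply/esym/anti.
  move: fPQ; rewrite /f.
  have := incl P Q PF; have := incl Q P QF.
  case: (boolP (x \in P)); case: (boolP (y \in P)); case: (boolP (z \in P));
  case: (boolP (x \in Q)); case: (boolP (y \in Q)); case: (boolP (z \in Q)) => /=;
  move=> a1 a2 a3 a4 a5 a6 h1 h2 E; try (by left; apply: h2); try (by right; apply: h1);
  exfalso; move: a1 a2 a3 a4 a5 a6 {h1 h2}; rewrite ?E; do ?case: (_ \in _) => //.
apply/subset_leq_card/fintype.subsetP => _ /imsetP[P PF ->]; rewrite /f.
by case: ifP => [/andP[yP _]|_]; [|case: ifP => [/andP[zP _]|_ //]]; apply: (fintype.subsetP (sub P PF)).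
Qed.

Section LatticePoints.
Variable d : nat.
Notation L := 'cV[int]_d.

Lemma lattice_enum (Q : pred L) (M : nat) : (forall b, Q b -> forall i, `|b i 0| <= M%:Z) ->
  exists2 l : seq L, uniq l & forall b, (b \in l) = Q b.
Proof.
move=> QM.
pose F (f : {ffun 'I_d -> 'I_(M + M).+1}) : L := \col_i ((f i : nat)%:Z - M%:Z).
exists [seq b <- undup [seq F f | f : {ffun 'I_d -> 'I_(M + M).+1}] | Q b].
  by rewrite filter_uniq // undup_uniq.
move=> b; rewrite mem_filter; have [Qb /=|//] := boolP (Q b).
rewrite mem_undup; apply/mapP.
exists [ffun i => inord (absz (b i 0 + M%:Z))]; first by rewrite mem_enum.
apply/colP => i; rewrite mxE ffunE; have := QM b Qb i => bM.
by rewrite inordK; move: bM; set x := b i 0; move: x => x; lia.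
Qed.
End LatticePoints.

(** * Counting the values that determine a solution of the limit system *)

Section Counting.
Variables (R : realType) (n : nat) (A : 'M[int]_(3, n)).
Variables (w : 'I_n -> R) (q : 'cV[R]_3) (beta : 'I_3 -> R[i]).
Let AR : 'M[R]_(3, n) := map_mx intr A.
Notation L := 'cV[int]_3.
Notation rc := (real_complex R).
Implicit Types (s P : {set 'I_n}) (b g : L).
Notation cz := (cz R A).
Notation cong := (cong R A).
Notation gam := (gam A beta).
Notation pset := (pset A beta).
Notation Hopen := (Hopen A q).
Notation Fan := (Fan A w).

Lemma lattice_bound s b (K : R) : basis AR s -> (forall j, `|cz s b j| <= K) ->
  forall i, (`|b i 0|%:~R : R) <= K * \sum_j \sum_i `|A i j|%:~R.
Proof.
move=> bs cK i.
have K0 : 0 <= K.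
  have [j _|] := pickP (mem s); first exact: le_trans (cK j).
  by move=> /eq_card0; rewrite (card_basis bs).
have -> : (`|b i 0|%:~R : R) = `|toR R b i 0| by rewrite mxE intr_norm.
rewrite (co_expand (toR R b) bs) summxE; apply: le_trans (ler_norm_sum _ _ _) _.
rewrite mulr_sumr; apply: ler_sum => j _; rewrite !mxE normrM.
apply: ler_pM => //; first exact: cK.
by rewrite -intr_norm (bigD1 i) //= lerDl sumr_ge0 // => k _; rewrite ler0z.
Qed.

Definition inbox s b := [forall j, (j \in s) ==> (0 <= cz s b j < 1)].

Lemma box_enum s : basis AR s ->
  exists2 l : seq L, uniq l & forall b, (b \in l) = inbox s b.
Proof.
move=> bs.
pose S : nat := (\sum_j \sum_i `|A i j|)%N.
apply: (@lattice_enum _ _ S) => b /forallP bb i.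
have H : forall j, `|cz s b j| <= 1.
  move=> j; have [js|js] := boolP (j \in s); last by rewrite /cz co_notin // normr0.
  by have := bb j; rewrite js /= => /andP[h1 h2]; rewrite ger0_norm // ltW.
have := lattice_bound bs H i; rewrite mul1r.
have -> : \sum_j \sum_i `|A i j|%:~R = (S%:Z)%:~R :> R.
  rewrite /S -!pmulrn natr_sum; apply: eq_bigr => j _; rewrite natr_sum.
  by apply: eq_bigr => k _; rewrite pmulrn abszE.
by rewrite ler_int.
Qed.

(** The half-open parallelepiped contains one point of each class modulo the lattice of the cell, so
    the length of this list is the index of the cell. *)
Definition boxseq s : seq L :=
  if pselect (exists2 l : seq L, uniq l & forall b, (b \in l) = inbox s b) is left h
  then projT1 (cid2 h) else [::].

Lemma boxseq_uniq s : basis AR s -> uniq (boxseq s).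
Proof.
by move=> bs; rewrite /boxseq; case: pselect => [h|/(_ (box_enum bs)) //]; case: cid2.
Qed.

Lemma mem_boxseq s b : basis AR s -> (b \in boxseq s) = inbox s b.
Proof.
move=> bs; rewrite /boxseq; case: pselect => [h|/(_ (box_enum bs)) //].
by case: cid2 => l /= _ ->.
Qed.

Lemma cong_sym s b b' : cong s b b' -> cong s b' b.
Proof. by move=> h j /h[z zE]; exists (- z); rewrite -opprB zE intrN. Qed.
Lemma cong_trans s b b' b'' : cong s b b' -> cong s b' b'' -> cong s b b''.
Proof.
move=> h h' j js; have [z zE] := h j js; have [z' zE'] := h' j js.
by exists (z + z'); rewrite intrD -zE -zE' addrA subrK.
Qed.

Definition boxof s b : L := b - \sum_(j in s) col j A *~ Num.floor (cz s b j).

Lemma czMz s b m j : cz s (b *~ m) j = cz s b j *~ m.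
Proof.
case: m => m; first by rewrite -!pmulrn czMn.
rewrite !NegzE !mulrNz -!pmulrn -czMn.
apply/eqP; rewrite -addr_eq0 addrC; apply/eqP.
by rewrite -czD subrr cz0.
Qed.

Lemma cz_comb s (z : 'I_n -> int) j : basis AR s -> j \in s ->
  cz s (\sum_(k in s) col k A *~ z k) j = (z j)%:~R.
Proof.
move=> bs js; rewrite cz_sum (bigD1 j) //= czMz cz_col // eqxx big1 ?addr0 //.
by move=> k /andP[ks kj]; rewrite czMz cz_col // eq_sym (negPf kj) mul0rz.
Qed.

Lemma cz_boxof s b j : basis AR s -> j \in s ->
  cz s (boxof s b) j = cz s b j - (Num.floor (cz s b j))%:~R.
Proof.
move=> bs js; rewrite -(cz_comb (fun k => Num.floor (cz s b k)) bs js) /boxof.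
by apply/eqP; rewrite eq_sym subr_eq -czD subrK.
Qed.

Lemma boxof_cong s b : basis AR s -> cong s (boxof s b) b.
Proof.
move=> bs j js; exists (- Num.floor (cz s b j)); rewrite cz_boxof // intrN.
by rewrite addrC addrA [- _ + _]addrC subrr sub0r.
Qed.

Lemma boxof_in s b : basis AR s -> boxof s b \in boxseq s.
Proof.
move=> bs; rewrite mem_boxseq //; apply/forallP => j; apply/implyP => js.
rewrite cz_boxof // subr_ge0 ge_floor /= ltrBlDl addrC -[1]/(1%:~R) -intrD.
by rewrite addrC floorD1_gt.
Qed.

Lemma inbox_cong s g g' : basis AR s -> inbox s g -> inbox s g' -> cong s g g' -> g = g'.
Proof.
move=> bs /forallP h /forallP h' cg; apply: (cz_inj bs) => j js.
have := h j; have := h' j; rewrite js /= => /andP[a1 a2] /andP[b1 b2].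
have [z zE] := cg j js.
have : `|z%:~R : R| < 1 by rewrite -zE ltr_norml; apply/andP; split; lra.
rewrite -intr_norm -[1]/(1%:~R) ltr_int => z1.
by apply/eqP; rewrite -subr_eq0 zE intr_eq0; lia.
Qed.

(* In the class of [g] modulo the sublattice of [s], the values of a solution at one point
   for each minimal [pset] determine it; these sets form an antichain. *)
Definition occ s g P : bool :=
  `[< exists b, [/\ NA A b, Hopen s b, cong s b g & pset s b = P] >].
Definition minocc s g : {set {set 'I_n}} :=
  [set P | occ s g P & [forall Q : {set 'I_n}, occ s g Q && (Q \subset P) ==> (Q == P)]].
Definition rep s g P : L :=
  if pselect (exists b, [/\ NA A b, Hopen s b, cong s b g & pset s b = P]) is left h
  then projT1 (cid h) else 0.
Definition reps s : seq L := [seq rep s g P | g <- boxseq s, P <- enum (minocc s g)].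

Lemma repP s g P : occ s g P ->
  [/\ NA A (rep s g P), Hopen s (rep s g P), cong s (rep s g P) g & pset s (rep s g P) = P].
Proof.
by move=> /asboolP h; rewrite /rep; case: pselect => // h'; exact: (projT2 (cid h')).
Qed.

Lemma size_reps s : size (reps s) = (\sum_(g <- boxseq s) #|minocc s g|)%N.
Proof.
rewrite /reps size_allpairs_dep sumnE big_map.
by apply: eq_bigr => g _; rewrite cardE.
Qed.

Lemma reps_cover s b : Fan s -> NA A b -> Hopen s b ->
  exists b', [/\ NA A b', Hopen s b', cong s b' b, pset s b' \subset pset s b &
       (b' \in reps s) || (pset s b' != pset s b)].
Proof.
move=> fs Nb hb; have bs := Fan_basis fs.
have cb : cong s b (boxof s b) by apply/cong_sym/boxof_cong.
have ob : occ s (boxof s b) (pset s b) by apply/asboolP; exists b; split.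
have [P /minsetP[oP minP] Pb] :
    {P | minset (occ s (boxof s b)) P & P \subset pset s b} by apply: minset_exists.
have [h1 h2 h3 h4] := repP oP.
exists (rep s (boxof s b) P); split=> //.
- exact: cong_trans h3 (cong_sym cb).
- by rewrite h4.
apply/orP; left; apply/allpairsPdep; exists (boxof s b), P; split=> //.
  exact: boxof_in.
rewrite mem_enum inE oP /=; apply/forallP => Q; apply/implyP => /andP[oQ QP].
by rewrite (minP Q oQ QP).
Qed.

Lemma minocc_anti s g : {in minocc s g &, forall P Q : {set 'I_n}, P \subset Q -> P = Q}.
Proof.
move=> P Q; rewrite !inE => /andP[oP _] /andP[_ /forallP/(_ P)/implyP h] PQ.
by apply/eqP/h; rewrite oP PQ.
Qed.

Definition intset s g : {set 'I_n} := [set j in s | `[< exists z : int, gam s g j = z%:~R >]].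

Lemma minocc_sub s g P : basis AR s -> P \in minocc s g -> P \subset intset s g.
Proof.
move=> bs; rewrite inE => /andP[/asboolP[b [Nb hb cb <-]] _].
apply/fintype.subsetP => j /psetP[js [t tE]]; rewrite inE js; apply/asboolP.
have [z zE] := cb j js; exists (z - t.+1%:Z).
have -> : g = b + (g - b) by rewrite addrC subrK.
rewrite gamD tE intrB -pmulrn addrC; congr (_ - _).
have -> : z%:~R = rc (z%:~R) by rewrite rmorph_int.
by rewrite -rmorphN /= -zE czB opprB.
Qed.

(** [gam] decreases as the coordinates grow, so the crossed set of a least point is contained in all
    the others of its class. *)
Lemma minocc_le1 s g b0 : NA A b0 -> Hopen s b0 -> cong s b0 g ->
  (forall b, NA A b -> Hopen s b -> cong s b g -> forall j, j \in s -> cz s b0 j <= cz s b j) ->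
  (#|minocc s g| <= 1)%N.
Proof.
move=> N0 h0 c0 least; apply/card_le1_eqP.
suff H P : P \in minocc s g -> P = pset s b0 by move=> P Q /H-> /H->.
rewrite inE => /andP[/asboolP[b [Nb hb cb Pb]] /forallP/(_ (pset s b0))/implyP h].
apply/esym/eqP/h/andP; split; first by apply/asboolP; exists b0; split.
rewrite -Pb; apply/fintype.subsetP => j /psetP[js [t tE]]; apply/psetP; split=> //.
have [z zE] := cong_trans cb (cong_sym c0) js.
have z0 : 0 <= z by have := least b Nb hb cb j js; rewrite -subr_ge0 zE ler0z.
exists (t + absz z)%N.
have -> : b = b0 + (b - b0) by rewrite addrC subrK.
rewrite gamD tE.
have -> : cz s (b - b0) j = z%:~R.
  by rewrite -zE czB.
rewrite rmorph_int -addSn natrD opprD; congr (_ - _).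
by rewrite pmulrn; congr (_%:~R); lia.
Qed.

Lemma minocc_le3 s g : basis AR s -> (#|minocc s g| <= 3)%N.
Proof.
move=> bs; rewrite -(card_basis bs); apply: card_antichain3.
- by rewrite (card_basis bs).
- move=> P /(minocc_sub bs) h; apply: fintype.subset_trans h _.
  by apply/fintype.subsetP => j; rewrite inE => /andP[].
- exact: minocc_anti.
Qed.

Lemma minocc_le2 s g j : basis AR s -> j \in s -> (forall P, P \in minocc s g -> j \notin P) ->
  (#|minocc s g| <= 2)%N.
Proof.
move=> bs js notj.
have c2 : #|s :\ j| = 2%N by have := cardsD1 j s; rewrite js (card_basis bs) => -[].
rewrite -c2; apply: card_antichain3; first by rewrite c2.
- move=> P PF; apply/fintype.subsetP => i iP; rewrite !inE.
  have := fintype.subsetP (minocc_sub bs PF) _ iP; rewrite inE => /andP[-> _].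
  by rewrite andbT; apply: contraNneq (notj P PF) => <-.
- exact: minocc_anti.
Qed.

Lemma minocc_le2' s g j : basis AR s -> j \in s -> (forall P, P \in minocc s g -> j \in P) ->
  (#|minocc s g| <= 2)%N.
Proof.
move=> bs js allj.
have c2 : #|s :\ j| = 2%N by have := cardsD1 j s; rewrite js (card_basis bs) => -[].
have inj : {in minocc s g &, injective (fun P : {set 'I_n} => P :\ j)}.
  by move=> P Q PF QF /= E; rewrite -(finset.setD1K (allj P PF)) E finset.setD1K // allj.
rewrite -(card_in_imset inj) -c2; apply: card_antichain3; first by rewrite c2.
- move=> _ /imsetP[P PF ->]; apply: finset.setSD.
  apply/fintype.subsetP => i iP.
  by have := fintype.subsetP (minocc_sub bs PF) _ iP; rewrite inE => /andP[].
- move=> _ _ /imsetP[P PF ->] /imsetP[Q QF ->] PQ; congr (_ :\ _).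
  apply: (minocc_anti PF QF).
  by rewrite -(finset.setD1K (allj P PF)) -(finset.setD1K (allj Q QF)) finset.setUS.
Qed.

Definition beta_in s := exists b, (forall i, beta i = (b i 0)%:~R) /\ Hopen s b.

Lemma gam0_beta s b : basis AR s -> (forall j, j \in s -> gam s b j = 0) ->
  forall i, beta i = (b i 0)%:~R.
Proof.
move=> bs h i; apply/eqP; rewrite -subr_eq0; apply/eqP.
have [h1 h2 _] := coordmxP bs.
have h' j : gam s b j = 0.
  have [/h //|js] := boolP (j \in s).
  by rewrite /gam big1 // => k _; rewrite h1 // rmorph0 mul0r.
transitivity (\sum_j rc (AR i j) * gam s b j); last first.
  by rewrite big1 // => j _; rewrite h' mulr0.
rewrite /gam; under eq_bigr do rewrite mulr_sumr.
rewrite exchange_big /= (bigD1 i) //= [X in _ = _ + X]big1 ?addr0 => [|k ki].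
  under eq_bigr do rewrite mulrA -rmorphM.
  rewrite -mulr_suml -rmorph_sum /=.
  by have /matrixP/(_ i i) := h2; rewrite !mxE eqxx => ->; rewrite rmorph1 mul1r.
under eq_bigr do rewrite mulrA -rmorphM.
rewrite -mulr_suml -rmorph_sum /=.
by have /matrixP/(_ i k) := h2; rewrite !mxE eq_sym (negPf ki) => ->; rewrite rmorph0 mul0r.
Qed.

(** With three minimal sets, no index of s is missing from all of them or contained in all of them.
    The first fact makes every [gam s g j] an integer, so that beta is a lattice point of this
    class; the second gives for each j a point that has not passed the zero in direction j, which
    places beta in the half-open cone. *)
Lemma minocc_ge3 s g : basis AR s -> (2 < #|minocc s g|)%N -> intset s g = s /\ beta_in s.
Proof.
move=> bs c3.
have sE : intset s g = s.
  apply/eqP; rewrite finset.eqEsubset; apply/andP; split.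
    by apply/fintype.subsetP => j; rewrite inE => /andP[].
  apply/fintype.subsetP => j js; apply: contraLR c3 => jJ; rewrite -leqNgt.
  apply: (minocc_le2 bs js) => P /(minocc_sub bs) PJ; apply: contra jJ.
  exact: (fintype.subsetP PJ).
split=> //.
have /choice[z zE] : forall j, exists z : int, j \in s -> gam s g j = z%:~R.
  move=> j; have [js|js] := boolP (j \in s); last by exists 0.
  by move: js; rewrite -{1}sE inE => /andP[_ /asboolP[z]]; exists z.
pose b0 : L := g + \sum_(k in s) col k A *~ z k.
have cb0 j : j \in s -> cz s b0 j = cz s g j + (z j)%:~R.
  by move=> js; rewrite /b0 czD cz_comb.
have g0 j : j \in s -> gam s b0 j = 0.
  by move=> js; rewrite /b0 gamD zE // cz_comb // rmorph_int subrr.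
exists b0; split; first exact: (gam0_beta bs).
apply/forallP => j; apply/implyP => js.
have /exists_inP[P PF jP] : [exists P in minocc s g, j \notin P].
  apply: contraLR c3 => /exists_inPn H; rewrite -leqNgt.
  by apply: (minocc_le2' bs js) => P /H; rewrite negbK.
move: PF; rewrite inE => /andP[/asboolP[b [Nb hb cb Pb]] _].
have [y yE] := cong_sym cb js.
have czb : cz s b0 j = cz s b j + (y + z j)%:~R.
  by rewrite cb0 // intrD -yE; lra.
have gb : gam s b j = (y + z j)%:~R.
  have -> : b = b0 + (b - b0) by rewrite addrC subrK.
  rewrite gamD g0 // sub0r -rmorphN /=.
  have -> : - cz s (b - b0) j = (y + z j)%:~R; last by rewrite rmorph_int.
  apply/eqP; rewrite eqr_oppLR; apply/eqP.
  have : cz s (b - b0) j + cz s b0 j = cz s b j by rewrite -czD subrK.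
  by rewrite czb; lra.
have y0 : 0 <= y + z j.
  rewrite leNgt; apply: contra jP => neg; rewrite -Pb; apply/psetP; split=> //.
  by exists (absz (y + z j)).-1; rewrite gb pmulrn -intrN; congr (_%:~R); lia.
move/forallP: hb => /(_ j); rewrite js /=.
rewrite -![co _ _ (toR R _) _]/(cz s _ _) czb.
have [->|ne] := eqVneq (y + z j) 0; first by rewrite addr0.
have y1 : 0 < (y + z j)%:~R :> R by rewrite ltr0z lt_neqAle eq_sym ne.
by move=> /orP[h|/andP[/eqP -> _]]; apply/orP; left; rewrite ?add0r // addr_gt0.
Qed.

(** Integrality of all factors says that the class is that of beta, and there is only one such
    class. *)
Lemma intset_full_uniq s g g' : basis AR s -> inbox s g -> inbox s g' ->
  intset s g = s -> intset s g' = s -> g = g'.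
Proof.
move=> bs bg bg' Eg Eg'; apply: inbox_cong bg bg' _ => // j js.
have := js; rewrite -{1}Eg inE => /andP[_ /asboolP[z zE]].
have := js; rewrite -{1}Eg' inE => /andP[_ /asboolP[z' zE']].
exists (z' - z); apply: complexI.
by rewrite rmorph_int intrB -zE -zE' !gamE rmorphB /=; ring.
Qed.

Lemma inbox0 s : inbox s 0.
Proof. by apply/forallP => j; rewrite cz0 lexx ltr01 implybT. Qed.

Lemma minocc0 s : Fan s -> (forall j, j \in s -> co AR s q j != 0) -> (#|minocc s 0%R| <= 1)%N.
Proof.
move=> fs gen_q; have bs := Fan_basis fs.
(* The least point of the class of 0 in the half-open cone: one column is added for each removed
   facet. *)
pose z j : int := if co AR s q j < 0 then 1 else 0.
pose b0 : L := \sum_(k in s) col k A *~ z k.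
have cb0 j : j \in s -> cz s b0 j = (z j)%:~R by move=> js; rewrite cz_comb.
apply: (@minocc_le1 s 0 b0).
- rewrite /b0 big_mkcond /=; apply: NA_sum => k; rewrite /z.
  by case: ifP => _; rewrite ?NA0 //; case: ifP => _; rewrite ?mulr1z ?mulr0z ?NA0 ?NA_col.
- apply/forallP => j; apply/implyP => js; rewrite -[co _ _ (toR R _) _]/(cz s _ _) cb0 // /z.
  have := gen_q j js; have [h _|h ne] := ltP (co AR s q j) 0; first by rewrite mulr1z ltr01.
  by rewrite mulr0z ltxx eqxx /= lt_neqAle eq_sym ne.
- by move=> j js; exists (z j); rewrite cz0 subr0 cb0.
- move=> b Nb hb cb j js; rewrite cb0 //.
  have [y] := cb j js; rewrite cz0 subr0 => yE.
  move/forallP: hb => /(_ j); rewrite js /= -[co _ _ (toR R _) _]/(cz s _ _) yE ler_int.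
  rewrite ltr0z intr_eq0 /z; have [h|h] := ltP (co AR s q j) 0.
    by rewrite [0 < co _ _ _ _]ltNge (ltW h) andbF orbF; lia.
  by move=> /orP[/ltW//|/andP[/eqP -> _]].
Qed.

(* At most one class needs three values, and the class of 0 needs only one. *)
Lemma count_le s : Fan s -> (forall j, j \in s -> co AR s q j != 0) ->
  [/\ (size (reps s) <= (size (boxseq s)).*2)%N,
      ~ beta_in s -> (size (reps s) < (size (boxseq s)).*2)%N &
      forall g, g \in boxseq s -> g != 0 -> (#|minocc s g| <= 1)%N ->
        (size (reps s) < (size (boxseq s)).*2)%N].
Proof.
move=> fs gen_q; have bs := Fan_basis fs.
have z_in : 0 \in boxseq s by rewrite mem_boxseq // inbox0.
have ub := boxseq_uniq bs.
pose small := count (fun g => #|minocc s g| <= 1)%N (boxseq s).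
pose big := count (fun g => 2 < #|minocc s g|)%N (boxseq s).
(* A class counts for two, with one more when it needs three values and one less when it needs at
   most one. *)
have E : (size (reps s) + small <= (size (boxseq s)).*2 + big)%N.
  rewrite size_reps /small /big; elim: (boxseq s) => [|g l IH]; first by rewrite big_nil.
  rewrite big_cons /=; have := minocc_le3 g bs; move: IH.
  by case: #|minocc s g| => [|[|[|[|]]]] //=; lia.
have big1 : (big <= 1)%N.
  rewrite /big -size_filter; case F : [seq _ <- _ | _] => [//|g [//|g' l]].
  have := filter_uniq (fun g => 2 < #|minocc s g|)%N ub; rewrite F /= inE negb_or.
  have : g \in [seq x <- boxseq s | (2 < #|minocc s x|)%N] by rewrite F mem_head.
  have : g' \in [seq x <- boxseq s | (2 < #|minocc s x|)%N] by rewrite F !inE eqxx orbT.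
  rewrite !mem_filter !mem_boxseq // => /andP[h1 i1] /andP[h2 i2].
  have [E1 _] := minocc_ge3 bs h1; have [E2 _] := minocc_ge3 bs h2.
  by rewrite (intset_full_uniq bs i2 i1 E2 E1) eqxx.
have small1 : (1 <= small)%N.
  by rewrite /small -has_count; apply/hasP; exists 0 => //; apply: minocc0.
split; first by lia.
- move=> nb; suff : big = 0%N by lia.
  apply/eqP; rewrite /big eqn0Ngt -has_count; apply/hasPn => g _.
  by apply/negP => /(minocc_ge3 bs)[].
- move=> g gin g0 gle; suff : (2 <= small)%N by lia.
  rewrite /small -size_filter; apply: (@uniq_leq_size _ [:: 0; g]).
    by rewrite /= inE eq_sym g0.
  move=> x; rewrite !inE mem_filter => /orP[] /eqP ->; rewrite ?z_in ?gin ?andbT //.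
  exact: minocc0.
Qed.

(** A cell whose half-open cone misses beta has the strict bound, so only a single cell containing
    beta remains. If its index is 1, a single value is counted. Otherwise some column outside its
    lattice supplies a second class that needs only one value. *)
Lemma total_count :
  (forall x : L, NA A x -> exists2 t, Fan t & Hopen t x) ->
  (forall s j, basis AR s -> j \in s -> co AR s q j != 0) ->
  (forall s l, Fan s -> \sum_j co AR s (col l AR) j <= 1) ->
  (forall b : L, exists lam : 'I_n -> int, b = \sum_l col l A *~ lam l) ->
  (\sum_(s | Fan s) size (reps s) < (\sum_(s | Fan s) size (boxseq s)).*2)%N.
Proof.
move=> cov gen_q col_le1 span.
suff [s fs lt] : exists2 s, Fan s & (size (reps s) < (size (boxseq s)).*2)%N.
  rewrite -muln2 big_distrl /= (bigD1 s) //= [ltnRHS](bigD1 s) //= -addSn.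
  apply: leq_add; first by rewrite muln2.
  apply: leq_sum => t /andP[ft _]; rewrite muln2.
  by have [] := count_le ft (fun j => gen_q t j (Fan_basis ft)).
have [s fs h0] := cov 0 (NA0 A); have bs := Fan_basis fs.
have [c1 c2 c3] := count_le fs (fun j => gen_q s j bs).
have [[b [bE hb]]|nb] := pselect (beta_in s); last by exists s => //; apply: c2.
have [[t [ft ts]]|H] := pselect (exists t, Fan t /\ t != s).
  have [d1 d2 d3] := count_le ft (fun j => gen_q t j (Fan_basis ft)).
  exists t => //; apply: d2 => -[b' [bE' hb']].
  have bb' : b' = b.
    by apply/colP => i; apply: (@intr_inj R[i]); rewrite -bE -bE'.
  by move: ts; rewrite bb' in hb'; rewrite (hopen_uniq ft fs hb' hb) eqxx.
have uni t : Fan t -> t = s.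
  by move=> ft; apply/eqP; apply: contraT => ts; case: H; exists t.
exists s => //.
have hop x : NA A x -> Hopen s x by move=> /cov[t /uni ->].
have [H1|/existsNP[l /existsNP[j0 /not_implyP[j0s nint]]]] :=
  pselect (forall l j, j \in s -> exists z : int, cz s (col l A) j = z%:~R).
  have box0 b0 : b0 \in boxseq s -> b0 = 0.
    rewrite mem_boxseq // => ib; apply: (inbox_cong bs ib (inbox0 s)) => j js.
    have [lam ->] := span b0; rewrite cz0 subr0 cz_sum.
    have /choice[z zE] : forall l, exists z : int, cz s (col l A) j = z%:~R by move=> l; apply: H1.
    exists (\sum_l z l * lam l); rewrite rmorph_sum /=; apply: eq_bigr => l _.
    by rewrite czMz zE intrM mulrzr.
  have sz : (size (boxseq s) <= 1)%N.
    apply: (@uniq_leq_size _ _ [:: 0]); first exact: boxseq_uniq.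
    by move=> x /box0 ->; rewrite inE.
  rewrite size_reps; case E : (boxseq s) sz => [|g [|//]] _.
    by have := boxof_in (0 : L) bs; rewrite E.
  rewrite big_seq1; have -> : g = 0 by apply: box0; rewrite E mem_head.
  by apply: leq_ltn_trans (minocc0 fs (fun j => gen_q s j bs)) _.
have al_ge0 j : 0 <= cz s (col l A) j.
  by have /forallP := Hopen_Cone fs (hop _ (NA_col A l)); apply.
(* The coordinates are nonnegative with sum at most 1, so a coordinate 1 would force the others to
   be 0 and all of them to be integers. With all coordinates below 1, the column is the least point
   of its class. *)
have al_lt1 j : j \in s -> cz s (col l A) j < 1.
  move=> js; rewrite ltNge; apply/negP => ge1; apply: nint.
  have := col_le1 s l fs; rewrite (bigD1 j) //=; rewrite -toR_col.
  rewrite -[co _ _ _ j]/(cz s (col l A) j) => le1.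
  have rest : \sum_(i < n | i != j) co AR s (toR R (col l A)) i = 0.
    apply/eqP; rewrite eq_le sumr_ge0 ?andbT; first by move: le1; lra.
    by move=> i _; apply: al_ge0.
  have [->|jj] := eqVneq j0 j.
    by exists 1; apply/eqP; rewrite eq_le ge1 andbT; move: le1; rewrite rest addr0.
  exists 0; apply/eqP; rewrite eq_le al_ge0 andbT mulr0z -[X in _ <= X]rest (bigD1 j0) //= lerDl.
  by apply: sumr_ge0 => i _; apply: al_ge0.
apply: (c3 (boxof s (col l A))); first exact: boxof_in.
- apply/eqP => E; apply: nint; have [z] := boxof_cong (col l A) bs j0s.
  by rewrite E cz0 sub0r => zE; exists (- z); rewrite intrN -zE opprK.
- apply: (@minocc_le1 _ _ (col l A)); first exact: NA_col.
  + exact/hop/NA_col.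
  + exact/cong_sym/boxof_cong.
  + move=> b0 N0 hb0 cb0 j js.
    have [y yE] := cong_trans cb0 (boxof_cong (col l A) bs) js.
    rewrite -subr_ge0 yE ler0z.
    have b00 : 0 <= cz s b0 j by have /forallP := Hopen_Cone fs hb0; apply.
    have : -1 < y%:~R :> R by rewrite -yE; have := al_lt1 j js; lra.
    by rewrite -[-1]/((-1)%:~R) ltr_int; lia.
Qed.

End Counting.

(** * Deformation to a generic point *)

Section Dickson.
Implicit Types (U : (nat -> nat) -> Prop).

Definition upclosed k U := forall u v, (forall j, (j < k)%N -> (u j <= v j)%N) -> U u -> U v.

(** Induction by slices in the last coordinate. The union of the slices is captured by finitely many
    bounded points, which all have appeared at one height [ts]; from there on the slices are equal,
    and each of the finitely many lower ones has its own bound. *)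
Lemma dickson k U : upclosed k U ->
  exists m, forall u, U u -> U (fun j => minn (u j) m).
Proof.
elim: k U => [|k IH] U upU; first by exists 0%N => u; apply: upU.
pose ext (x : nat -> nat) t j := if (j < k)%N then x j else t.
have upUt t : upclosed k (fun x => U (ext x t)).
  by move=> x y xy; apply: upU => j _; rewrite /ext; case: ifP => // /xy.
have /choice[mt mtP] := fun t => IH _ (upUt t).
have [|mi miP] := IH (fun x => exists t, U (ext x t)).
  by move=> x y xy [t h]; exists t; apply: upUt h.
pose efun (f : {ffun 'I_k -> 'I_mi.+1}) (j : nat) : nat :=
  if insub j is Some i then f i else 0%N.
have /choice[tau tauP] : forall f, exists t, (exists t', U (ext (efun f) t')) -> U (ext (efun f) t).
  by move=> f; have [[t h]|h] := pselect (exists t', U (ext (efun f) t')); [exists t|exists 0%N].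
pose ts := (\max_f tau f)%N.
have big x t : U (ext x t) -> U (ext (fun j => minn (x j) mi) ts).
  move=> h; have [|t' h'] := miP x; first by exists t.
  pose f := [ffun i : 'I_k => inord (minn (x i) mi) : 'I_mi.+1].
  have fE j : (j < k)%N -> efun f j = minn (x j) mi.
    by move=> jk; rewrite /efun insubT ffunE /= inordK // ltnS geq_minr.
  have : U (ext (efun f) (tau f)).
    by apply: tauP; exists t'; apply: upU h' => j _; rewrite /ext; case: ifP => // /fE ->.
  apply: upU => j _; rewrite /ext; case: ifP => [/fE -> //|_].
  exact: leq_bigmax.
pose m := maxn (maxn mi ts) (\max_(t < ts) mt t).
exists m => u Uu.
have hu : U (ext u (u k)).
  by apply: upU Uu => j; rewrite /ext ltnS leq_eqVlt; case: ifP => // jk; rewrite orbF => /eqP ->.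
have [tsk|kts] := leqP ts (u k).
  apply: upU (big _ _ hu) => j; rewrite /ext ltnS leq_eqVlt; case: ifP => [_ _|_].
    by rewrite /m; lia.
  by rewrite orbF => /eqP ->; rewrite /m; lia.
apply: upU (mtP _ _ hu) => j; rewrite /ext ltnS leq_eqVlt; case: ifP => [_ _|_].
  have : (mt (u k) <= \max_(t < ts) mt t)%N by apply: (leq_bigmax (Ordinal kts)).
  by rewrite /m; lia.
by rewrite orbF => /eqP ->; rewrite /m; lia.
Qed.
End Dickson.

(** * Finite linear systems and their stabilization *)

Lemma full_minor (K : fieldType) m N (G : 'M[K]_(N, m)) : row_free G ->
  exists g : 'I_N -> 'I_m, \det (colsub g G) != 0.
Proof.
move=> fG; have rk : \rank G^T == N by rewrite mxrank_tr.
exists (fullrankfun rk); have := fullrowsub_unit rk.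
by rewrite unitmxE unitfE -[\det (colsub _ _)]det_tr trmx_mxsub.
Qed.

Section FiniteSystems.
Variables (I : choiceType) (Bs : seq I) (E : finType).

Definition row_value (K : fieldType) (c : E -> I -> K) (e : E) (u : I -> K) : K :=
  \sum_(b <- Bs) c e b * u b.

Definition determined (K : fieldType) (c : E -> I -> K) :=
  forall u : I -> K, (forall e, row_value c e u = 0) -> forall b, b \in Bs -> u b = 0.

Section Matrix.
Variables (K : fieldType) (c : E -> I -> K).
Definition sysmx : 'M[K]_(size Bs, #|E|) :=
  \matrix_(k, e) c (enum_val e) (tnth (in_tuple Bs) k).

Lemma sysmxE (u : I -> K) e :
  ((\row_k u (tnth (in_tuple Bs) k)) *m sysmx) 0 e = row_value c (enum_val e) u.
Proof.
rewrite mxE /row_value (big_tnth _ _ Bs); apply: eq_bigr => k _.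
by rewrite !mxE mulrC.
Qed.

Lemma sysmx_determined : row_free sysmx -> determined c.
Proof.
move=> fr u h b bB.
have : (\row_k u (tnth (in_tuple Bs) k)) *m sysmx = 0.
  by apply/rowP => e; rewrite sysmxE h mxE.
move=> /eqP; rewrite mulmx_free_eq0 // => /eqP /rowP.
have /tnthP[k ->] : b \in in_tuple Bs by [].
by move=> /(_ k); rewrite !mxE.
Qed.

Lemma determined_sysmx : uniq Bs -> determined c -> row_free sysmx.
Proof.
move=> uB h; rewrite -kermx_eq0; apply/eqP/row_matrixP => i; rewrite row0.
pose v := row i (kermx sysmx).
have vS : v *m sysmx = 0 by rewrite -row_mul mulmx_ker row0.
pose u b : K := if insub (index b Bs) is Some k then v 0 k else 0.
have uE k : u (tnth (in_tuple Bs) k) = v 0 k.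
  rewrite /u (tnth_nth (tnth (in_tuple Bs) k)) /= index_uniq //.
  by rewrite insubT //= => lt; congr (v 0 _); apply: val_inj.
have vu : v = \row_k u (tnth (in_tuple Bs) k) by apply/rowP => k; rewrite [RHS]mxE uE.
have {}h := h u.
have h0 e : row_value c e u = 0.
  by rewrite -(enum_rankK e) -sysmxE -vu vS mxE.
apply/rowP => k; rewrite -/v [RHS]mxE -uE; apply: h => //.
exact: mem_tnth.
Qed.
End Matrix.

(** [D] is a maximal minor that is nonzero at [x0]. The clause on [Q] expresses that it is
    polynomial in the coefficients; it serves both for the parameter of the curve and for the point
    p. *)
Lemma open_determined (K : fieldType) (X : Type) (c : X -> E -> I -> K) (x0 : X) :
  uniq Bs -> determined (c x0) ->
  exists D : X -> K, [/\ D x0 != 0, forall x, D x != 0 -> determined (c x) &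
    forall Q : (X -> K) -> Prop, (forall k, Q (fun=> k)) ->
      (forall f g, Q f -> Q g -> Q (fun x => f x + g x)) ->
      (forall f g, Q f -> Q g -> Q (fun x => f x * g x)) ->
      (forall e b, Q (fun x => c x e b)) -> Q D].
Proof.
move=> uB h0; have [g gP] := full_minor (determined_sysmx uB h0).
exists (fun x => \det (colsub g (sysmx (c x)))); split=> //.
- move=> x dx; apply: sysmx_determined; rewrite -kermx_eq0.
  apply/eqP/row_matrixP => i; rewrite row0.
  set v := row _ _; have vS : v *m sysmx (c x) = 0 by rewrite -row_mul mulmx_ker row0.
  have : v *m colsub g (sysmx (c x)) = 0.
    by rewrite mulmx_colsub vS; apply/matrixP => a b; rewrite !mxE.
  by move=> /eqP; rewrite mulmx_free_eq0 ?row_free_unit ?unitmxE ?unitfE // => /eqP.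
- move=> Q Qk QD QM Qc.
  have Qsum J (r : seq J) (f : J -> X -> K) : (forall j, Q (f j)) ->
      Q (fun x => \sum_(j <- r) f j x).
    move=> Qf; elim: r => [|j r IH].
      by under eq_fun do rewrite big_nil.
    by under eq_fun do rewrite big_cons; apply: QD.
  have Qprod J (r : seq J) (f : J -> X -> K) : (forall j, Q (f j)) ->
      Q (fun x => \prod_(j <- r) f j x).
    move=> Qf; elim: r => [|j r IH].
      by under eq_fun do rewrite big_nil.
    by under eq_fun do rewrite big_cons; apply: QM.
  apply: Qsum => s; apply: QM => //; apply: Qprod => i.
  by under eq_fun do rewrite !mxE.
Qed.

Lemma bound_determined (K : numFieldType) (c : E -> I -> K) : uniq Bs -> determined c ->
  exists2 M : K, 0 <= M & forall (u : I -> K) (delta : K), 0 <= delta ->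
     (forall e, `|row_value c e u| <= delta) -> forall b, b \in Bs -> `|u b| <= M * delta.
Proof.
move=> uB /(determined_sysmx uB) /row_freeP[H GH].
exists (\sum_k \sum_e `|H e k|); first by do 2!(apply: sumr_ge0 => ? _).
move=> u delta d0 hd b bB; have /tnthP[k ->] : b \in in_tuple Bs by [].
pose v := \row_k u (tnth (in_tuple Bs) k).
have -> : u (tnth (in_tuple Bs) k) = ((v *m sysmx c) *m H) 0 k.
  by rewrite -mulmxA GH mulmx1 mxE.
rewrite mxE (le_trans (ler_norm_sum _ _ _)) // (bigD1 k) //= mulrDl mulr_suml.
rewrite -[leLHS]addr0 lerD //; last by apply: mulr_ge0 => //; do 2!(apply: sumr_ge0 => ? _).
apply: ler_sum => e _; rewrite normrM sysmxE mulrC.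
by rewrite ler_wpM2l.
Qed.
End FiniteSystems.

Section Subspaces.
Variables (K : fieldType) (m : nat).

Lemma subspace_mx (P : 'rV[K]_m -> Prop) : P 0 ->
  (forall a v w, P v -> P w -> P (a *: v + w)) ->
  exists M : 'M[K]_m, forall v, P v <-> (v <= M)%MS.
Proof.
move=> P0 PL.
pose good r := `[< exists M : 'M[K]_m, (forall v, (v <= M)%MS -> P v) /\ \rank M = r >].
have g0 : exists r, good r.
  exists 0%N; apply/asboolP; exists 0; split; last by rewrite mxrank0.
  by move=> v; rewrite submx0 => /eqP ->.
have gm r : good r -> (r <= m)%N by move=> /asboolP[M [_ <-]]; apply: rank_leq_col.
have [r /asboolP[M [MP rM]] rmax] := ex_maxnP g0 gm.
exists M => v; split=> [Pv|]; last exact: MP.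
have g' : good (\rank (M + v)%MS).
  apply/asboolP; exists (M + v)%MS; split=> // x /sub_addsmxP[[x1 x2] /= ->].
  have -> : x2 *m v = x2 0 0 *: v by rewrite {1}[x2]mx11_scalar mul_scalar_mx.
  rewrite addrC; apply: PL => //; apply: MP; exact: submxMl.
have := rmax _ g'; rewrite -rM => le.
have := geq_leqif (mxrank_leqif_sup (addsmxSl M v)); rewrite le => /esym h.
exact: submx_trans (addsmxSr M v) h.
Qed.

(** A member of least rank is equal to all later ones, so any nonzero vector in it is common to the
    whole chain. *)
Lemma decreasing_subspaces (P : nat -> 'rV[K]_m -> Prop) :
  (forall t, P t 0) ->
  (forall t a v w, P t v -> P t w -> P t (a *: v + w)) ->
  (forall t v, P t.+1 v -> P t v) ->
  (forall t, exists2 v, P t v & v != 0) ->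
  exists2 v, v != 0 & forall t, P t v.
Proof.
move=> P0 PL Pdec Pnz.
have /choice[M MP] := fun t => subspace_mx (P0 t) (PL t).
have Pmon t t' v : (t <= t')%N -> P t' v -> P t v.
  move=> /subnK <-; elim: (t' - t)%N => [//|k IH]; rewrite addSn => /Pdec; exact: IH.
have [r /asboolP[t0 rt0] rmin] := @ex_minnP (fun r => `[< exists t, \rank (M t) = r >])
  (ex_intro _ (\rank (M 0%N)) (introT (asboolP _) (ex_intro _ 0%N erefl))).
have [v Pv v0] := Pnz t0; exists v => // t.
have [tt0|t0t] := leqP t t0; first exact: Pmon Pv.
apply/MP; have sub : (M t <= M t0)%MS.
  by apply/rV_subP => x /MP h; apply/MP; apply: Pmon (ltnW t0t) h.
apply: submx_trans (_ : (M t0 <= M t)%MS); first exact/MP.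
have rr : (r <= \rank (M t))%N by apply: rmin; apply/asboolP; exists t.
by have := geq_leqif (mxrank_leqif_sup sub); rewrite rt0 rr => <-.
Qed.

End Subspaces.

Section Stabilization.
Variables (K : fieldType) (I : choiceType) (dom : nat -> pred I).
Variables (N : nat -> (I -> K) -> Prop) (B0 : seq I).
Hypothesis domS : forall t b, dom t b -> dom t.+1 b.
Hypothesis NS : forall t u, N t.+1 u -> N t u.
Hypothesis NL : forall t a u v, N t u -> N t v -> N t (fun b => a * u b + v b).
Hypothesis N0 : forall t, N t (fun=> 0).
Hypothesis Nloc : forall t u v, (forall b, dom t b -> u b = v b) -> N t u -> N t v.
Hypothesis B0dom : forall b, b \in B0 -> dom 0 b.
Hypothesis base : forall t u, N t u -> (forall b, b \in B0 -> u b = 0) ->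
  forall b, dom t b -> u b = 0.

(** If every truncation had a nonzero solution, restriction to [B0] would give a decreasing chain of
    nonzero subspaces with a common vector. Values on [B0] determine a truncated solution, so the
    lifts of this vector agree on common domains and glue to a nonzero full solution. *)
Lemma stabilize :
  (forall u, (forall t, N t u) -> forall t b, dom t b -> u b = 0) ->
  exists t, forall u, N t u -> forall b, dom t b -> u b = 0.
Proof.
move=> full; apply: contrapT => H.
have dmon t t' b : (t <= t')%N -> dom t b -> dom t' b.
  by move=> /subnK <-; elim: (t' - t)%N => [//|k IH] /IH; rewrite addSn; apply: domS.
have Nmon t t' u : (t <= t')%N -> N t' u -> N t u.
  by move=> /subnK <-; elim: (t' - t)%N => [//|k IH]; rewrite addSn => /NS; apply: IH.
pose res (u : I -> K) : 'rV[K]_(size B0) := \row_k u (tnth (in_tuple B0) k).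
have res0 u : res u = 0 <-> forall b, b \in B0 -> u b = 0.
  split=> [/rowP h b bB|h].
    have /tnthP[k ->] : b \in in_tuple B0 by [].
    by have := h k; rewrite !mxE.
  by apply/rowP => k; rewrite !mxE h // mem_tnth.
have resL a u v : res (fun b => a * u b + v b) = a *: res u + res v.
  by apply/rowP => k; rewrite !mxE.
have [|||t|v v0 Pv] := @decreasing_subspaces K _ (fun t v => exists2 u, N t u & v = res u).
- by move=> t; exists (fun=> 0) => //; apply/esym/res0.
- by move=> t a _ _ [u Nu ->] [v Nv ->]; exists (fun b => a * u b + v b); [apply: NL|rewrite resL].
- by move=> t _ [u Nu ->]; exists u => //; apply: NS.
- apply: contrapT => Hn; apply: H; exists t => u Nu; apply: base => //; apply/res0.
  apply/eqP; apply: contraT => nz; case: Hn; exists (res u) => //; by exists u.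
have /choice[U UP] : forall t, exists u, N t u /\ v = res u.
  by move=> t; have [u] := Pv t; exists u.
have compat t t' b : (t <= t')%N -> dom t b -> U t b = U t' b.
  move=> tt' db; have [Nt vt] := UP t; have [Nt' vt'] := UP t'.
  have := @base t (fun b => -1 * U t b + U t' b) (NL _ Nt (Nmon _ _ _ tt' Nt')).
  move=> /(_ _ b db) h; apply/esym/eqP; rewrite -subr_eq0 addrC -mulN1r; apply/eqP/h.
  by apply/res0; rewrite resL -vt -vt' scaleN1r addNr.
pose u b := if pselect (exists t, dom t b) is left h then U (projT1 (cid h)) b else 0.
have uE t b : dom t b -> u b = U t b.
  move=> db; rewrite /u; case: pselect => [h|[]]; last by exists t.
  case: cid => t' /= db'; have [tt'|/ltnW t't] := leqP t t'; first exact/esym/compat.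
  exact: compat.
have Nu t : N t u by have [Nt _] := UP t; apply: Nloc Nt => b /uE.
have u0 := full u Nu 0%N.
have [_ vE] := UP 0%N; move/eqP: v0; apply; rewrite vE; apply/res0 => b bB.
by rewrite -uE ?B0dom // u0 // B0dom.
Qed.

End Stabilization.

(** * The gauge of the polytope and the leading system *)

Section Gauge.
Variables (R : realType) (n : nat) (A : 'M[int]_(3, n)).
Variables (wn : 'I_n -> nat) (q : 'cV[R]_3).
Let AR : 'M[R]_(3, n) := map_mx intr A.
Notation L := 'cV[int]_3.
Notation C := R[i].
Notation rc := (real_complex R).
Let w j : R := (wn j)%:R.
Implicit Types (s : {set 'I_n}) (b : L).
Notation cz := (cz R A).
Notation Hopen := (Hopen A q).
Notation Fan := (Fan A w).
Notation Cone := (Cone R A).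
Notation star := (star A w).

Hypothesis cov : forall x : L, NA A x -> exists2 t, Fan t & Hopen t x.
Hypothesis col_le1 : forall s l, Fan s -> \sum_j co AR s (col l AR) j <= 1.
Hypothesis cost_int : forall s b, basis AR s -> exists z : int, cost AR w s (toR R b) = z%:~R.

Definition sel b : {set 'I_n} :=
  if [pick s | Fan s && Hopen s b] is Some s then s else finset.set0.
(* [psi] is the gauge of the polytope with vertices 0 and the rays of the cells; [phi] is the
   piecewise linear function interpolating the heights. *)
Definition psi b : R := \sum_j cz (sel b) b j.
Lemma psi_sel b : psi b = \sum_j cz (sel b) b j.
Proof. by []. Qed.
Definition phi b : int := Num.floor (cost AR w (sel b) (toR R b)).
Definition supp b : {set 'I_n} := [set j | 0 < cz (sel b) b j].

Lemma selP b : NA A b -> Fan (sel b) /\ Hopen (sel b) b.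
Proof.
move=> /cov[s fs hs]; rewrite /sel; case: pickP => [t /andP[]//|/(_ s)].
by rewrite fs hs.
Qed.

Lemma sel_cone b : NA A b -> Cone (sel b) b.
Proof. by move=> /selP[f h]; apply: Hopen_Cone f h. Qed.

Lemma cz_sel s b : NA A b -> Fan s -> Cone s b -> cz (sel b) b =1 cz s b.
Proof. by move=> Nb fs hb; have [f _] := selP Nb; apply: co_uniq f fs (sel_cone Nb) hb. Qed.

Lemma psiE s b : NA A b -> Fan s -> Cone s b -> psi b = \sum_j cz s b j.
Proof. by move=> Nb fs hb; apply: eq_bigr => j _; rewrite (cz_sel Nb fs hb). Qed.

Lemma suppE s b j : NA A b -> Fan s -> Cone s b -> (j \in supp b) = (0 < cz s b j).
Proof. by move=> Nb fs hb; rewrite inE (cz_sel Nb fs hb). Qed.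

Lemma phiE s b : NA A b -> Fan s -> Cone s b -> (phi b)%:~R = cost AR w s (toR R b).
Proof.
move=> Nb fs hb; have [fs' hs'] := selP Nb.
have [z zE] := cost_int b (Fan_basis fs'); rewrite /phi zE intrKfloor -zE.
by apply: eq_bigr => j _; rewrite (co_uniq fs' fs (sel_cone Nb) hb).
Qed.

(** In every cell the columns have coordinate sums at most 1, so no cell gives b a larger sum than
    its own. Thus [psi] is a maximum of linear functions, which makes it subadditive. *)
Lemma psi_le s b : NA A b -> Fan s -> \sum_j cz s b j <= psi b.
Proof.
move=> Nb fs; have [fs' _] := selP Nb; have h' := sel_cone Nb.
have bE := co_expand (toR R b) (Fan_basis fs').
rewrite [X in X <= _](eq_bigr (fun j => \sum_k cz (sel b) b k * co AR s (col k AR) j)).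
  rewrite exchange_big /=; apply: ler_sum => k _; rewrite -mulr_sumr ler_piMr ?col_le1 //.
  by have /forallP := h'; apply.
by move=> j _; rewrite {1}czE bE co_sum; apply: eq_bigr => k _; rewrite coZ.
Qed.

Lemma psiD_le b b' : NA A b -> NA A b' -> psi (b + b') <= psi b + psi b'.
Proof.
move=> Nb Nb'; have [fs _] := selP (NAD Nb Nb').
rewrite {1}/psi; under eq_bigr do rewrite czD.
by rewrite big_split; apply: lerD; apply: psi_le.
Qed.

Lemma psiD s b b' : NA A b -> NA A b' -> Fan s -> Cone s b -> Cone s b' ->
  psi (b + b') = psi b + psi b'.
Proof.
move=> Nb Nb' fs h h'.
have hD : Cone s (b + b').
  apply/forallP => j; rewrite -[co _ _ _ _]/(cz s _ _) czD addr_ge0 //.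
    by have /forallP := h; apply.
  by have /forallP := h'; apply.
rewrite (psiE (NAD Nb Nb') fs hD) (psiE Nb fs h) (psiE Nb' fs h') -big_split.
by apply: eq_bigr => j _; rewrite czD.
Qed.

Lemma psi_ge0 b : NA A b -> 0 <= psi b.
Proof.
by move=> Nb; apply: sumr_ge0 => j _; have /forallP := sel_cone Nb; apply.
Qed.

Lemma psi_col l : psi (col l A) <= 1.
Proof.
have [fs _] := selP (NA_col A l).
rewrite /psi; under eq_bigr do rewrite czE toR_col.
exact: col_le1.
Qed.

Lemma psi_step b k : NA A b -> psi (b + col k A) <= psi b + 1.
Proof. by move=> Nb; apply: le_trans (psiD_le Nb (NA_col A k)) _; rewrite lerD2l psi_col. Qed.

Lemma Cone_col s k : Fan s -> k \in s -> Cone s (col k A).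
Proof.
by move=> fs ks; apply/forallP => j; rewrite -[co _ _ _ _]/(cz s _ _) cz_col ?ler0n //; apply: Fan_basis fs.
Qed.

Lemma psi_col_eq s k : Fan s -> k \in s -> psi (col k A) = 1.
Proof.
move=> fs ks; rewrite (psiE (NA_col A k) fs (Cone_col fs ks)) (bigD1 k) //= big1 ?addr0.
  by rewrite cz_col ?eqxx //; apply: Fan_basis fs.
by move=> j jk; rewrite cz_col ?(negPf jk) //; apply: Fan_basis fs.
Qed.

Lemma psi_star b k : NA A b -> star b k -> psi (b + col k A) = psi b + 1.
Proof.
move=> Nb /existsP[s /and3P[fs hb ks]].
by rewrite (psiD Nb (NA_col A k) fs hb (Cone_col fs ks)) (psi_col_eq fs ks).
Qed.

(* the exponent with which a term of the deformed system tends to zero *)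
Definition expo k b : nat := absz ((wn k)%:Z + phi b - phi (b + col k A))%R.

(** The exponent is the sum of two nonnegative gaps, for t the cell of [b + a_k]: the excess of the
    cost of b in its own cell over that in t, and the reduced cost of [a_k] in t. Both vanish
    exactly when b and [a_k] lie in t. *)
Lemma phi_step b k : NA A b ->
  0 <= (wn k)%:Z + phi b - phi (b + col k A) /\
  ((wn k)%:Z + phi b - phi (b + col k A) == 0) = star b k.
Proof.
move=> Nb; have NbD := NAD Nb (NA_col A k).
have [fs _] := selP NbD; have hD := sel_cone NbD.
have [fb _] := selP Nb; have hb := sel_cone Nb.
set t := sel (b + col k A) in fs hD.
have E : ((wn k)%:Z + phi b - phi (b + col k A))%:~R =
    (cost AR w (sel b) (toR R b) - cost AR w t (toR R b)) + (w k - cost AR w t (col k AR)).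
  rewrite intrB intrD (phiE NbD fs hD) (phiE Nb fb hb) toRD costD toR_col -pmulrn.
  by rewrite opprD [X in X + _]addrC addrACA.
have c1 : 0 <= cost AR w (sel b) (toR R b) - cost AR w t (toR R b).
  by rewrite subr_ge0 cost_le //; apply: Fan_basis fb.
have c2 : 0 <= w k - cost AR w t (col k AR) by rewrite subr_ge0 cost_col_le.
split; first by rewrite -(ler0z R) E addr_ge0.
rewrite -(intr_eq0 R) E paddr_eq0 //; apply/andP/idP => [[]|].
  rewrite !subr_eq0 => /eqP e1 /eqP e2.
  apply/existsP; exists t; rewrite fs /=; apply/andP; split.
    rewrite ConeE -(incone_cost_eq fb fs hb); exact/eqP/esym.
  by apply: contraT => kt; have := cost_col_lt fs kt; rewrite -e2 ltxx.
move=> st; have [hbt kt] := star_cone st fs hD.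
have e1 : cost AR w t (toR R b) == cost AR w (sel b) (toR R b).
  by rewrite (incone_cost_eq fb fs hb).
by rewrite (eqP e1) subrr (cost_col _ (Fan_basis fs)) // subrr eqxx.
Qed.

Lemma expoE b k : NA A b -> (expo k b)%:Z = (wn k)%:Z + phi b - phi (b + col k A).
Proof. by move=> Nb; rewrite gez0_abs //; have [] := phi_step k Nb. Qed.

Lemma expo_star b k : NA A b -> (expo k b == 0%N) = star b k.
Proof. by move=> Nb; have [_ <-] := phi_step k Nb; rewrite -expoE. Qed.

Lemma level_enum (K : R) : exists2 l : seq L, uniq l & forall b, (b \in l) = NA A b && (psi b <= K).
Proof.
pose S : nat := (\sum_j \sum_i `|A i j|)%N.
have [M MP] : exists M : nat, K * S%:R <= M%:R.
  by exists (Num.bound `|K * S%:R|); rewrite ltW // (le_lt_trans (ler_norm _)) // archi_boundP.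
apply: (@lattice_enum _ _ M) => b /andP[Nb bK] i.
have [fs _] := selP Nb.
have H j : `|cz (sel b) b j| <= K.
  have ge0 k : 0 <= cz (sel b) b k by have /forallP := sel_cone Nb; apply.
  rewrite ger0_norm //; apply: le_trans bK; rewrite /psi (bigD1 j) //= lerDl.
  by apply: sumr_ge0 => k _.
have := lattice_bound (Fan_basis fs) H i.
have -> : \sum_j \sum_i `|A i j|%:~R = S%:R :> R.
  rewrite /S natr_sum; apply: eq_bigr => j _; rewrite natr_sum.
  by apply: eq_bigr => k _; rewrite pmulrn abszE.
by move=> /le_trans/(_ MP); rewrite pmulrn ler_int.
Qed.

(* Dickson's lemma bounds the part of [b] that cannot be shortened along its cell. *)
Lemma descent_point : exists2 N0 : R, 1 <= N0 & forall b, NA A b -> N0 <= psi b ->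
  exists s j, [/\ Fan s, Cone s b, j \in s, NA A (b - col j A) & 1 < cz s b j].
Proof.
pose U s g (c : nat -> nat) := NA A (g + \sum_(j in s) col j A *+ c j).
have upU s g : upclosed n (U s g).
  move=> c c' cc' /NAD h; rewrite /U.
  have -> : g + \sum_(j in s) col j A *+ c' j =
    g + \sum_(j in s) col j A *+ c j + \sum_(j in s) col j A *+ (c' j - c j).
    rewrite -addrA -big_split /=; congr (_ + _); apply: eq_bigr => j _.
    by rewrite -mulrnDr subnKC // cc'.
  apply: h; rewrite big_mkcond; apply: NA_sum => j.
  by case: ifP => _; rewrite ?NA0 // NA_mul // NA_col.
have /choice[m mP] : forall sg : {set 'I_n} * L, exists m, forall u, U sg.1 sg.2 u ->
    U sg.1 sg.2 (fun j => minn (u j) m).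
  by move=> sg; apply: (dickson (upU sg.1 sg.2)).
pose M := (\max_s \max_(g <- boxseq R A s) m (s, g))%N.
(* Three coordinates share the gauge, so one has integral part at least [M + 2]. Lowering it by 1
   stays above the Dickson bound and keeps the coordinate positive. *)
exists ((3 * M.+2)%:R); first by rewrite ler1n.
move=> b Nb leb; have [fs _] := selP Nb; have hb := sel_cone Nb.
set s := sel b in fs hb; have bs := Fan_basis fs.
have cge j : 0 <= cz s b j by have /forallP := hb; apply.
pose f j := absz (Num.floor (cz s b j)).
have fE j : (f j)%:Z = Num.floor (cz s b j) by rewrite gez0_abs // floor_ge0.
have fle j : (f j)%:R <= cz s b j by rewrite pmulrn fE ge_floor.
have fgt j : cz s b j < (f j).+1%:R.
  by rewrite -natr1 pmulrn fE -[X in _ + X]/(1%:~R) -intrD floorD1_gt.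
have [j js jM] : exists2 j, j \in s & (M.+2 <= f j)%N.
  apply: contrapT => H; move: leb; apply/negP; rewrite -ltNge.
  rewrite (psiE Nb fs hb) (bigID (mem s)) /= [X in _ + X]big1 ?addr0; last first.
    by move=> j js; rewrite czE co_notin.
  have c3 := card_basis bs.
  have -> : (3 * M.+2)%:R = \sum_(i in s) (M.+2)%:R :> R by rewrite sumr_const c3 mulnC natrM mulr_natr.
  apply: ltr_sum => [|j js].
    by have /card_gt0P[j js] : (0 < #|s|)%N by [rewrite c3]; apply/hasP; exists j; rewrite ?mem_index_enum.
  apply: lt_le_trans (fgt j) _; rewrite ler_nat ltnNge; apply/negP => h; apply: H.
  by exists j.
exists s, j; split=> //; last first.
  by apply: lt_le_trans (fle j); rewrite ltr1n; lia.
pose c (k : nat) := if insub k is Some i then f i else 0%N.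
have cE (k : 'I_n) : c k = f k by rewrite /c valK.
have bE : b = boxof R A s b + \sum_(k in s) col k A *+ c k.
  rewrite /boxof -{1}[b](subrK (\sum_(k in s) col k A *~ Num.floor (cz s b k))); congr (_ + _).
  by apply: eq_bigr => k _; rewrite cE -fE pmulrn.
have Uc : U s (boxof R A s b) c by rewrite /U -bE.
pose c' k := if k == j :> nat then (c k).-1 else c k.
have -> : b - col j A = boxof R A s b + \sum_(k in s) col k A *+ c' k.
  rewrite {1}bE -addrA; congr (_ + _); rewrite (bigD1 j) //= [in RHS](bigD1 j) //=.
  rewrite /c' eqxx addrC addrA; congr (_ + _).
    have -> : c j = (c j).-1.+1 by rewrite cE; lia.
    by rewrite mulrS addKr.
  by apply: eq_bigr => k /andP[_ kj]; rewrite (_ : (k == j :> nat) = false) //; apply: negbTE.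
apply: (upU s (boxof R A s b) (fun k => minn (c k) (m (s, boxof R A s b)))).
  move=> k kn; rewrite /c'; case: eqP => [kj|_]; last exact: geq_minl.
  have : (m (s, boxof R A s b) <= M)%N.
    apply: leq_trans (leq_bigmax s) => /=.
    by apply: leq_bigmax_seq => //; apply: boxof_in.
  by rewrite kj cE; lia.
exact: (mP (s, _)).
Qed.

Lemma coord_comb s j (F : 'I_n -> C) :
  \sum_i rc (coordmx AR s j i) * (\sum_k (A i k)%:~R * F k) = \sum_k rc (co AR s (col k AR) j) * F k.
Proof.
under eq_bigr do rewrite mulr_sumr.
rewrite exchange_big /=; apply: eq_bigr => k _.
rewrite /co mxE rmorph_sum mulr_suml; apply: eq_bigr => i _ /=.
by rewrite mulrA rmorphM /= !mxE rmorph_int.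
Qed.

Definition leadN (kap : 'I_n -> L -> C) (N : R) (v : L -> C) :=
  forall b, NA A b -> psi b = N - 1 -> forall i,
    \sum_(k | psi (b + col k A) == N) (A i k)%:~R * (kap k b * v (b + col k A)) = 0.

(** Descending induction on the size of the support. At [b' = b - a_j] the j-th coordinate of the
    equations removes the other columns of the cell. The starred columns outside it lead to points
    whose support contains that of b and one more index, where v is already zero. The bound
    [1 < cz s b j] ensures that b' has the support of b. *)
Lemma lead_limit : exists N0 : R, [/\ 1 <= N0,
  forall b, NA A b -> N0 <= psi b ->
    exists j, NA A (b - col j A) /\ psi (b - col j A) = psi b - 1 &
  forall N v, N0 <= N -> leadN (fun k b => (star b k)%:R) N v ->
    forall b, NA A b -> psi b = N -> v b = 0].
Proof.
have [N0 N01 desc] := descent_point; exists N0; split=> //.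
  move=> b Nb /(desc b Nb)[s [j [fs hb js Nb' c1]]]; exists j; split=> //.
  set b' := b - col j A in Nb' *.
  have hb' : Cone s b'.
    apply/forallP => k; rewrite -[co _ _ _ _]/(cz s _ _) /b' czB.
    rewrite (cz_col _ (Fan_basis fs) js); case: eqP => [->|_]; first by rewrite subr_ge0 ltW.
    by rewrite subr0; have /forallP := hb; apply.
  have st : star b' j by apply/existsP; exists s; rewrite fs hb' js.
  by have := psi_star Nb' st; rewrite subrK => ->; rewrite addrK.
move=> N v NN0 lv.
suff H m b : (n - #|supp b| < m)%N -> NA A b -> psi b = N -> v b = 0.
  by move=> b; apply: H (ltnSn _).
elim: m b => // m IH b; rewrite ltnS => lem Nb psib.
have [|s [j [fs hb js Nb' c1]]] := desc b Nb; first by rewrite psib.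
have bs := Fan_basis fs; set b' := b - col j A in Nb' *.
have bE : b = b' + col j A by rewrite subrK.
have cb' k : cz s b' k = cz s b k - (k == j)%:R by rewrite /b' czB cz_col.
have hb' : Cone s b'.
  apply/forallP => k; rewrite -[co _ _ _ _]/(cz s _ _) cb'; case: eqP => [->|_].
    by rewrite subr_ge0 ltW.
  by rewrite subr0; have /forallP := hb; apply.
have starS k : k \in s -> star b' k by move=> ks; apply/existsP; exists s; rewrite fs hb' ks.
have psib' : psi b' = N - 1.
  by rewrite -psib bE (psi_star Nb' (starS j js)) addrK.
have := coord_comb s j (fun k => if psi (b' + col k A) == N then (star b' k)%:R * v (b' + col k A) else 0).
rewrite [LHS]big1 => [|i _]; last first.
  rewrite (_ : \sum_k _ = 0) ?mulr0 //; rewrite -[RHS](lv b' Nb' psib' i) [RHS]big_mkcond.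
  by apply: eq_bigr => k _; case: ifP => _ //; rewrite mulr0.
rewrite (bigD1 j) //= big1 ?addr0.
  rewrite co_col // eqxx rmorph1 mul1r (psi_star Nb' (starS j js)) psib' subrK eqxx.
  by rewrite starS // mul1r -bE => /esym.
move=> k kj; have [ks|ks] := boolP (k \in s).
  by rewrite co_col // eq_sym (negPf kj) rmorph0 mul0r.
case: ifP => [/eqP psik|_]; last by rewrite mulr0.
have [st|st] := boolP (star b' k); last by rewrite mul0r mulr0.
rewrite (IH (b' + col k A)) ?mulr0 ?(NAD Nb' (NA_col A k)) //.
have [s2 /and3P[f2 h2 k2]] := existsP st.
have kn : k \notin supp b.
  by rewrite (suppE _ Nb fs hb) czE co_notin // ltxx.
have Nk := NAD Nb' (NA_col A k).
have hk : Cone s2 (b' + col k A) := Cone_add f2 h2 k2.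
have E2 x : cz s2 (b' + col k A) x = cz s b' x + (x == k)%:R.
  by rewrite czD (cz_col _ (Fan_basis f2)) // -(cz_sel Nb' f2 h2) (cz_sel Nb' fs hb').
have : (k |: supp b) \subset supp (b' + col k A).
  apply/fintype.subsetP => x; rewrite in_setU1 (suppE _ Nk f2 hk) E2 => /orP[/eqP->|].
    rewrite eqxx ltr_wpDl // cb'; case: eqP => [E|_]; first by move: ks; rewrite E js.
    by rewrite subr0; have /forallP := hb; apply.
  rewrite (suppE _ Nb fs hb) cb' => xb.
  rewrite ltr_wpDr // ?ler0n //; case: eqP => [->|_]; last by rewrite subr0.
  by rewrite subr_gt0.
move=> /subset_leq_card; rewrite cardsU1 kn add1n => le1.
have := max_card (mem (supp (b' + col k A))); rewrite card_ord => mc.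
by apply: leq_trans lem; apply: ltn_sub2l => //; apply: leq_trans le1 mc.
Qed.

End Gauge.

(** * Polynomial conditions and multi-indices *)

Definition ring_closed (X : Type) (K : fieldType) (Q : (X -> K) -> Prop) :=
  [/\ forall k, Q (fun=> k),
      forall f g, Q f -> Q g -> Q (fun x => f x + g x) &
      forall f g, Q f -> Q g -> Q (fun x => f x * g x)].

Lemma ring_closed_sum (X : Type) (K : fieldType) (Q : (X -> K) -> Prop) J (r : seq J)
    (P : pred J) (f : J -> X -> K) : ring_closed Q -> (forall j, P j -> Q (f j)) ->
  Q (fun x => \sum_(j <- r | P j) f j x).
Proof.
move=> [Qk QD _] Qf; elim: r => [|j r IH]; first by under eq_fun do rewrite big_nil.
under eq_fun do rewrite big_cons.
by have [Pj|_] := boolP (P j); [apply: QD => //; apply: Qf|].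
Qed.

(** In [factorial_growth] a descent by one unit of gauge, which is h steps, costs a factor of order
    [m.+1]; one further factor of the factorial absorbs it up to h. *)
Lemma factorial_step h m : (0 < h)%N ->
  (m.+1 * (((m.+1 - h) %/ h).+1)`! <= h * ((m.+1 %/ h).+1)`!)%N.
Proof.
move=> h0; have [hm|hm] := leqP h m.+1.
  have -> : (m.+1 %/ h = ((m.+1 - h) %/ h).+1)%N.
    by rewrite -{1}(subnK hm) divnDr ?divnn ?h0 ?dvdnn // addn1.
  rewrite [in leqRHS]factS mulnA leq_mul2r; apply/orP; right.
  rewrite -{1}(subnK hm) mulnC mulSn addnC leq_add2l.
  by apply: ltnW; apply: ltn_ceil.
rewrite (_ : m.+1 - h = 0)%N; last by apply/eqP; rewrite subn_eq0 ltnW.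
by rewrite div0n divn_small // !muln1 ltnW.
Qed.

Section Multiindices.
Variable n : nat.
Implicit Types (a u v : mi n).

Definition mi_add a u : mi n := [ffun j => (a j + u j)%N].
Definition mi_fact a : nat := (\prod_j (a j)`!)%N.
Definition mi0 : mi n := [ffun=> 0%N].

Lemma mi_fact_gt0 a : (0 < mi_fact a)%N.
Proof. by apply: prodn_gt0 => j; apply: fact_gt0. Qed.

Lemma mi_fact_inc a j : mi_fact (mi_inc a j) = ((a j).+1 * mi_fact a)%N.
Proof.
rewrite /mi_fact (bigD1 j) //= [in RHS](bigD1 j) //= ffunE eqxx addn1 factS mulnA.
congr (_ * _)%N; apply: eq_bigr => k kj; by rewrite ffunE (negPf kj) addn0.
Qed.

Lemma mi_inc_dec a j : (0 < a j)%N -> mi_inc (mi_dec a j) j = a.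
Proof.
move=> aj; apply/ffunP => k; rewrite !ffunE.
by have [->|_] := eqVneq k j; rewrite ?addn0 ?subn0 // subn1 addn1 prednK.
Qed.

Lemma mi_deg_inc a j : mi_deg (mi_inc a j) = (mi_deg a).+1.
Proof.
rewrite /mi_deg; under eq_bigr do rewrite ffunE.
rewrite big_split /= -addn1; congr (_ + _)%N.
rewrite (bigD1 j) //= eqxx big1 // => k kj.
by rewrite (negPf kj).
Qed.

(** An entry with [mi_deg a <= n.+1 * a j] is lowered by 1: the factor lost from the factorial of
    the degree is paid for by [n.+1 * a j]. *)
Lemma fact_deg_le a : ((mi_deg a)`! <= n.+1 ^ mi_deg a * mi_fact a)%N.
Proof.
have [m] := ubnP (mi_deg a); elim: m a => // m IH a lem.
case E : (mi_deg a) => [|d]; first by rewrite expn0 mul1n mi_fact_gt0.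
have [j aj] : exists j, (d.+1 <= n.+1 * a j)%N.
  apply: contrapT => H.
  have le j : (n.+1 * a j <= d)%N by rewrite -ltnS ltnNge; apply/negP => h; apply: H; exists j.
  have : (n.+1 * mi_deg a <= n * d)%N.
    have -> : (n * d = \sum_(j < n) d)%N by rewrite sum_nat_const card_ord.
    by rewrite /mi_deg big_distrr /=; apply: leq_sum.
  rewrite E; nia.
have a0 : (0 < a j)%N by case: (a j) aj => //; rewrite muln0.
have D : mi_deg (mi_dec a j) = d.
  by have := mi_deg_inc (mi_dec a j) j; rewrite mi_inc_dec // E => -[].
have := IH (mi_dec a j); rewrite D => /(_ _)/(leq_mul aj).
rewrite -ltnS -E => /(_ lem); rewrite E -factS => h; apply: leq_trans h _.
rewrite -{3}(mi_inc_dec a0) mi_fact_inc ffunE eqxx subn1 prednK // expnS.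
by rewrite !mulnA leq_mul2r [(n.+1 * a j * _)%N]mulnAC leqnn orbT.
Qed.

End Multiindices.

Section Polynomials.
Variables (R : realType) (n : nat).
Notation C := R[i].

Definition polyfun (f : ('I_n -> C) -> C) :=
  exists h : seq (C * mi n), forall p, f p = peval h p.

Lemma polyfun_ring : ring_closed polyfun.
Proof.
split.
- move=> k; exists [:: (k, mi0 n)] => p; rewrite /peval big_seq1 /= big1 ?mulr1 // => j _.
  by rewrite ffunE expr0.
- move=> f g [h hE] [h' hE']; exists (h ++ h') => p.
  by rewrite hE hE' /peval big_cat.
- move=> f g [h hE] [h' hE'].
  exists [seq (t.1 * t'.1, mi_add t.2 t'.2) | t <- h, t' <- h'] => p.
  rewrite hE hE' /peval big_allpairs_dep mulr_suml; apply: eq_bigr => t _.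
  rewrite mulr_sumr; apply: eq_bigr => t' _ /=.
  rewrite mulrACA; congr (_ * _); rewrite -big_split; apply: eq_bigr => j _ /=.
  by rewrite ffunE exprD.
Qed.

Lemma polyfun_coord k : polyfun (fun p => p k).
Proof.
exists [:: (1, [ffun j => (j == k) : nat])] => p.
rewrite /peval big_seq1 /= mul1r (bigD1 k) //= ffunE eqxx expr1 big1 ?mulr1 //.
by move=> j jk; rewrite ffunE (negPf jk) expr0.
Qed.

(** On the line through the two points both functions become nonzero polynomials in one variable. *)
Lemma polyfun_mul_neq0 f g : polyfun f -> polyfun g ->
  (exists p, f p != 0) -> (exists p, g p != 0) -> exists p, f p * g p != 0.
Proof.
move=> pf pg [p fp] [p' gp].
pose l (t : C) k := (p' k - p k) * t + p k.
have line F : polyfun F -> exists P : {poly C}, forall t, F (l t) = P.[t].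
  move=> [h hE]; exists (\sum_(t <- h) t.1 *: \prod_j ((p' j - p j) *: 'X + (p j)%:P) ^+ t.2 j).
  move=> t; rewrite hE /peval horner_sum; apply: eq_bigr => m _.
  rewrite hornerZ horner_prod; congr (_ * _); apply: eq_bigr => j _.
  by rewrite horner_exp hornerD hornerZ hornerX hornerC.
have [F FE] := line f pf; have [G GE] := line g pg.
have l0 : l 0 = p by apply: funext => k; rewrite /l mulr0 add0r.
have l1 : l 1 = p' by apply: funext => k; rewrite /l mulr1 subrK.
have [i|m mP] := @common_nonroot C bool (fun i => if i then F else G).
  case: i; first by apply: contraNneq fp => F0; rewrite -l0 FE F0 horner0.
  by apply: contraNneq gp => G0; rewrite -l1 GE G0 horner0.
exists (l m%:R); rewrite FE GE mulf_neq0 //; first exact: (mP true).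
exact: (mP false).
Qed.

End Polynomials.

(** * Formal solutions as functions on the semigroup *)

Section Solutions.
Variables (R : realType) (n : nat) (A : 'M[int]_(3, n)) (beta : 'I_3 -> R[i]).
Notation C := R[i].
Notation L := 'cV[int]_3.

Definition norm_coef (c : series R n) (a : mi n) : C := (mi_fact a)%:R * c a.

Lemma mi_fact_neq0 (a : mi n) : (mi_fact a)%:R != 0 :> C.
Proof. by rewrite pnatr_eq0 -lt0n mi_fact_gt0. Qed.

Lemma norm_coef_pd j c a : norm_coef (pd j c) a = norm_coef c (mi_inc a j).
Proof. by rewrite /norm_coef /pd mi_fact_inc natrM mulrA [_ * (a j).+1%:R]mulrC. Qed.

Lemma norm_coef_iter j m c a :
  norm_coef (iter m (pd j) c) a = norm_coef c [ffun k => (a k + (k == j) * m)%N].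
Proof.
elim: m a => [|m IH] a /=.
  by congr norm_coef; apply/ffunP => k; rewrite ffunE muln0 addn0.
rewrite norm_coef_pd IH; congr norm_coef; apply/ffunP => k.
by rewrite !ffunE -addnA mulnS.
Qed.

Lemma norm_coef_pdpow u c a : norm_coef (pdpow u c) a = norm_coef c (mi_add a u).
Proof.
rewrite /pdpow; have -> : mi_add a u = [ffun k => (a k + \sum_(j <- enum 'I_n) (k == j) * u j)%N].
  apply/ffunP => k; rewrite !ffunE; congr (_ + _)%N.
  rewrite (bigD1_seq k) ?mem_enum ?enum_uniq //= eqxx mul1n big1 ?addn0 // => j jk.
  by rewrite eq_sym (negPf jk).
elim: (enum 'I_n) a => [|j l IH] a /=.
  by congr norm_coef; apply/ffunP => k; rewrite ffunE big_nil addn0.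
rewrite norm_coef_iter IH; congr norm_coef; apply/ffunP => k.
by rewrite !ffunE big_cons addnA.
Qed.

Lemma norm_coef_euler p i c a : (mi_fact a)%:R * euler A p i c a =
  \sum_k (A i k)%:~R * (p k * norm_coef c (mi_inc a k)) +
  (lcomb A a i 0)%:~R * norm_coef c a.
Proof.
rewrite /euler mulr_sumr; have -> : (lcomb A a i 0)%:~R = \sum_k (A i k)%:~R * (a k)%:R :> C.
  rewrite /lcomb summxE rmorph_sum /=; apply: eq_bigr => k _.
  by rewrite mulmxnE mxE rmorphMn /= mulr_natr.
rewrite mulr_suml -big_split; apply: eq_bigr => k _ /=.
rewrite /mulx -norm_coef_pd mulrCA -mulrA -mulrDr; congr (_ * _).
rewrite mulrDr; congr (_ + _); first by rewrite mulrCA.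
case: ifP => ak; last first.
  by move/negbT: ak; rewrite -eqn0Ngt => /eqP ->; rewrite mulr0 mul0r.
rewrite /pd mi_inc_dec // ffunE eqxx subn1 prednK //.
by rewrite /norm_coef mulrCA.
Qed.

Lemma AmulE u i : Amul A u i = lcomb A u i 0.
Proof.
rewrite /lcomb summxE; apply: eq_bigr => k _.
by rewrite mulmxnE mxE -mulr_natr natz.
Qed.

Definition nasol (p : 'I_n -> C) (u : L -> C) := forall b, NA A b -> forall i,
  \sum_k (A i k)%:~R * (p k * u (b + col k A)) = (beta i - (b i 0)%:~R) * u b.

(** Solutions before convergence is known; [ser_convergent] supplies it where the leading system at
    p is invertible. *)
Definition formal p (c : series R n) :=
  (forall u v : mi n, (forall i, Amul A u i = Amul A v i) -> pdpow u c =1 pdpow v c) /\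
  (forall i, euler A p i c =1 (fun a => beta i * c a)).

Definition ser (u : L -> C) : series R n := fun a => u (lcomb A a) / (mi_fact a)%:R.

Lemma norm_coef_ser u a : norm_coef (ser u) a = u (lcomb A a).
Proof. by rewrite /norm_coef /ser mulrC divfK // mi_fact_neq0. Qed.

Lemma norm_coef_inj c c' a : norm_coef c a = norm_coef c' a -> c a = c' a.
Proof. exact/mulfI/mi_fact_neq0. Qed.

Lemma lcomb_inc a k : lcomb A (mi_inc a k) = lcomb A a + col k A.
Proof.
by rewrite -(lcomb1 A k) -lcombD; congr lcomb; apply/ffunP => j; rewrite !ffunE.
Qed.

Lemma ser_formal p u : nasol p u -> formal p (ser u).
Proof.
move=> su; split=> [v v' E a|i a].
  apply: (@norm_coef_inj (pdpow v (ser u)) (pdpow v' (ser u))); rewrite !norm_coef_pdpow !norm_coef_ser; congr u.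
  rewrite !lcombD; congr (_ + _); apply/colP => i.
  by rewrite -!AmulE.
apply: (mulfI (mi_fact_neq0 a)); rewrite norm_coef_euler norm_coef_ser.
rewrite mulrCA -/(norm_coef (ser u) a) norm_coef_ser.
have := su (lcomb A a) (NA_lcomb A a) i => E.
rewrite (eq_bigr (fun k => (A i k)%:~R * (p k * u (lcomb A a + col k A)))).
  by rewrite E -mulrDl subrK.
by move=> k _; rewrite norm_coef_ser lcomb_inc.
Qed.

(* By the toric equations the coefficients alpha! c_alpha depend only on A alpha. *)
Definition unser (c : series R n) (b : L) : C :=
  if pselect (exists a, b = lcomb A a) is left h then norm_coef c (projT1 (cid h)) else 0.

Lemma unserE p c a : formal p c -> unser c (lcomb A a) = norm_coef c a.
Proof.
move=> [tor _]; rewrite /unser; case: pselect => [h|[]]; last by exists a.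
case: cid => a' /= E.
have := tor a' a; move=> /(_ _ (mi0 n)) H.
have {}H : norm_coef (pdpow a' c) (mi0 n) = norm_coef (pdpow a c) (mi0 n).
  by rewrite /norm_coef H // => i; rewrite !AmulE E.
have add0 x : mi_add (mi0 n) x = x by apply/ffunP => j; rewrite !ffunE.
by rewrite !norm_coef_pdpow !add0 in H.
Qed.

Lemma unser_sol p c : formal p c -> nasol p (unser c).
Proof.
move=> fc b /NAP[a ->] i; have [_ eul] := fc.
have := eul i a; move=> /(congr1 (fun z => (mi_fact a)%:R * z)).
rewrite norm_coef_euler => E; rewrite (unserE _ fc).
have E' : (mi_fact a)%:R * (beta i * c a) = beta i * norm_coef c a by rewrite mulrCA.
rewrite mulrBl -E' -E addrK; apply: eq_bigr => k _.
by rewrite -lcomb_inc (unserE _ fc).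
Qed.

Lemma unserK p c a : formal p c -> c a = unser c (lcomb A a) / (mi_fact a)%:R.
Proof. by move=> fc; rewrite (unserE _ fc) /norm_coef [_ * c a]mulrC mulfK // mi_fact_neq0. Qed.

End Solutions.

(** * Truncated systems, convergence and the generic rank *)

Section Systems.
Variables (R : realType) (n : nat) (A : 'M[int]_(3, n)).
Variables (wn : 'I_n -> nat) (q : 'cV[R]_3) (beta : 'I_3 -> R[i]).
Let AR : 'M[R]_(3, n) := map_mx intr A.
Notation L := 'cV[int]_3.
Notation C := R[i].
Notation rc := (real_complex R).
Let w j : R := (wn j)%:R.
Implicit Types (s : {set 'I_n}) (b : L).
Notation cz := (cz R A).
Notation Hopen := (Hopen A q).
Notation Fan := (Fan A w).
Notation Cone := (Cone R A).
Notation star := (star A w).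
Notation psi := (psi A wn q).
Notation phi := (phi A wn q).
Notation expo := (expo A wn q).

Hypothesis cov : forall x : L, NA A x -> exists2 t, Fan t & Hopen t x.
Hypothesis col_le1 : forall s l, Fan s -> \sum_j co AR s (col l AR) j <= 1.
Hypothesis cost_int : forall s b, basis AR s -> exists z : int, cost AR w s (toR R b) = z%:~R.

Variable N0 : R.
Hypothesis N01 : 1 <= N0.
Hypothesis descent : forall b, NA A b -> N0 <= psi b ->
    exists j, NA A (b - col j A) /\ psi (b - col j A) = psi b - 1.
Hypothesis leadL : forall N v, N0 <= N ->
  leadN A wn q (fun k b => (star b k)%:R) N v ->
    forall b, NA A b -> psi b = N -> v b = 0.

Definition levelseq (K : R) : seq L :=
  projT1 (cid2 (level_enum cov K)).

Lemma levelseq_uniq K : uniq (levelseq K).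
Proof. by rewrite /levelseq; case: cid2. Qed.

Lemma mem_levelseq K b : (b \in levelseq K) = NA A b && (psi b <= K).
Proof. by rewrite /levelseq; case: cid2 => l /= _ ->. Qed.

(** Although [psi] is real-valued, the induction is well founded, since only finitely many points of
    NA have gauge at most K. *)
Lemma psi_ind (K : R) (P : L -> Prop) :
  (forall b, NA A b -> psi b <= K ->
     (forall y, NA A y -> psi y < psi b -> P y) -> P b) ->
  forall b, NA A b -> psi b <= K -> P b.
Proof.
move=> step.
suff H m b : (count (fun y => (psi y < psi b)%R) (levelseq K) < m)%N -> NA A b -> psi b <= K -> P b.
  by move=> b; apply: H (ltnSn _).
elim: m b => // m IH b; rewrite ltnS => le Nb bK; apply: step => // y Ny yb.
apply: (IH y) => //; last exact: le_trans (ltW yb) bK.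
apply: leq_trans le.
have yin : y \in levelseq K by rewrite mem_levelseq Ny (le_trans (ltW yb) bK).
rewrite -!size_filter.
apply: (@uniq_leq_size _ (y :: [seq x <- levelseq K | psi x < psi y])).
  by rewrite /= mem_filter ltxx /= filter_uniq // levelseq_uniq.
move=> x; rewrite inE !mem_filter => /orP[/eqP ->|/andP[h ->]]; first by rewrite yb yin.
by rewrite (lt_trans h yb).
Qed.

(* The Euler equations whose unknowns have gauge at most [K]; [kap] carries the
   coefficients p_k, or t^(expo k b) after rescaling u by t^(phi b). *)
Definition trunc (kap : 'I_n -> L -> C) (K : R) (u : L -> C) :=
  forall b, NA A b -> psi b + 1 <= K -> forall i,
    \sum_k (A i k)%:~R * (kap k b * u (b + col k A)) = (beta i - (b i 0)%:~R) * u b.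

Definition lead (kap : 'I_n -> L -> C) (v : L -> C) :=
  forall b, NA A b -> N0 - 1 <= psi b < N0 -> forall i,
    \sum_(k | psi (b + col k A) == psi b + 1) (A i k)%:~R * (kap k b * v (b + col k A)) = 0.

(* One slab of width 1 suffices: the coefficients do not depend on [b], and every point of
   large gauge is a translate of a point of the slab within its cell. *)
Definition leaddet (kap : 'I_n -> L -> C) := forall v, lead kap v ->
  forall b, NA A b -> N0 <= psi b < N0 + 1 -> v b = 0.

Definition truncdet (kap : 'I_n -> L -> C) (K : R) (X : seq L) := forall u, trunc kap K u ->
  (forall r, r \in X -> u r = 0) -> forall b, NA A b -> psi b <= K -> u b = 0.

Lemma leaddet_limit : leaddet (fun k b => (star b k)%:R).
Proof.
move=> v lv b Nb /andP[h1 h2]; apply: (@leadL (psi b) v) => // b' Nb' E i.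
rewrite -[RHS](lv b' Nb' _ i); first by rewrite E subrK.
by rewrite E lerD2r h1 ltrBlDr.
Qed.

Definition lpts : seq L := [seq b <- levelseq (N0 + 1) | N0 <= psi b < N0 + 1].
Definition leqs : seq L := [seq b <- levelseq N0 | N0 - 1 <= psi b < N0].
Notation E1 := ('I_(size leqs) * 'I_3)%type.
Definition leqp (m : 'I_(size leqs)) : L := tnth (in_tuple leqs) m.
(** Columns may repeat, so the coefficient of the unknown at y is a sum over all k leading to y. *)
Definition lcoef (kap : 'I_n -> L -> C) (e : E1) (y : L) : C :=
  \sum_(k | (psi (leqp e.1 + col k A) == psi (leqp e.1) + 1) && (leqp e.1 + col k A == y))
     (A e.2 k)%:~R * kap k (leqp e.1).

Lemma mem_lpts b : (b \in lpts) = NA A b && (N0 <= psi b < N0 + 1).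
Proof.
rewrite mem_filter mem_levelseq andbC -andbA; case: (NA A b) => //=.
by apply/andP/idP => [[]//|h]; split=> //; have /andP[_ /ltW] := h.
Qed.
Lemma mem_leqs b : (b \in leqs) = NA A b && (N0 - 1 <= psi b < N0).
Proof.
rewrite mem_filter mem_levelseq andbC -andbA; case: (NA A b) => //=.
by apply/andP/idP => [[]//|h]; split=> //; have /andP[_ /ltW] := h.
Qed.
Lemma leqpP m : NA A (leqp m) /\ N0 - 1 <= psi (leqp m) < N0.
Proof. by have := mem_tnth m (in_tuple leqs); rewrite mem_leqs => /andP[]. Qed.

Lemma pts_uniq : uniq lpts. Proof. by rewrite filter_uniq // levelseq_uniq. Qed.

Lemma lcoefE kap (e : E1) v : row_value lpts (lcoef kap) e v =
  \sum_(k | psi (leqp e.1 + col k A) == psi (leqp e.1) + 1)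
     (A e.2 k)%:~R * (kap k (leqp e.1) * v (leqp e.1 + col k A)).
Proof.
rewrite /row_value /lcoef; under eq_bigr do rewrite mulr_suml.
rewrite (exchange_big_dep (fun k => psi (leqp e.1 + col k A) == psi (leqp e.1) + 1)) /=; last first.
  by move=> y k _ /andP[].
apply: eq_bigr => k /eqP psik; have [Ne /andP[e1 e2]] := leqpP e.1.
have yin : leqp e.1 + col k A \in lpts.
  by rewrite mem_lpts NAD ?NA_col // psik -lerBlDr e1 ltrD2r e2.
rewrite big_mkcond /= (bigD1_seq (leqp e.1 + col k A)) ?pts_uniq //= psik !eqxx /=.
rewrite big1_seq ?addr0 ?mulrA // => y /andP[ne _].
by rewrite eq_sym (negPf ne).
Qed.

Lemma leaddetE kap : leaddet kap <-> determined lpts (lcoef kap).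
Proof.
split=> [h v ve b|h v lv b Nb pb].
  rewrite mem_lpts => /andP[Nb pb]; apply: h => // b' Nb' pb' i.
  have : b' \in in_tuple leqs by rewrite mem_leqs Nb'.
  move=> /tnthP[m ->]; have := ve (m, i); rewrite lcoefE //.
apply: h; last by rewrite mem_lpts Nb.
move=> e; rewrite lcoefE; have [Ne pe] := leqpP e.1; exact: lv.
Qed.

Lemma open_leaddet (X : Type) (kap : X -> 'I_n -> L -> C) x0 : leaddet (kap x0) ->
  exists D : X -> C, [/\ D x0 != 0, forall x, D x != 0 -> leaddet (kap x) &
    forall Q, ring_closed Q -> (forall k b, Q (fun x => kap x k b)) -> Q D].
Proof.
move=> /leaddetE h.
have [D [D0 DP DQ]] := @open_determined _ _ _ _ X (fun x => lcoef (kap x)) x0 pts_uniq h.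
exists D; split=> // [x /DP /leaddetE //|Q QR Qk]; have [Q1 Q2 Q3] := QR.
apply: DQ => // e b; apply: ring_closed_sum => // k _.
by apply: Q3.
Qed.

Section TruncSystem.
Variables (K : R) (X : seq L).
Hypothesis XK : forall r, r \in X -> NA A r && (psi r <= K).
Definition teqs : seq L := [seq b <- levelseq K | psi b + 1 <= K].
Notation E2 := ('I_(size teqs) * 'I_3 + 'I_(size X))%type.
Definition teqp (m : 'I_(size teqs)) : L := tnth (in_tuple teqs) m.
Definition tcoef (kap : 'I_n -> L -> C) (e : E2) (y : L) : C :=
  match e with
  | inl mi => \sum_(k | teqp mi.1 + col k A == y) (A mi.2 k)%:~R * kap k (teqp mi.1) +
     (if teqp mi.1 == y then - (beta mi.2 - (teqp mi.1 mi.2 0)%:~R) else 0)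
  | inr r => if tnth (in_tuple X) r == y then 1 else 0
  end.

Lemma mem_teqs b : (b \in teqs) = NA A b && (psi b + 1 <= K).
Proof.
rewrite mem_filter mem_levelseq andbC -andbA; case: (NA A b) => //=.
apply/andP/idP => [[]//|h]; split=> //.
by apply: le_trans h; rewrite lerDl.
Qed.
Lemma teqpP m : NA A (teqp m) /\ psi (teqp m) + 1 <= K.
Proof. by have := mem_tnth m (in_tuple teqs); rewrite mem_teqs => /andP[]. Qed.

Lemma tcoef_inl kap m i u : row_value (levelseq K) (tcoef kap) (inl (m, i)) u =
  \sum_k (A i k)%:~R * (kap k (teqp m) * u (teqp m + col k A)) -
    (beta i - (teqp m i 0)%:~R) * u (teqp m).
Proof.
have [Nm mK] := teqpP m.
rewrite /row_value /=; under eq_bigr do rewrite mulrDl.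
rewrite big_split /=; congr (_ + _).
  under eq_bigr do rewrite mulr_suml.
  rewrite (exchange_big_dep xpredT) //=; apply: eq_bigr => k _.
  have yin : teqp m + col k A \in levelseq K.
    rewrite mem_levelseq NAD ?NA_col //=; apply: le_trans mK.
    exact: (psi_step cov col_le1).
  rewrite big_mkcond /= (bigD1_seq (teqp m + col k A)) ?levelseq_uniq //= eqxx.
  rewrite big1_seq ?addr0 ?mulrA // => y /andP[ne _].
  by rewrite eq_sym (negPf ne).
rewrite (bigD1_seq (teqp m)) ?levelseq_uniq //=; last first.
  by rewrite mem_levelseq Nm (le_trans _ mK) // lerDl.
rewrite eqxx big1_seq ?addr0 ?mulNr // => y /andP[ne _].
by rewrite eq_sym (negPf ne) mul0r.
Qed.

Lemma tcoef_inr kap r u : row_value (levelseq K) (tcoef kap) (inr r) u = u (tnth (in_tuple X) r).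
Proof.
rewrite /row_value /= (bigD1_seq (tnth (in_tuple X) r)) ?levelseq_uniq //=; last first.
  by rewrite mem_levelseq XK // mem_tnth.
rewrite eqxx mul1r big1_seq ?addr0 // => y /andP[ne _].
by rewrite eq_sym (negPf ne) mul0r.
Qed.

Lemma truncdetE kap : truncdet kap K X <-> determined (levelseq K) (tcoef kap).
Proof.
split=> [h u ue b|h u tu uX b Nb pb].
  rewrite mem_levelseq => /andP[Nb pb]; apply: (h u) => //.
    move=> b' Nb' pb' i; have : b' \in in_tuple teqs by rewrite mem_teqs Nb'.
    move=> /tnthP[m ->]; have := ue (inl (m, i)); rewrite tcoef_inl => /eqP.
    by rewrite subr_eq0 => /eqP.
  move=> r rX; have /tnthP[m ->] : r \in in_tuple X by [].
  by rewrite -(tcoef_inr kap).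
apply: h; last by rewrite mem_levelseq Nb.
move=> [[m i]|r].
  by rewrite tcoef_inl; have [Nm mK] := teqpP m; rewrite (tu _ Nm mK) subrr.
by rewrite tcoef_inr uX // mem_tnth.
Qed.

Lemma open_truncdet (Y : Type) (kap : Y -> 'I_n -> L -> C) x0 : truncdet (kap x0) K X ->
  exists D : Y -> C, [/\ D x0 != 0, forall x, D x != 0 -> truncdet (kap x) K X &
    forall Q, ring_closed Q -> (forall k b, Q (fun x => kap x k b)) -> Q D].
Proof.
move=> /truncdetE h.
have [D [D0 DP DQ]] :=
  @open_determined _ _ _ _ Y (fun x => tcoef (kap x)) x0 (levelseq_uniq K) h.
exists D; split=> // [x /DP /truncdetE //|Q QR Qk]; have [Q1 Q2 Q3] := QR.
apply: DQ => // -[[m i]|r] b /=; last exact: Q1.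
apply: Q2; last exact: Q1.
by apply: ring_closed_sum => // k _; apply: Q3.
Qed.

End TruncSystem.

Lemma trunc_lin kap K a u v : trunc kap K u -> trunc kap K v ->
  trunc kap K (fun b => a * u b + v b).
Proof.
move=> tu tv b Nb bK i; rewrite mulrDr [_ * (a * _)]mulrCA -tu // -tv // mulr_sumr -big_split.
by apply: eq_bigr => k _ /=; ring.
Qed.

Lemma trunc_loc kap K u v : (forall b, NA A b && (psi b <= K) -> u b = v b) ->
  trunc kap K u -> trunc kap K v.
Proof.
move=> uv tu b Nb bK i; rewrite -uv ?Nb /= ?(le_trans _ bK) ?lerDl //.
rewrite -tu //; apply: eq_bigr => k _; rewrite uv // NAD ?NA_col //=.
exact: le_trans (psi_step cov col_le1 _ Nb) bK.
Qed.

Lemma trunc_mon kap K K' u : K <= K' -> trunc kap K' u -> trunc kap K u.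
Proof. by move=> KK' tu b Nb bK; apply: tu => //; apply: le_trans KK'. Qed.

Definition fullsol kap u := forall K, trunc kap K u.

(** A set that determines the solutions of the infinite system already determines those of some
    truncation, a finite system to which openness in p applies. *)
Lemma trunc_stabilize kap (B : R) (X : seq L) :
  (forall r, r \in X -> NA A r && (psi r <= B)) ->
  (forall K u, trunc kap K u -> (forall b, NA A b -> psi b <= B -> u b = 0) ->
     forall b, NA A b -> psi b <= K -> u b = 0) ->
  (forall u, fullsol kap u -> (forall r, r \in X -> u r = 0) -> forall b, NA A b -> u b = 0) ->
  exists2 K, B <= K & truncdet kap K X.
Proof.
move=> XB base full.
pose dom (t : nat) b := NA A b && (psi b <= B + t%:R).
have Bt t : B <= B + t%:R by rewrite lerDl.
have [||||||||t tP] := @stabilize C L dom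
  (fun t u => trunc kap (B + t%:R) u /\ forall r, r \in X -> u r = 0) (levelseq B).
- move=> t b /andP[Nb pb]; rewrite /dom Nb /= (le_trans pb) // lerD2l ler_nat //.
- by move=> t u [tu ur]; split=> //; apply: trunc_mon tu; rewrite lerD2l ler_nat.
- move=> t a u v [tu ur] [tv vr]; split; first exact: trunc_lin.
  by move=> r rX; rewrite ur ?vr // mulr0 addr0.
- move=> t; split=> // b _ _ i; rewrite mulr0 big1 // => k _.
  by rewrite !mulr0.
- move=> t u v uv [tu ur]; split; first exact: trunc_loc tu.
  move=> r rX; rewrite -uv ?ur //; have /andP[Nr pr] := XB r rX.
  by rewrite /dom Nr (le_trans pr).
- by move=> b; rewrite mem_levelseq /dom addr0.
- move=> t u [tu ur] u0 b /andP[Nb pb]; apply: base tu _ b Nb pb => y Ny py.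
  by apply: u0; rewrite mem_levelseq Ny.
- move=> u h t b /andP[Nb _]; apply: (full u) => //.
    move=> K; pose t0 := Num.bound `|K - B|.
    have [tu _] := h t0; apply: trunc_mon tu; rewrite addrC -lerBlDr.
    by rewrite ltW // (le_lt_trans (ler_norm _)) // archi_boundP.
  by have [] := h 0%N.
- exists (B + t%:R); first exact: Bt.
  move=> u tu ur b Nb pb; apply: (tP u) => //; by rewrite /dom Nb.
Qed.

Lemma limit_trunc_zero K u : trunc (fun k b => (star b k)%:R) K u ->
  (forall b, NA A b -> psi b <= N0 -> u b = 0) -> forall b, NA A b -> psi b <= K -> u b = 0.
Proof.
move=> tu u0; apply: psi_ind => b Nb bK IH.
have [|/ltW pb] := leP (psi b) N0; first exact: u0.
apply: (leadL pb) => // b' Nb' pb' i.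
have pb1 : psi b' + 1 <= K by rewrite pb' subrK.
have ub' : u b' = 0 by apply: IH => //; rewrite pb' ltrBlDr ltrDl.
have := tu b' Nb' pb1 i; rewrite ub' mulr0 => E; rewrite -[RHS]E.
rewrite [RHS](bigID (fun k => psi (b' + col k A) == psi b)) /= [X in _ + X]big1 ?addr0 //.
move=> k ne; rewrite IH ?mulr0 ?NAD ?NA_col //.
by rewrite lt_neqAle ne -(subrK 1 (psi b)) -pb' (psi_step cov col_le1).
Qed.

Definition cstw (p : 'I_n -> C) : 'I_n -> L -> C := fun k _ => p k.

(** Columns are split off by [descent] until the slab is reached. Each of them lowers the gauge by
    exactly 1, so subadditivity holds with equality here. *)
Lemma decompose b : NA A b -> N0 <= psi b -> exists b1 e,
  [/\ NA A b1, NA A e, b = b1 + e, N0 <= psi b1 < N0 + 1 & psi b = psi b1 + psi e].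
Proof.
suff H K : forall b, NA A b -> psi b <= K -> N0 <= psi b -> exists b1 e,
  [/\ NA A b1, NA A e, b = b1 + e, N0 <= psi b1 < N0 + 1 & psi b = psi b1 + psi e].
  by move=> Nb; apply: (H (psi b)).
apply: psi_ind => {}b Nb bK IH Nb0.
have [lt|ge] := ltP (psi b) (N0 + 1).
  have p0 : psi 0 = 0 by rewrite psi_sel big1 // => j _; exact: cz0.
  by exists b, 0; rewrite p0 !addr0 Nb0 lt; split=> //; exact: NA0.
have [j [Nb' pb']] := descent Nb Nb0.
have [||b1 [e [N1 Ne bE r1 pE]]] := IH _ Nb'.
- by rewrite pb' ltrBlDr ltrDl.
- by rewrite pb' lerBrDr.
have Nej := NAD Ne (NA_col A j).
have bE' : b = b1 + (e + col j A) by rewrite addrA -bE subrK.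
exists b1, (e + col j A); split=> //.
apply/eqP; rewrite eq_le {1}bE' (psiD_le cov col_le1 N1 Nej) /=.
have := psi_step cov col_le1 j Ne; rewrite -(lerD2l (psi b1)) addrA -pE pb' subrK.
by move=> h; apply: h.
Qed.

Let S : R := \sum_j \sum_i `|A i j|%:~R.
Let S0 : 0 <= S. Proof. by do 2!(apply: sumr_ge0 => ? _); rewrite ler0z. Qed.

Lemma entry_bound b i : NA A b -> `|(b i 0)%:~R : C| <= rc (psi b * S).
Proof.
move=> Nb; have [fs _] := selP cov Nb.
have ge0 k : 0 <= cz (sel A wn q b) b k by have /forallP := sel_cone cov Nb; apply.
have H j : `|cz (sel A wn q b) b j| <= psi b.
  rewrite ger0_norm // psi_sel (bigD1 j) //= lerDl.
  by apply: sumr_ge0 => k _.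
have := lattice_bound (Fan_basis fs) H i.
by rewrite -intr_norm -(rmorph_int rc) -lecR.
Qed.

(** The leading system of the slab is translated by e to the level of b. What remains on the other
    side are values at least one unit lower, bounded by X and with coefficients growing like
    [1 + psi b], and the terms raising the gauge by less than 1, bounded by Y. *)
Lemma lead_bound (p : 'I_n -> C) : leaddet (cstw p) ->
  exists (M : C) (h : nat), [/\ 0 <= M, (0 < h)%N &
   forall K u, trunc (cstw p) K u -> forall b, NA A b -> N0 <= psi b <= K ->
   forall X Y : C, 0 <= X -> 0 <= Y ->
    (forall y, NA A y -> psi y <= psi b - 1 -> `|u y| <= X) ->
    (forall y, NA A y -> psi y <= psi b - h%:R^-1 -> `|u y| <= Y) ->
    `|u b| <= M * (rc (1 + psi b) * X + Y)].
Proof.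
move=> /leaddetE ld; have [M0 M00 M0P] := bound_determined pts_uniq ld.
(* There are finitely many slab equations, so the positive gaps between a raise by 1 and the actual
   raise are bounded below; h exceeds all their reciprocals. *)
have [h hP] := fin_nat_bound (fun mk : 'I_(size leqs) * 'I_n =>
  (psi (leqp mk.1) + 1 - psi (leqp mk.1 + col mk.2 A))^-1).
pose cb : C := \sum_i `|beta i|.
pose P : C := \sum_k \sum_i `|(A i k)%:~R * p k|.
have cb0 : 0 <= cb by apply: sumr_ge0 => i _.
have P0 : 0 <= P by do 2!(apply: sumr_ge0 => ? _).
have rS0 : 0 <= rc S by rewrite ler0c.
exists (M0 * (cb + rc S + P)), h.+1; split=> //.
  by rewrite mulr_ge0 // !addr_ge0.
move=> K u tu b Nb /andP[Nb0 bK] X Y X0 Y0 hX hY.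
have [b1 [e [N1 Ne bE /andP[r1 r2] pE]]] := decompose Nb Nb0.
pose v x : C := if psi x == psi b1 then u (x + e) else 0.
have -> : u b = v b1 by rewrite /v eqxx bE.
have pb0 : 0 <= psi b by apply: psi_ge0 cov _ Nb.
set Z := rc (1 + psi b) * X + Y.
have rc1 : 1 <= rc (1 + psi b) by rewrite -(rmorph1 rc) lecR lerDl.
have rc0 : 0 <= rc (1 + psi b) by apply: le_trans rc1.
have rX0 : 0 <= rc (1 + psi b) * X by rewrite mulr_ge0.
have XZ : X <= Z by rewrite /Z ler_wpDr // ler_peMl.
have YZ : Y <= Z by rewrite /Z ler_wpDl.
have Z0 : 0 <= Z by apply: le_trans Y0 YZ.
rewrite -mulrA; apply: M0P; first by rewrite mulr_ge0 // !addr_ge0.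
  move=> [m i]; rewrite lcoefE /=; have [Nm /andP[m1 m2]] := leqpP m.
  have [E|ne] := eqVneq (psi (leqp m) + 1) (psi b1); last first.
    rewrite big1 ?normr0 ?mulr_ge0 ?addr_ge0 // => k /eqP kE.
    by rewrite /v kE (negPf ne) !mulr0.
  pose y := leqp m + e.
  have Ny : NA A y by apply: NAD.
  have py : psi y <= psi b - 1.
    by rewrite pE -E (le_trans (psiD_le cov col_le1 Nm Ne)) // addrAC addrK.
  have := tu y Ny _ i; rewrite -lerBrDr (le_trans py) ?lerD2r // => /(_ isT).
  rewrite (bigID (fun k => psi (leqp m + col k A) == psi (leqp m) + 1)) /= => eqy.
  have -> : \sum_(k | psi (leqp m + col k A) == psi (leqp m) + 1)
       (A i k)%:~R * (cstw p k (leqp m) * v (leqp m + col k A)) =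
     (beta i - (y i 0)%:~R) * u y -
     \sum_(k | psi (leqp m + col k A) != psi (leqp m) + 1) (A i k)%:~R * (cstw p k y * u (y + col k A)).
    rewrite -eqy addrK; apply: eq_bigr => k /eqP kE.
    by rewrite /v kE E eqxx /y addrAC.
  apply: le_trans (ler_normB _ _) _; rewrite [leRHS]mulrDl; apply: lerD.
    rewrite normrM; apply: (@le_trans _ _ ((cb + rc (psi b * S)) * X)).
      apply: ler_pM => //; last exact: hX.
      apply: le_trans (ler_normB _ _) _; apply: lerD.
        by rewrite /cb (bigD1 i) //= lerDl; apply: sumr_ge0 => ? _.
      apply: le_trans (entry_bound _ Ny) _; rewrite lecR ler_wpM2r //.
      by rewrite (le_trans py) // lerBlDr lerDl.
    apply: (@le_trans _ _ ((cb + rc S) * (rc (1 + psi b) * X))).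
      rewrite mulrA; apply: ler_wpM2r => //; rewrite mulrDl; apply: lerD.
        by rewrite ler_peMr.
      by rewrite [leRHS]mulrC -rmorphM lecR ler_wpM2r // lerDr.
    by apply: ler_wpM2l; [rewrite addr_ge0|rewrite /Z lerDl].
  apply: le_trans (ler_norm_sum _ _ _) _.
  apply: (@le_trans _ _ (\sum_(k | psi (leqp m + col k A) != psi (leqp m) + 1)
      (\sum_i `|(A i k)%:~R * p k|) * Z)).
    apply: ler_sum => k ne; rewrite mulrA normrM; apply: ler_pM => //.
      by rewrite (bigD1 i) //= lerDl; apply: sumr_ge0 => ? _.
    apply: le_trans YZ; apply: hY; first by rewrite NAD ?NA_col.
    have NmK := NAD Nm (NA_col A k).
    have gap : 0 < psi (leqp m) + 1 - psi (leqp m + col k A).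
      by rewrite subr_gt0 lt_neqAle ne (psi_step cov col_le1).
    have gap2 : h.+1%:R^-1 <= psi (leqp m) + 1 - psi (leqp m + col k A).
      rewrite -[leRHS]invrK lef_pV2 ?posrE ?ltr0n ?invr_gt0 //.
      by have := hP (m, k) => /ltW /le_trans; apply; rewrite ler_nat.
    rewrite (_ : y + col k A = leqp m + col k A + e); last by rewrite /y addrAC.
    apply: le_trans (psiD_le cov col_le1 NmK Ne) _; rewrite pE -E; by rewrite [_ + psi e - _]addrAC lerD2r lerBrDr addrC -lerBrDr.
  rewrite -mulr_suml; apply: ler_wpM2r => //.
  rewrite /P [leRHS](bigID (fun k => psi (leqp m + col k A) != psi (leqp m) + 1)) /= lerDl.
  by do 2!(apply: sumr_ge0 => ? _).
by rewrite mem_lpts N1 r1.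
Qed.

(* The leading part is invertible and dominates, so values of small gauge determine the
   solution. *)
Lemma trunc_zero p K u : leaddet (cstw p) -> trunc (cstw p) K u ->
  (forall b, NA A b -> psi b <= N0 -> u b = 0) -> forall b, NA A b -> psi b <= K -> u b = 0.
Proof.
move=> /lead_bound[M [h [M0 h0 key]]] tu u0; apply: psi_ind => b Nb bK IH.
have [|/ltW pb] := leP (psi b) N0; first exact: u0.
apply/eqP; rewrite -normr_le0.
have := key K u tu b Nb _ 0 0 (lexx _) (lexx _); rewrite pb bK !mulr0 addr0 mulr0.
apply=> // y Ny py; rewrite IH ?normr0 //; apply: le_lt_trans py _.
  by rewrite ltrBlDr ltrDl.
by rewrite ltrBlDr ltrDl invr_gt0 ltr0n.
Qed.

(** Induction in steps of [1/h]. The X term costs a factor of order [psi b] but descends a whole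
    unit; the Y term costs a constant and descends one step. This gives geometric growth and one
    factor of the factorial per unit. *)
Lemma factorial_growth p u : leaddet (cstw p) -> fullsol (cstw p) u ->
  exists (G B : C) (h : nat), [/\ 0 <= G, 1 <= B &
    forall (m : nat) b, NA A b -> psi b <= m%:R ->
      `|u b| <= G * B ^+ (h * m) * (m.+1)`!%:R].
Proof.
move=> /lead_bound[M [h [M0 h0 key]]] fu.
pose G : C := \sum_(y <- levelseq N0) `|u y|.
have G0 : 0 <= G by apply: sumr_ge0.
have GP y : NA A y -> psi y <= N0 -> `|u y| <= G.
  move=> Ny py; have yin : y \in levelseq N0 by rewrite mem_levelseq Ny.
  rewrite /G (bigD1_seq y) ?levelseq_uniq //= lerDl.
  by apply: sumr_ge0.
pose c1 : C := rc (2 + N0).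
have c10 : 0 <= c1 by rewrite ler0c addr_ge0 // (le_trans _ N01).
pose B := M * (c1 * h%:R + 1) + 1.
have B1 : 1 <= B by rewrite lerDr mulr_ge0 // addr_ge0 // mulr_ge0.
have B0 : 0 <= B by apply: le_trans B1.
pose F m := ((m %/ h).+1)`!.
have hR : 0 < h%:R :> R by rewrite ltr0n.
have H m b : NA A b -> psi b <= N0 + m%:R / h%:R -> `|u b| <= G * B ^+ m * (F m)%:R.
  elim/ltn_ind: m b => -[|m] IH b Nb pb.
    by rewrite /F div0n expr0 !mulr1; apply: GP => //; rewrite mul0r addr0 in pb.
  have F1 k : 1 <= (F k)%:R :> C by rewrite ler1n fact_gt0.
  have Bk k : 1 <= B ^+ k by rewrite exprn_ege1.
  have [pb0|/ltW pb0] := leP (psi b) N0.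
    apply: le_trans (GP b Nb pb0) _; rewrite -mulrA ler_peMr // mulr_ege1 //.
  pose X := G * B ^+ (m.+1 - h) * (F (m.+1 - h)%N)%:R.
  pose Y := G * B ^+ m * (F m)%:R.
  have X0 : 0 <= X by rewrite !mulr_ge0 // exprn_ge0.
  have Y0 : 0 <= Y by rewrite !mulr_ge0 // exprn_ge0.
  have := key _ u (fu (psi b)) b Nb _ X Y X0 Y0; rewrite pb0 lexx => /(_ isT) key'.
  apply: le_trans (key' _ _) _.
  - move=> y Ny py; apply: IH; rewrite ?ltn_subrL ?h0 //.
    have [hm|hm] := leqP h m.+1.
      rewrite natrB // mulrBl divff ?gt_eqF // addrA; apply: le_trans py _.
      by rewrite lerD2r.
    rewrite (_ : m.+1 - h = 0)%N ?mul0r ?addr0; last by apply/eqP; rewrite subn_eq0 ltnW.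
    apply: le_trans py _; rewrite lerBlDr; apply: le_trans pb _; rewrite lerD2l.
    by rewrite ler_pdivrMr // mul1r ler_nat ltnW.
  - move=> y Ny py; apply: IH => //; apply: le_trans py _.
    rewrite lerBlDr; apply: le_trans pb _.
    by rewrite -addrA lerD2l -natr1 mulrDl mul1r.
  have psim : rc (1 + psi b) <= c1 * m.+1%:R.
    rewrite /c1 -(rmorph_nat rc) -rmorphM lecR.
    have mh : m.+1%:R / h%:R <= m.+1%:R :> R by rewrite ler_pdivrMr // ler_peMr // ler1n.
    have : 1 <= m.+1%:R :> R by rewrite ler1n.
    have : N0 <= N0 * m.+1%:R by rewrite ler_peMr ?ler1n // (le_trans _ N01).
    rewrite mulrDl; move: pb mh; set t := m.+1%:R; lra.
  have FX : m.+1%:R * (F (m.+1 - h)%N)%:R <= h%:R * (F m.+1)%:R :> C.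
    by rewrite -!natrM ler_nat; apply: factorial_step.
  have FY : (F m)%:R <= (F m.+1)%:R :> C.
    by rewrite ler_nat /F; apply: leq_fact; rewrite ltnS leq_div2r.
  have e1 : rc (1 + psi b) * X <= c1 * h%:R * (G * B ^+ m * (F m.+1)%:R).
    apply: (@le_trans _ _ (c1 * m.+1%:R * X)); first exact: ler_wpM2r.
    have -> : c1 * m.+1%:R * X = c1 * (G * B ^+ (m.+1 - h)) * (m.+1%:R * (F (m.+1 - h)%N)%:R).
      by rewrite /X; ring.
    have -> : c1 * h%:R * (G * B ^+ m * (F m.+1)%:R) = c1 * (G * B ^+ m) * (h%:R * (F m.+1)%:R).
      by ring.
    apply: ler_pM; [by rewrite !mulr_ge0 // exprn_ge0|by rewrite mulr_ge0 ?ler0n| |exact: FX].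
    apply: ler_wpM2l => //; apply: ler_wpM2l => //; apply: ler_weXn2l => //.
    by rewrite leq_subLR -addn1 addnC leq_add2r.
  have e2 : Y <= G * B ^+ m * (F m.+1)%:R.
    by apply: ler_wpM2l => //; rewrite mulr_ge0 // exprn_ge0.
  apply: (@le_trans _ _ (M * ((c1 * h%:R + 1) * (G * B ^+ m * (F m.+1)%:R)))).
    by apply: ler_wpM2l => //; rewrite mulrDl mul1r lerD.
  have -> : M * ((c1 * h%:R + 1) * (G * B ^+ m * (F m.+1)%:R)) =
      (M * (c1 * h%:R + 1)) * (G * B ^+ m * (F m.+1)%:R) by rewrite mulrA.
  have -> : G * B ^+ m.+1 * (F m.+1)%:R = B * (G * B ^+ m * (F m.+1)%:R).
    by rewrite exprS; ring.
  by apply: ler_wpM2r; [rewrite !mulr_ge0 // exprn_ge0|rewrite /B lerDl].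
exists G, B, h; split=> // m b Nb pb.
have := H (h * m)%N b Nb; rewrite /F mulKn //; apply.
rewrite natrM mulrAC divff ?gt_eqF // mul1r (le_trans pb) // lerDr.
exact: le_trans N01.
Qed.

Definition curve (x : C) : 'I_n -> L -> C := fun k b => x ^+ expo k b.

Lemma curve0 k b : NA A b -> curve 0 k b = (star b k)%:R.
Proof. by move=> Nb; rewrite /curve expr0n expo_star. Qed.

(** Multiplying u by [x ^ phi] turns the coefficients [x ^+ wn k] into [x ^+ expo k b]. For x
    nonzero the two systems are equivalent, and the second one extends to x = 0, where it is the
    limit system. *)
Lemma curve_phi x k b (c : C) : x != 0 -> NA A b ->
  curve x k b * (x ^ phi (b + col k A) * c) = x ^ phi b * (x ^+ wn k * c).
Proof.
move=> x0 Nb; rewrite /curve !mulrA; congr (_ * _).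
rewrite !exprnP -!expfzDr // expoE //; congr (x ^ _).
by rewrite subrK addrC.
Qed.

Lemma lead_scale x : x != 0 -> leaddet (curve x) -> leaddet (cstw (fun k => x ^+ wn k)).
Proof.
move=> x0 ld v lv b Nb pb.
have /(_ _ b Nb pb)/eqP := ld (fun b => x ^ phi b * v b).
rewrite mulf_eq0 expfz_eq0 (negPf x0) andbF => h; apply/eqP/h => {h b Nb pb} b Nb pb i.
have /(congr1 (fun z => x ^ phi b * z)) := lv b Nb pb i.
rewrite mulr0 mulr_sumr => E; apply: etrans E.
by apply: eq_bigr => k _; rewrite curve_phi // mulrCA.
Qed.

Lemma trunc_scale x K X : x != 0 -> truncdet (curve x) K X ->
  truncdet (cstw (fun k => x ^+ wn k)) K X.
Proof.
move=> x0 td u tu ur b Nb pb.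
have /(_ _ _ b Nb pb)/eqP := td (fun b => x ^ phi b * u b).
rewrite mulf_eq0 expfz_eq0 (negPf x0) andbF => h; apply/eqP/h => {h b Nb pb}.
  move=> b Nb pb i; rewrite [RHS]mulrCA -(tu b Nb pb) mulr_sumr.
  by apply: eq_bigr => k _; rewrite curve_phi // mulrCA.
by move=> r /ur ->; rewrite mulr0.
Qed.

Lemma psi_seq_bound (X : seq L) : (forall r, r \in X -> NA A r) ->
  exists2 B, N0 <= B & forall r, r \in X -> NA A r && (psi r <= B).
Proof.
move=> XN; have X0 : 0 <= \sum_(y <- X) psi y.
  by rewrite big_seq; apply: sumr_ge0 => y /XN; apply: psi_ge0.
exists (N0 + \sum_(r <- X) psi r) => [|r rX]; first by rewrite lerDl.
rewrite XN //= ler_wpDl ?(le_trans _ N01) //.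
elim: X rX XN {X0} => [//|y X IH]; rewrite inE big_cons => /orP[/eqP->|rX] XN.
  rewrite lerDl big_seq; apply: sumr_ge0 => z zX; apply: psi_ge0 => //.
  by apply: XN; rewrite inE zX orbT.
rewrite ler_wpDl ?IH //; first by apply: psi_ge0 => //; apply: XN; rewrite mem_head.
by move=> z zX; apply: XN; rewrite inE zX orbT.
Qed.

Lemma good_point (X : seq L) : (forall r, r \in X -> NA A r) ->
  (forall u, limsol A w beta u -> (forall r, r \in X -> u r = 0) -> forall b, NA A b -> u b = 0) ->
  exists p K, [/\ leaddet (cstw p), N0 <= K & truncdet (cstw p) K X].
Proof.
move=> XN det; have [B NB XB] := psi_seq_bound XN.
have [K BK tdK] : exists2 K, B <= K & truncdet (fun k b => (star b k)%:R) K X.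
  apply: trunc_stabilize XB _ _.
    move=> K u tu u0; apply: (limit_trunc_zero tu) => b Nb pb; apply: u0 => //.
    exact: le_trans pb NB.
  move=> u fu ur; apply: det => // b Nb i.
  have := fu (psi b + 1) b Nb (lexx _) i => <-.
  rewrite big_mkcond; apply: eq_bigr => k _.
  by case: ifP => _; rewrite ?mul1r ?mul0r ?mulr0.
have td0 : truncdet (curve 0) K X.
  move=> u tu ur; apply: tdK ur => b Nb pb i; rewrite -(tu b Nb pb).
  by apply: eq_bigr => k _; rewrite curve0.
have ld0 : leaddet (curve 0).
  move=> v lv; apply: leaddet_limit => b Nb pb i; rewrite -[RHS](lv b Nb pb i).
  by apply: eq_bigr => k _; rewrite curve0.
have XK r : r \in X -> NA A r && (psi r <= K).
  by move=> /XB /andP[-> h]; apply: le_trans BK.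
have [D1 [D10 D1P D1Q]] := open_leaddet ld0.
have [D2 [D20 D2P D2Q]] := open_truncdet XK td0.
pose Q (f : C -> C) := exists P : {poly C}, forall x, f x = P.[x].
have QR : ring_closed Q.
  split=> [k|f g [P fP] [P' gP]|f g [P fP] [P' gP]].
  - by exists k%:P => x; rewrite hornerC.
  - by exists (P + P') => x; rewrite hornerD fP gP.
  - by exists (P * P') => x; rewrite hornerM fP gP.
have Qk k b : Q (fun x => curve x k b) by exists ('X^(expo k b)) => x; rewrite hornerXn.
have [F1 F1E] := D1Q Q QR Qk; have [F2 F2E] := D2Q Q QR Qk.
(* The third polynomial ['X] secures a nonzero parameter, for which the rescaling can be undone; the
   other two are nonzero because they are so at 0. *)
have [i|m mP] := @common_nonroot C 'I_3 (fun i => if i == 0 then F1 else if i == 1 then F2 else 'X).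
  case: ifP => _; first by apply: contra_neq D10 => F10; rewrite F1E F10 horner0.
  case: ifP => _; first by apply: contra_neq D20 => F20; rewrite F2E F20 horner0.
  by rewrite polyX_eq0.
have x0 : (m%:R : C) != 0 by have := mP (2%:R); rewrite /= hornerX.
exists (fun k => m%:R ^+ wn k), K; split.
- by apply: lead_scale => //; apply: D1P; have := mP 0; rewrite /= F1E.
- exact: le_trans NB BK.
- by apply: trunc_scale => //; apply: D2P; have := mP 1; rewrite /= F2E.
Qed.

Notation nasol := (nasol A beta).

Lemma nasol_full p u : nasol p u -> fullsol (cstw p) u.
Proof. by move=> su K b Nb _ i; apply: su. Qed.

Lemma psi_lcomb a : psi (lcomb A a) <= (mi_deg a)%:R.
Proof.
have [fs _] := selP cov (NA_lcomb A a).
rewrite psi_sel; under eq_bigr do rewrite /lcomb cz_sum.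
rewrite exchange_big /= /mi_deg natr_sum; apply: ler_sum => k _.
under eq_bigr do rewrite czMn -mulr_natl.
rewrite -mulr_sumr ler_piMr //.
by have := col_le1 k fs; rewrite -[col k AR]toR_col.
Qed.

Lemma ser_convergent p u : leaddet (cstw p) -> nasol p u -> convergent (ser A u).
Proof.
move=> ld su.
have [G [B [h [G0 B1 GB]]]] := factorial_growth ld (nasol_full su).
have B0 : 0 < B by apply: lt_le_trans B1.
(* With m the degree of a, [2 ^ m] dominates m + 1, [n.+1 ^ m] dominates the quotient of m! by a!,
   and [B ^+ h] is the geometric rate. *)
pose T : C := 2%:R * n.+1%:R * B ^+ h.
have T0 : 0 < T by rewrite !mulr_gt0 ?exprn_gt0 // ltr0n.
exists T^-1, G; split; first by rewrite invr_gt0.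
move=> a; have mf : 0 < (mi_fact a)%:R :> C by rewrite ltr0n mi_fact_gt0.
rewrite exprVn ler_pdivrMr ?exprn_gt0 // /ser normrM normfV (gtr0_norm mf) ler_pdivrMr //.
apply: le_trans (GB _ _ (NA_lcomb A a) (psi_lcomb a)) _.
rewrite -!mulrA ler_wpM2l // /T !exprMn -exprM [leRHS]mulrAC [leRHS]mulrC.
rewrite ler_wpM2l ?exprn_ge0 //; first exact: ltW.
rewrite -!natrX -!natrM ler_nat factS -mulnA.
apply: leq_mul; last exact: fact_deg_le.
exact: ltn_expl.
Qed.

Lemma sol_ser p u : leaddet (cstw p) -> nasol p u -> gkz_solution A beta p (ser A u).
Proof.
move=> ld su; have [f1 f2] := ser_formal su.
by split=> //; apply: ser_convergent ld su.
Qed.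

Definition detset p (X : seq L) := forall u, nasol p u ->
  (forall r, r \in X -> u r = 0) -> forall b, NA A b -> u b = 0.

Lemma nasol_comb p m (u : 'I_m -> L -> C) (lam : 'I_m -> C) :
  (forall l, nasol p (u l)) -> nasol p (fun b => \sum_l lam l * u l b).
Proof.
move=> su b Nb i; rewrite mulr_sumr.
under eq_bigr do rewrite 2!mulr_sumr.
rewrite exchange_big; apply: eq_bigr => l _ /=.
rewrite [RHS]mulrCA -(su l b Nb) mulr_sumr; apply: eq_bigr => k _.
by ring.
Qed.

(** Leaving out one point of a smallest determining set admits a solution that is nonzero at this
    point and zero on the rest; these dual solutions are independent. Conversely, evaluation on X is
    injective on solutions, which bounds the dimension. *)
Lemma detset_dim p (X : seq L) : leaddet (cstw p) -> (forall x, x \in X -> NA A x) ->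
  detset p X -> (forall Y, (forall y, y \in Y -> NA A y) -> detset p Y -> (size X <= size Y)%N) ->
  sol_dim A beta p (size X).
Proof.
move=> ld XN det mini; split.
  have ex (l : 'I_(size X)) : exists u, [/\ nasol p u, u (nth 0 X l) != 0 &
      forall m : 'I_(size X), m != l -> u (nth 0 X m) = 0].
    pose Y := take l X ++ drop l.+1 X.
    have YN y : y \in Y -> NA A y.
      by rewrite mem_cat => /orP[/mem_take|/mem_drop]; apply: XN.
    have XY (m : 'I_(size X)) : m != l -> nth 0 X m \in Y.
      rewrite -val_eqE /= neq_ltn mem_cat => /orP[lt|lt].
        by rewrite -(nth_take 0 lt) mem_nth // size_take ltn_ord.
      apply/orP; right; rewrite -(subnKC lt) -nth_drop mem_nth // size_drop ltn_sub2r //.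
      exact: leq_ltn_trans lt (ltn_ord m).
    have /existsNP[u /not_implyP[su /not_implyP[uY /existsNP[b /not_implyP[Nb ub]]]]] : ~ detset p Y.
      move=> dY; have := mini Y YN dY; rewrite size_cat size_take ltn_ord size_drop.
      by rewrite leqNgt => /negP; apply; rewrite -[ltnRHS](subnKC (ltn_ord l)) addSn.
    exists u; split=> [//||m ml]; last by apply: uY; apply: XY.
    apply/eqP => ul; apply: ub; apply: (det u su) => // x /(nthP 0)[i iX <-].
    have [il|il] := eqVneq (Ordinal iX) l; first by rewrite -ul -il.
    by apply: uY; apply: (XY (Ordinal iX)).
  have [u uP] := choice ex; exists (fun l => ser A (u l)); split.
    by move=> l; have [su _ _] := uP l; apply: sol_ser.
  move=> lam lam0 m; have /NAP[a aE] : NA A (nth 0 X m) by apply: XN; apply: mem_nth.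
  have := lam0 a; rewrite (bigD1 m) //= /ser -aE big1 ?addr0; last first.
    by move=> l lm; have [_ _ ->] := uP l; rewrite ?mul0r ?mulr0 // eq_sym.
  move/eqP; rewrite mulf_eq0 mulf_eq0 invr_eq0 (negPf (mi_fact_neq0 R a)) orbF.
  by have [_ /negPf -> _] := uP m; rewrite orbF => /eqP.
move=> f fs lif.
pose M : 'M[C]_((size X).+1, size X) := \matrix_(l, m) unser A (f l) (nth 0 X m).
have : kermx M != 0.
  by rewrite -mxrank_eq0 mxrank_ker -lt0n subn_gt0 ltnS rank_leq_col.
case/rowV0Pn => v /sub_kermxP vM v0.
have fo l : formal A beta p (f l) by have [_ ? ?] := fs l.
have su := nasol_comb (v 0) (fun l => unser_sol (fo l)).
have z : forall b, NA A b -> \sum_l v 0 l * unser A (f l) b = 0.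
  apply: (det _ su) => x /(nthP 0)[i iX <-].
  have := congr1 (fun N : 'rV_(size X) => N 0 (Ordinal iX)) vM.
  rewrite !mxE => E; apply: etrans E; apply: eq_bigr => l _.
  by rewrite mxE.
have := lif (v 0); move=> H; have v00 : forall l, v 0 l = 0.
  apply: H => a; under eq_bigr => l _ do rewrite (unserK a (fo l)) mulrA.
  by rewrite -mulr_suml z ?mul0r // NA_lcomb.
by case/eqP: v0; apply/rowP => l; rewrite mxE v00.
Qed.

(** r is the least size of a determining set over all points where [D1] is nonzero. A set attaining
    it at one point remains determining where [D2] is nonzero as well, and no smaller set can occur
    there, so the dimension is constant. Convergence of formal solutions is recorded for the lower
    bound in the example. *)
Lemma generic_rank (X0 : seq L) : (forall r, r \in X0 -> NA A r) ->
  (forall u, limsol A w beta u -> (forall r, r \in X0 -> u r = 0) ->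
     forall b, NA A b -> u b = 0) ->
  exists (r : nat) (h : seq (C * mi n)), [/\ (exists p, peval h p != 0),
    (forall p, peval h p != 0 -> sol_dim A beta p r /\
       forall c, formal A beta p c -> convergent c) &
    (r <= size X0)%N].
Proof.
move=> X0N X0det.
have [p0 [K0 [ld0 NK0 td0]]] := good_point X0N X0det.
have [D1 [D10 D1P D1Q]] := @open_leaddet _ (fun p => cstw p) p0 ld0.
have polyD1 : polyfun D1.
  by apply: (D1Q _ (polyfun_ring R n)) => k b; apply: polyfun_coord.
pose good r := `[< exists p X, [/\ D1 p != 0, size X = r, forall x, x \in X -> NA A x & detset p X] >].
have base p K u : leaddet (cstw p) -> trunc (cstw p) K u ->
    (forall b, NA A b -> psi b <= N0 -> u b = 0) -> forall b, NA A b -> psi b <= K -> u b = 0.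
  exact: trunc_zero.
have upgrade p K X : N0 <= K -> D1 p != 0 -> truncdet (cstw p) K X -> detset p X.
  move=> NK dp td u su ux b Nb; have ld := D1P p dp.
  apply: (base p (psi b) u ld (nasol_full su (K:=psi b)) _ b Nb (lexx _)) => y Ny py.
  by apply: (td u (nasol_full su (K:=K)) ux) => //; apply: le_trans NK.
have gex : exists r, good r.
  by exists (size X0); apply/asboolP; exists p0, X0; split=> //; apply: upgrade NK0 D10 td0.
have [r /asboolP[p1 [X1 [Dp1 sX1 X1N X1det]]] rmin] := ex_minnP gex.
have [B NB XB] := psi_seq_bound X1N.
have [K BK tdK] : exists2 K, B <= K & truncdet (cstw p1) K X1.
  apply: (trunc_stabilize XB).
    move=> K u tu u0; apply: (base p1 K u (D1P _ Dp1) tu) => b Nb pb.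
    by apply: u0 => //; apply: le_trans NB.
  move=> u fu; apply: X1det => b Nb i.
  exact: (fu (psi b + 1)).
have XK x : x \in X1 -> NA A x && (psi x <= K).
  by move=> /XB /andP[-> h]; apply: le_trans BK.
have [D2 [D20 D2P D2Q]] := @open_truncdet K X1 XK _ (fun p => cstw p) p1 tdK.
have polyD2 : polyfun D2.
  by apply: (D2Q _ (polyfun_ring R n)) => k b; apply: polyfun_coord.
have [h hE] : polyfun (fun p => D1 p * D2 p) by have [_ _ QM] := polyfun_ring R n; apply: QM.
exists r, h; split.
- by exists p1; rewrite -hE mulf_neq0.
- move=> p; rewrite -hE mulf_eq0 negb_or => /andP[d1 d2].
  have ld := D1P p d1; have detp : detset p X1.
    by apply: upgrade (le_trans NB BK) d1 _; apply: D2P.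
  split; last first.
    move=> c fc; have -> : c = ser A (unser A c) by apply: funext => a; apply: unserK fc.
    exact: ser_convergent ld (unser_sol fc).
  rewrite -sX1; apply: detset_dim => // Y YN dY; rewrite sX1.
  by apply: rmin; apply/asboolP; exists p, Y.
by apply: rmin; apply/asboolP; exists p0, X0; split=> //; apply: upgrade NK0 D10 td0.
Qed.

End Systems.

(** * Bound of the rank by the indices of the cells *)

Section Assembly.
Variables (R : realType) (n : nat) (A : 'M[int]_(3, n)).
Notation L := 'cV[int]_3.
Notation C := R[i].
Let AR : 'M[R]_(3, n) := map_mx intr A.

Hypothesis ptA : pointed R A.
Hypothesis spA : spans_lattice A.

Lemma spans_col (b : L) : exists lam : 'I_n -> int, b = \sum_l col l A *~ lam l.
Proof.
have [lam lamE] := spA (fun i => b i 0); exists lam; apply/colP => i.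
rewrite lamE summxE; apply: eq_bigr => j _.
by rewrite -scaler_int !mxE intz.
Qed.

Lemma spans_right_inverse : exists B : 'M[R]_(n, 3), AR *m B = 1%:M.
Proof.
have [lam lamE] := choice (fun k : 'I_3 => spA (fun i => (i == k)%:R)).
exists (\matrix_(j, k) (lam k j)%:~R); apply/matrixP => i k; rewrite !mxE.
transitivity ((i == k)%:R%:~R : R); last by case: (i == k).
rewrite (lamE k) rmorph_sum; apply: eq_bigr => j _ /=.
by rewrite !mxE rmorphM mulrC.
Qed.

Lemma pointed_row : exists h : 'rV[R]_3, forall j, 0 < (h *m col j AR) 0 0.
Proof.
have [w wP] := ptA; exists (\row_i w i) => j; rewrite mxE.
by under eq_bigr do rewrite !mxE; apply: wP.
Qed.

Lemma triangulation : exists (wn : 'I_n -> nat) (q : 'cV[R]_3),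
  let w j : R := (wn j)%:R in
  [/\ forall x, (exists lam : 'cV[R]_n, (forall j, 0 <= lam j 0) /\ x = AR *m lam) ->
        exists2 s, Fan A w s & hopen AR q s x,
      forall s j, basis AR s -> j \in s -> co AR s q j != 0,
      forall s l, Fan A w s -> \sum_j co AR s (col l AR) j <= 1 &
      forall s b, basis AR s -> exists z : int, cost AR w s (toR R b) = z%:~R].
Proof.
have [wn [q [gw gen_q cq iw col_le1]]] := generic_weights R A.
exists wn, q; split=> // x; apply: fan_cover => //.
  exact: spans_right_inverse.
exact: pointed_row.
Qed.

Section Weights.
Variables (wn : 'I_n -> nat) (q : 'cV[R]_3).
Let w j : R := (wn j)%:R.
Hypothesis cov : forall x, (exists lam : 'cV[R]_n, (forall j, 0 <= lam j 0) /\ x = AR *m lam) ->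
        exists2 s, Fan A w s & hopen AR q s x.
Hypothesis gen_q : forall s j, basis AR s -> j \in s -> co AR s q j != 0.
Hypothesis col_le1 : forall s l, Fan A w s -> \sum_j co AR s (col l AR) j <= 1.
Hypothesis cost_int : forall s b, basis AR s -> exists z : int, cost AR w s (toR R b) = z%:~R.

Lemma cov_NA x : NA A x -> exists2 t, Fan A w t & Hopen A q t x.
Proof.
move=> /NAP[u ->]; apply: cov; exists (\col_j (u j)%:R); split=> [j|].
  by rewrite mxE.
apply/colP => i; rewrite !mxE summxE rmorph_sum; apply: eq_bigr => j _ /=.
by rewrite mulmxnE !mxE rmorphMn /= mulr_natr.
Qed.

Lemma generic_rank_lt (beta : 'I_3 -> C) : exists (r : nat) (h : seq (C * mi n)),
  [/\ (exists p, peval h p != 0),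
    (forall p, peval h p != 0 -> sol_dim A beta p r /\
       forall c, formal A beta p c -> convergent c) &
    (r < (\sum_(s | Fan A w s) size (boxseq R A s)).*2)%N].
Proof.
have [N0 [N01 descent leadL]] := lead_limit cov_NA.
pose X0 := flatten [seq reps A q beta s | s <- enum (Fan A w)].
have memX0 r : r \in X0 <-> exists2 s, Fan A w s & r \in reps A q beta s.
  split=> [/flattenP[_ /mapP[s + ->] rs]|[s fs rs]]; last first.
    by apply/flattenP; exists (reps A q beta s) => //; apply: map_f; rewrite mem_enum.
  by rewrite mem_enum => fs; exists s.
have X0N r : r \in X0 -> NA A r.
  move=> /memX0[s fs /allpairsPdep[g [P [gs + ->]]]].
  by rewrite mem_enum inE => /andP[/repP[]].
have [|r [h [hp hs rX]]] := @generic_rank R n A wn q beta cov_NA col_le1 cost_int N0 N01 descent leadL X0 X0N.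
  move=> u lu u0; apply: (limsol_det cov_NA _ lu) => [s b|s r fs rs].
    exact: reps_cover.
  by apply: u0; apply/memX0; exists s.
exists r, h; split=> //; apply: leq_ltn_trans rX _.
rewrite size_flatten /shape -map_comp sumnE big_map big_enum.
exact: total_count cov_NA gen_q col_le1 spans_col.
Qed.

End Weights.
End Assembly.

(** * Volume *)

Lemma ord3_ind (P : 'I_3 -> Prop) : P 0 -> P 1 -> P 2%:R -> forall i, P i.
Proof.
move=> h0 h1 h2 [[|[|[|//]]] lt].
- by rewrite (_ : Ordinal lt = 0) //; apply: val_inj.
- by rewrite (_ : Ordinal lt = 1) //; apply: val_inj.
- by rewrite (_ : Ordinal lt = 2%:R) //; apply: val_inj.
Qed.

Section Lebesgue3.
Variable R : realType.
Local Open Scope classical_set_scope.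

Notation leb := (@lebesgue_measure R).
Notation T := (g_sigma_algebraType (R.-ocitv.-measurable)).
Definition leb3 : {measure set (T * T * T) -> \bar R} := ((leb \x leb) \x leb)%E.

Definition box3 (x y z x' y' z' : R) : set (T * T * T) :=
  `[x, x'[ `*` `[y, y'[ `*` `[z, z'[.

Lemma measurable_box3 x y z x' y' z' : measurable (box3 x y z x' y' z').
Proof. by apply: measurableX; [apply: measurableX|]; exact: measurable_itv. Qed.

Lemma leb3_box3 x y z x' y' z' : x <= x' -> y <= y' -> z <= z' ->
  leb3 (box3 x y z x' y' z') = ((x' - x) * (y' - y) * (z' - z))%:E.
Proof.
move=> hx hy hz; have mI (a b : R) : measurable (`[a, b[ : set T) by exact: measurable_itv.
apply: etrans (@product_measure1E _ _ _ _ R (leb \x leb)%E leb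
  (`[x, x'[ `*` `[y, y'[) (`[z, z'[) (measurableX (mI _ _) (mI _ _)) (mI _ _)) _.
apply: etrans (congr1 (fun t => (t * leb `[z, z'[)%E)
  (@product_measure1E _ _ _ _ R leb leb (`[x, x'[) (`[y, y'[) (mI _ _) (mI _ _))) _.
have itvE (a b : R) : a <= b -> leb `[a, b[ = (b - a)%:E.
  rewrite le_eqVlt => /orP[/eqP->|ab]; rewrite lebesgue_measure_itv /= lte_fin.
    by rewrite ltxx subrr.
  by rewrite ab EFinB.
by rewrite EFinM EFinM -(itvE _ _ hx) -(itvE _ _ hy) -(itvE _ _ hz).
Qed.

Lemma in_box3 x y z x' y' z' (p : T * T * T) : box3 x y z x' y' z' p <->
  [/\ x <= p.1.1 < x', y <= p.1.2 < y' & z <= p.2 < z'].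
Proof.
rewrite /box3 /=; split=> [[[h1 h2] h3]|[h1 h2 h3]].
  by move: h1 h2 h3; rewrite /= !in_itv.
by split; [split|]; rewrite /= in_itv.
Qed.

(** Cubes of side [1/N] at distinct points of the scaled lattice are disjoint, because the floor of
    the rescaled coordinates recovers the lattice point. *)
Lemma leb3_packing (S : set (R * R * R)) (X : seq 'cV[int]_3) (v : 'I_3 -> R) (N : R) :
  0 < N -> uniq X -> measurable (S : set (T * T * T)) ->
  (forall b (y : 'I_3 -> R), b \in X -> (forall i, 0 <= y i < 1) ->
    S (((b 0 0)%:~R + v 0 + y 0) / N, ((b 1 0)%:~R + v 1 + y 1) / N,
       ((b 2%:R 0)%:~R + v 2%:R + y 2%:R) / N)) ->
  (((size X)%:R / N ^+ 3)%:E <= leb3 S)%E.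
Proof.
move=> N0 uX mS XS.
pose F (m : 'I_(size X)) : set (T * T * T) := let b := nth 0 X m in
  let lo i := ((b i 0)%:~R + v i) / N in let hi i := ((b i 0)%:~R + v i + 1) / N in
  box3 (lo 0) (lo 1) (lo 2%:R) (hi 0) (hi 1) (hi 2%:R).
have lohi (b : 'cV[int]_3) i : ((b i 0)%:~R + v i) / N <= ((b i 0)%:~R + v i + 1) / N.
  by rewrite ler_pM2r ?invr_gt0 // lerDl.
have mF m : measurable (F m) by apply: measurable_box3.
have coord (b : 'cV[int]_3) i (t : R) :
    ((b i 0)%:~R + v i) / N <= t < ((b i 0)%:~R + v i + 1) / N ->
    b i 0 = Num.floor (N * t - v i) /\ 0 <= N * t - v i - (b i 0)%:~R < 1.
  rewrite ler_pdivrMr // ltr_pdivlMr // => h.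
  have h' : 0 <= N * t - v i - (b i 0)%:~R < 1 by lra.
  split=> //; apply/esym/floor_def; rewrite intrD; lra.
have tF : trivIset setT F.
  move=> m m' _ _ [p [/in_box3[/coord[a1 _] /coord[a2 _] /coord[a3 _]]]].
  move=> /in_box3[/coord[b1 _] /coord[b2 _] /coord[b3 _]].
  apply/val_inj/eqP; rewrite -(nth_uniq 0 (ltn_ord m) (ltn_ord m') uX); apply/eqP/colP => i.
  by move: i; apply: ord3_ind; rewrite ?a1 ?a2 ?a3 ?b1 ?b2 ?b3.
apply: (@le_trans _ _ (leb3 (\big[setU/set0]_(m < size X) F m))).
  rewrite measure_bigsetU_ord //.
  rewrite (eq_bigr (fun=> ((N^-1) ^+ 3)%:E)); last first.
    move=> m _; rewrite /F /= leb3_box3 //; congr (_%:E).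
    have E i : ((nth 0 X m i 0)%:~R + v i + 1) / N - ((nth 0 X m i 0)%:~R + v i) / N = N^-1.
      by rewrite -mulrBl addrC addKr mul1r.
    by rewrite !E !exprS expr0 mulr1 mulrA.
  by rewrite sumEFin sumr_const card_ord exprVn mulr_natl.
apply: le_measure; rewrite ?inE //; first exact: bigsetU_measurable.
move=> p; rewrite -bigcup_seq => -[m _] /in_box3[/coord[_ a1] /coord[_ a2] /coord[_ a3]].
have bX : nth 0 X m \in X by apply: mem_nth.
pose y i := if i == 0 then N * p.1.1 - v i - (nth 0 X m i 0)%:~R else
  if i == 1 then N * p.1.2 - v i - (nth 0 X m i 0)%:~R else N * p.2 - v i - (nth 0 X m i 0)%:~R.
have back (t c e : R) : (c + e + (N * t - e - c)) / N = t.
  by have Nn : N != 0 by [rewrite gt_eqF]; field.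
have := XS _ y bX; rewrite /y /= !back => H.
have {}H : S (p.1.1, p.1.2, p.2) by apply: H; apply: ord3_ind.
by case: p H {a1 a2 a3 y} => [[]].
Qed.

Lemma leb3_bounded (S : set (R * R * R)) (M : R) : 0 <= M ->
  (forall x, S x -> [/\ `|x.1.1| <= M, `|x.1.2| <= M & `|x.2| <= M]) ->
  S `<=` box3 (- M) (- M) (- M) (M + 1) (M + 1) (M + 1).
Proof.
move=> M0 SM x /SM[]; rewrite !ler_norml => h1 h2 h3; apply/in_box3; split.
- by move/andP: h1 => [-> h]; apply: le_lt_trans h _; rewrite ltrDl.
- by move/andP: h2 => [-> h]; apply: le_lt_trans h _; rewrite ltrDl.
- by move/andP: h3 => [-> h]; apply: le_lt_trans h _; rewrite ltrDl.
Qed.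

Lemma leb3_fin (S : set (R * R * R)) (M : R) : 0 <= M -> measurable (S : set (T * T * T)) ->
  (forall x, S x -> [/\ `|x.1.1| <= M, `|x.1.2| <= M & `|x.2| <= M]) ->
  leb3 S \is a fin_num.
Proof.
move=> M0 mS SM; rewrite ge0_fin_numE ?measure_ge0 //.
apply: (@le_lt_trans _ _ (leb3 (box3 (- M) (- M) (- M) (M + 1) (M + 1) (M + 1)))).
  by apply: le_measure; rewrite ?inE //; [exact: measurable_box3|exact: leb3_bounded].
have h : - M <= M + 1 by apply: le_trans (ge0_cp M0).1 _; rewrite addr_ge0.
by rewrite leb3_box3 // ltry.
Qed.

Lemma measurable_halfspace (a b c t : R) :
  measurable ([set x | a * x.1.1 + b * x.1.2 + c * x.2 <= t] : set (T * T * T)).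
Proof.
have mf : measurable_fun setT (fun x : T * T * T => a * x.1.1 + b * x.1.2 + c * x.2 : R).
  apply: measurable_funD; first apply: measurable_funD.
  - by apply: measurable_funM => //; apply: measurableT_comp measurable_fst.
  - by apply: measurable_funM => //; apply: measurableT_comp measurable_fst.
  - by apply: measurable_funM => //; apply: measurable_snd.
have := mf measurableT _ (@measurable_itv R `]-oo, t]%R); rewrite setTI.
by congr measurable; apply/seteqP; split=> x /=; rewrite in_itv.
Qed.

End Lebesgue3.

Lemma cubic_growth (R : realType) (m V c : R) : 0 <= V -> 0 <= c ->
  (forall K : nat, m * K.+1%:R ^+ 3 <= V * (K.+1%:R + c) ^+ 3) -> m <= V.
Proof.
move=> V0 c0 H; rewrite leNgt; apply/negP => Vm.
have d0 : 0 < m - V by rewrite subr_gt0.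
(* For X at least c, the cube of X + c exceeds that of X by at most 3 + 3 + 1 times [c * X ^+ 2].
   Beyond B this excess, multiplied by V, is smaller than [(m - V) * X ^+ 3]. *)
pose B := 7%:R * V * c / (m - V) + c.
have B0 : 0 <= B by rewrite addr_ge0 // divr_ge0 ?mulr_ge0 // ltW.
pose K := Num.truncn B; have lt : B < K.+1%:R by apply: truncnS_gt.
have := H K; move: (K.+1%:R) lt => X lt.
have cX : c <= X by apply: le_trans (ltW lt); rewrite lerDr divr_ge0 ?mulr_ge0 // ltW.
have X0 : 0 < X := le_lt_trans B0 lt.
have big : 7%:R * V * c < (m - V) * X.
  by rewrite [ltRHS]mulrC -ltr_pdivrMr //; apply: le_lt_trans lt; rewrite lerDl.
apply/negP; rewrite -ltNge.
apply: (@le_lt_trans _ _ (V * (X ^+ 3 + 7%:R * c * X ^+ 2))).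
  apply: ler_wpM2l => //.
  have h1 : c ^+ 2 * X <= c * X ^+ 2 by rewrite expr2 -mulrA ler_wpM2l // expr2 ler_wpM2r // ltW.
  have h2 : c ^+ 3 <= c * X ^+ 2 by rewrite exprS ler_wpM2l // lerXn2r // nnegrE ltW.
  have -> : (X + c) ^+ 3 = X ^+ 3 + 3%:R * (c * X ^+ 2) + 3%:R * (c ^+ 2 * X) + c ^+ 3 by ring.
  rewrite -mulrA; lra.
have : 7%:R * V * c * X ^+ 2 < (m - V) * X * X ^+ 2 by rewrite ltr_pM2r // exprn_gt0.
lra.
Qed.

Lemma map_nth_index (T T' : eqType) (x : T') (e : seq T) (t : seq T') :
  uniq e -> size e = size t -> [seq nth x t (index j e) | j <- e] = t.
Proof.
move=> ue sz; case: e ue sz => [|j0 e] ue sz; first by case: t sz.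
apply: (@eq_from_nth _ x) => [|i]; first by rewrite size_map.
by rewrite size_map => lt; rewrite (nth_map j0) // index_uniq.
Qed.

Section Volume.
Variables (R : realType) (n : nat) (A : 'M[int]_(3, n)).
Notation L := 'cV[int]_3.
Let AR : 'M[R]_(3, n) := map_mx intr A.
Notation T := (g_sigma_algebraType (R.-ocitv.-measurable)).
Implicit Types (s : {set 'I_n}) (g b : L).
Hypothesis spA : spans_lattice A.
Variables (w : 'I_n -> R) (q : 'cV[R]_3).
Hypothesis cov : forall x, (exists lam : 'cV[R]_n, (forall j, 0 <= lam j 0) /\ x = AR *m lam) ->
        exists2 s, Fan A w s & hopen AR q s x.
Hypothesis gen_q : forall s j, basis AR s -> j \in s -> co AR s q j != 0.
Hypothesis col_le1 : forall s l, Fan A w s -> \sum_j co AR s (col l AR) j <= 1.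
Notation cz := (cz R A).
Notation Hopen := (Hopen A q).

Definition vec3 (x : R * R * R) : 'cV[R]_3 :=
  \col_i (if i == 0 then x.1.1 else if i == 1 then x.1.2 else x.2).

Lemma sum_ord3 (V : nmodType) (F : 'I_3 -> V) : \sum_i F i = F 0 + F 1 + F 2%:R.
Proof.
rewrite !big_ord_recl big_ord0 addr0 addrA.
by congr (_ + F _ + F _); apply: val_inj.
Qed.

Lemma vec3_inj x y : vec3 x = vec3 y -> x = y.
Proof.
move=> /colP h; have := h 0; have := h 1; have := h 2%:R; rewrite !mxE /=.
by case: x y {h} => [[? ?] ?] [[? ?] ?] /= -> -> ->.
Qed.

Lemma DeltaP x : DeltaA3 A x <->
  exists lam : 'cV[R]_n, [/\ forall j, 0 <= lam j 0, \sum_j lam j 0 <= 1 & vec3 x = AR *m lam].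
Proof.
split=> [[lam [l0 [l1 ->]]]|[lam [l0 l1 E]]].
  exists (\col_j lam j); split=> [j||]; first by rewrite mxE.
    by under eq_bigr do rewrite mxE.
  apply/colP; apply: ord3_ind; rewrite !mxE /=; apply: eq_bigr => j _; rewrite !mxE; exact: mulrC.
exists (fun j => lam j 0); split=> //; split=> //; apply: vec3_inj; rewrite E.
apply/colP; apply: ord3_ind; rewrite !mxE /=; apply: eq_bigr => j _; rewrite !mxE; exact: mulrC.
Qed.

(** The bound on the coordinate sums of the columns passes to all combinations with sum at most 1,
    so the simplices spanned by 0 and the cells cover the polytope. Measurability follows from this
    finite union. *)
Lemma Delta_fan x : DeltaA3 A x <-> exists s, [/\ Fan A w s, forall j, 0 <= co AR s (vec3 x) j &
   \sum_j co AR s (vec3 x) j <= 1].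
Proof.
split=> [/DeltaP[lam [l0 l1 E]]|[s [fs h0 h1]]]; last first.
  apply/DeltaP; exists (\col_j co AR s (vec3 x) j); split=> [j||]; first by rewrite mxE.
    by under eq_bigr do rewrite mxE.
  rewrite [LHS](co_expand _ (Fan_basis fs)) mulmx_sum_col.
  by apply: eq_bigr => j _; rewrite mxE.
have [s fs hs] : exists2 s, Fan A w s & hopen AR q s (vec3 x) by apply: cov; exists lam.
exists s; split=> //.
  by move=> j; have /forallP := hopen_incone (Fan_basis fs) hs; apply.
have -> : \sum_j co AR s (vec3 x) j = \sum_l lam l 0 * \sum_j co AR s (col l AR) j.
  rewrite E mulmx_sum_col; under eq_bigr do rewrite co_sum.
  rewrite exchange_big /=; apply: eq_bigr => l _; rewrite mulr_sumr.
  by apply: eq_bigr => j _; rewrite coZ.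
apply: le_trans l1; apply: ler_sum => l _.
by apply: ler_piMr => //; apply: col_le1.
Qed.

Lemma co_vec3 s x j : co AR s (vec3 x) j =
  coordmx AR s j 0 * x.1.1 + coordmx AR s j 1 * x.1.2 + coordmx AR s j 2%:R * x.2.
Proof. by rewrite /co mxE sum_ord3 !mxE. Qed.

Lemma measurable_Delta : measurable (@DeltaA3 R n A : set (T * T * T)).
Proof.
have -> : (@DeltaA3 R n A : set (T * T * T)) = \big[setU/set0]_(s : {set 'I_n} | Fan A w s)
   (\big[setI/setT]_j [set x | 0 <= co AR s (vec3 x) j] `&`
     [set x | \sum_j co AR s (vec3 x) j <= 1])%classic.
  apply/seteqP; split=> x.
    move=> /Delta_fan[s [fs h0 h1]]; rewrite (bigD1 s) //=; left; split=> //.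
    by rewrite -bigcap_seq => j _ /=.
  rewrite big_mkcond -bigcup_seq => -[s _]; case: ifP => // fs [h0 h1].
  apply/Delta_fan; exists s; split=> // j; move: h0; rewrite -bigcap_seq => /(_ j).
  by apply; rewrite /= mem_index_enum.
apply: bigsetU_measurable => s fs; apply: measurableI.
  apply: bigsetI_measurable => j _.
  have := measurable_halfspace (- coordmx AR s j 0) (- coordmx AR s j 1) (- coordmx AR s j 2%:R) 0.
  congr measurable; apply/seteqP; split=> x /=; rewrite co_vec3; lra.
have := measurable_halfspace (\sum_j coordmx AR s j 0) (\sum_j coordmx AR s j 1) (\sum_j coordmx AR s j 2%:R) 1.
have E x : \sum_j co AR s (vec3 x) j = (\sum_j coordmx AR s j 0) * x.1.1 +
    (\sum_j coordmx AR s j 1) * x.1.2 + (\sum_j coordmx AR s j 2%:R) * x.2.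
  by under eq_bigr do rewrite co_vec3; rewrite !big_split /= -!mulr_suml.
by congr measurable; apply/seteqP; split=> x /=; rewrite E.
Qed.

Lemma Delta_fin : leb3 R (@DeltaA3 R n A) \is a fin_num.
Proof.
apply: (@leb3_fin R _ (\sum_i \sum_j `|AR i j|)).
- by apply: sumr_ge0 => i _; apply: sumr_ge0.
- exact: measurable_Delta.
move=> x /DeltaP[lam [l0 l1 E]].
have H i : `|vec3 x i 0| <= \sum_i \sum_j `|AR i j|.
  rewrite E mxE [leRHS](bigD1 i) //= ler_wpDr //; first by apply: sumr_ge0 => k _; apply: sumr_ge0.
  apply: le_trans (ler_norm_sum _ _ _) _; apply: ler_sum => j _.
  rewrite normrM ler_piMr // ger0_norm //; apply: le_trans l1.
  by rewrite (bigD1 j) //= lerDl sumr_ge0.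
by have := H 0; have := H 1; have := H 2%:R; rewrite !mxE /=; split.
Qed.

(* [b + v + [0,1]^3] lies in a bounded dilate of [Delta] for a suitable [v], since the
   columns generate the lattice *)
Lemma unit_cube_absorbed : exists (M : R) (mu : 'I_3 -> 'I_n -> R), 0 <= M /\
  forall y : 'I_3 -> R, (forall i, 0 <= y i < 1) ->
    (forall j, `|\sum_i y i * mu i j| <= M) /\
    (forall i, \sum_j (\sum_k y k * mu k j) * AR i j = y i).
Proof.
have [lam lamE] := choice (fun k : 'I_3 => spA (fun i => (i == k)%:R)).
exists (\sum_k \sum_j `|(lam k j)%:~R|), (fun k j => (lam k j)%:~R); split.
  by apply: sumr_ge0 => k _; apply: sumr_ge0.
move=> y yP; split=> [j|i].
  apply: le_trans (ler_norm_sum _ _ _) _; apply: ler_sum => k _.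
  have /andP[y0 /ltW y1] := yP k.
  rewrite normrM (ger0_norm y0) (le_trans (ler_piMl _ y1)) // (bigD1 j) //= lerDl.
  exact: sumr_ge0.
under eq_bigr do rewrite mulr_suml.
rewrite exchange_big /= (bigD1 i) //= [X in _ + X]big1 ?addr0 => [|k ki].
  rewrite -[RHS]mulr1; under eq_bigr do rewrite -mulrA.
  rewrite -mulr_sumr; congr (_ * _).
  have := congr1 (fun z : int => z%:~R : R) (lamE i i); rewrite eqxx rmorph_sum => E.
  by apply: etrans _ (esym E); apply: eq_bigr => j _; rewrite mxE rmorphM.
under eq_bigr do rewrite -mulrA.
rewrite -mulr_sumr; apply/eqP; rewrite mulf_eq0; apply/orP; right; apply/eqP.
have := congr1 (fun z : int => z%:~R : R) (lamE k i); rewrite eq_sym (negPf ki) rmorph_sum => E.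
by apply: etrans _ (esym E); apply: eq_bigr => j _; rewrite mxE rmorphM.
Qed.

Definition tv s (t : seq nat) j : nat := nth 0%N t (index j (enum s)).
Definition sh s g j : bool := (cz s g j == 0) && (co AR s q j < 0).
(* The points of the half-open cone of [s]: [sh] moves the representative [g] off the
   excluded facets, and [t] lists multiplicities along [enum s]. *)
Definition cell_pt s g t : L := g + \sum_(j in s) col j A *+ (sh s g j + tv s t j).

Lemma cz_cell_pt s g t j : basis AR s -> j \in s ->
  cz s (cell_pt s g t) j = cz s g j + (sh s g j)%:R + (tv s t j)%:R.
Proof.
move=> bs js; rewrite czD cz_sum (bigD1 j) //= czMn cz_col // eqxx big1 ?addr0.
  by rewrite natrD addrA.
by move=> k /andP[ks kj]; rewrite czMn cz_col // eq_sym (negPf kj) mul0rn.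
Qed.

Lemma cell_pt_hopen s g t : Fan A w s -> g \in boxseq R A s -> Hopen s (cell_pt s g t).
Proof.
move=> fs; have bs := Fan_basis fs; rewrite mem_boxseq // => /forallP gb.
apply/forallP => j; apply/implyP => js; rewrite -/(cz s (cell_pt s g t) j) cz_cell_pt // /sh.
have := gb j; rewrite js /= => /andP[g0 _].
move: g0; rewrite le_eqVlt => /orP[/eqP E|g0].
  have := gen_q bs js; rewrite -E eqxx add0r /= neq_lt => /orP[q0|q0].
    by rewrite q0 ltr_pwDl.
  rewrite q0 (lt_gtF q0) add0r andbT.
  by case: (tv s t j) => [|m]; rewrite ?eqxx ?orbT // ltr0n.
by rewrite gt_eqF //= addr0 ltr_pwDl.
Qed.

Lemma sum_tv s (t : seq nat) : basis AR s -> size t = 3 -> (\sum_(j in s) tv s t j = \sum_(i <- t) i)%N.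
Proof.
move=> bs t3; have E : [seq tv s t j | j <- enum s] = t.
  by apply: map_nth_index; rewrite ?enum_uniq // -cardE (card_basis bs).
by rewrite -{2}E big_map big_enum.
Qed.

Lemma cell_pt_sum s g t : Fan A w s -> g \in boxseq R A s -> size t = 3 ->
  \sum_j cz s (cell_pt s g t) j <= (3 + \sum_(i <- t) i)%:R.
Proof.
move=> fs; have bs := Fan_basis fs; rewrite mem_boxseq // => /forallP gb t3.
rewrite -(sum_tv bs t3) natrD natr_sum (bigID (mem s)) /= [X in _ + X]big1 ?addr0; last first.
  by move=> j js; rewrite czE co_notin.
rewrite (eq_bigr _ (fun j js => cz_cell_pt g t bs js)) big_split /= lerD2r.
have -> : 3 = \sum_(j in s) (1 : R) by rewrite sumr_const (card_basis bs).
apply: ler_sum => j js; have := gb j; rewrite js /sh /= => /andP[g0 /ltW g1].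
by have [->|_] := eqVneq (cz s g j) 0; [rewrite add0r; case: (_ < _)|rewrite addr0].
Qed.

Lemma cell_pt_inj s s' g g' t t' : Fan A w s -> Fan A w s' ->
  g \in boxseq R A s -> g' \in boxseq R A s' -> size t = 3 -> size t' = 3 ->
  cell_pt s g t = cell_pt s' g' t' -> [/\ s = s', g = g' & t = t'].
Proof.
move=> fs fs' gb gb' t3 t3' E.
have ss' : s = s'.
  by apply: (hopen_uniq fs fs' (cell_pt_hopen t fs gb)); rewrite E; apply: cell_pt_hopen.
move: fs' gb' E; rewrite -{s'}ss' => _ gb' E; have bs := Fan_basis fs.
have cg g1 t1 : cong R A s (cell_pt s g1 t1) g1.
  move=> j js; exists (sh s g1 j + tv s t1 j)%:Z.
  by rewrite cz_cell_pt // -pmulrn natrD; ring.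
have gg' : g = g'.
  rewrite !mem_boxseq // in gb gb'; apply: (inbox_cong bs gb gb').
  by apply: cong_trans (cong_sym (cg g t)) _; rewrite E.
split=> //; rewrite -{gb' g'}gg' in E.
have Et : [seq tv s t j | j <- enum s] = t.
  by apply: map_nth_index; rewrite ?enum_uniq // -cardE (card_basis bs).
have Et' : [seq tv s t' j | j <- enum s] = t'.
  by apply: map_nth_index; rewrite ?enum_uniq // -cardE (card_basis bs).
rewrite -Et -Et'; apply/eq_in_map => j; rewrite mem_enum => js.
have := congr1 (fun b => cz s b j) E; rewrite /= !cz_cell_pt // => /addrI/eqP.
by rewrite eqr_nat => /eqP.
Qed.

Definition tseqs K : seq (seq nat) :=
  [seq map val (tval t) | t <- enum [set t : 3.-tuple 'I_K.+1 | (\sum_(i <- t) i <= K)%N]].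

Lemma tseqsP K t : t \in tseqs K -> size t = 3 /\ (\sum_(i <- t) i <= K)%N.
Proof.
move=> /mapP[u]; rewrite mem_enum inE => le ->.
by rewrite size_map size_tuple big_map.
Qed.

Definition lattice_pts K : seq L :=
  [seq cell_pt x.1 x.2 t | x <- [seq (s, g) | s <- enum (Fan A w), g <- boxseq R A s], t <- tseqs K].

Lemma lattice_ptsP K b : b \in lattice_pts K -> exists s,
  [/\ Fan A w s, Hopen s b & \sum_j cz s b j <= (3 + K)%:R].
Proof.
move=> /allpairsP[[x t] /= [/allpairsPdep[s [g [+ gb ->]]] /tseqsP[t3 tK] ->]] /=.
rewrite mem_enum => fs; exists s; split=> //; first exact: cell_pt_hopen.
by apply: le_trans (cell_pt_sum fs gb t3) _; rewrite ler_nat leq_add2l.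
Qed.

Lemma lattice_pts_uniq K : uniq (lattice_pts K).
Proof.
apply: allpairs_uniq.
- apply: allpairs_uniq_dep; first exact: enum_uniq.
    by move=> s; rewrite mem_enum => fs; apply: boxseq_uniq; apply: Fan_basis fs.
  by move=> [s g] [s' g'] _ _ /= [-> ->].
- rewrite map_inj_in_uniq ?enum_uniq // => t t' _ _ /inj_map E.
  by apply/val_inj/E/val_inj.
move=> [[s g] t] [[s' g'] t'] /allpairsP[[x1 t1] /= [/allpairsPdep[s1 [g1 [h1 gb ->]]] /tseqsP[h2 _] [-> -> ->]]].
move=> /allpairsP[[x2 t2] /= [/allpairsPdep[s2 [g2 [h1' gb' ->]]] /tseqsP[h2' _] [-> -> ->]]] /= E.
rewrite !mem_enum in h1 h1'.
by have [-> -> ->] := cell_pt_inj h1 h1' gb gb' h2 h2' E.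
Qed.

Lemma size_lattice_pts K :
  size (lattice_pts K) = ((\sum_(s | Fan A w s) size (boxseq R A s)) * 'C(3 + K, 3))%N.
Proof.
rewrite size_allpairs size_allpairs_dep sumnE big_map big_enum; congr (_ * _)%N.
by rewrite size_map -cardE card_partial_ord_partitions.
Qed.

(** The [m * 'C(3 + K, 3)] points of [lattice_pts K] carry disjoint cubes inside a dilate of the
    polytope by K + O(1). Comparing cubic growth in K leaves [m / 6] against the Euclidean
    volume. *)
Lemma volume_ge : (\sum_(s | Fan A w s) size (boxseq R A s))%:R <= vol3 R A.
Proof.
set m := (\sum_(s | _) _)%N.
have [M [mu [M0 muP]]] := unit_cube_absorbed.
(* The coordinates of a lattice point sum to at most K + 3. The shift by M on every column, which
   keeps them nonnegative, and the unit cube add at most [n * M] each, so that [K.+1 + c] is the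
   total. *)
pose c : R := 2%:R + 2%:R * n%:R * M.
have c0 : 0 <= c by rewrite addr_ge0 // !mulr_ge0.
have vE : (vol3 R A / 6%:R)%:E = leb3 R (@DeltaA3 R n A).
  by rewrite /vol3 mulrC mulKf ?pnatr_eq0 // fineK //; exact: Delta_fin.
have v0 : 0 <= vol3 R A by rewrite mulr_ge0 // fine_ge0 // measure_ge0.
apply: (cubic_growth v0 c0) => K.
pose N : R := K.+1%:R + c; have N0 : 0 < N by rewrite ltr_pwDl.
have := @leb3_packing R (@DeltaA3 R n A) (lattice_pts K) (fun i => \sum_j M * AR i j) N N0
  (lattice_pts_uniq K) measurable_Delta.
rewrite size_lattice_pts -/m -vE lee_fin => H.
have {}H : (m * 'C(3 + K, 3))%:R / N ^+ 3 <= vol3 R A / 6%:R.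
  apply: H => b y /lattice_ptsP[s [fs hb sb]] yP; have [mub mue] := muP y yP.
  have bs := Fan_basis fs.
  have cb j : 0 <= cz s b j by have /forallP := hopen_incone bs hb; apply.
  apply/DeltaP; exists (\col_j ((cz s b j + M + \sum_k y k * mu k j) / N)); split.
  - move=> j; rewrite mxE divr_ge0 ?(ltW N0) // -addrA addr_ge0 //.
    by have := mub j; rewrite ler_norml => /andP[h _]; rewrite addrC -lerBlDr sub0r.
  - under eq_bigr do rewrite mxE; rewrite -mulr_suml ler_pdivrMr // mul1r.
    rewrite 2!big_split /= sumr_const card_ord.
    have h : \sum_j \sum_k y k * mu k j <= n%:R * M.
      rewrite mulr_natl -[n in leRHS]card_ord -sumr_const; apply: ler_sum => j _.
      exact: le_trans (ler_norm _) (mub j).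
    have nn : (3 + K)%:R = 2%:R + K.+1%:R :> R by rewrite -natrD add2n.
    move: sb h; rewrite /N /c nn -[M *+ n]mulr_natl; lra.
  have e i : \sum_j cz s b j * AR i j = (b i 0)%:~R.
    have /colP/(_ i) := co_expand (toR R b) bs; rewrite summxE !mxE => ->.
    by apply: eq_bigr => j _; rewrite !mxE.
  have E i : ((b i 0)%:~R + \sum_j M * AR i j + y i) / N =
      \sum_j AR i j * ((cz s b j + M + \sum_k y k * mu k j) / N).
    rewrite -(e i) -(mue i) -!big_split /= mulr_suml; apply: eq_bigr => j _.
    by rewrite -!mulrDl mulrA [AR i j * _]mulrC.
  apply/colP; apply: ord3_ind; rewrite [LHS]mxE /= E [RHS]mxE;
    by apply: eq_bigr => j _; congr (_ * _); rewrite mxE.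
rewrite -/N; move: H; rewrite ler_pdivrMr ?exprn_gt0 // mulrAC ler_pdivlMr ?ltr0n //.
apply: le_trans; rewrite natrM -mulrA ler_wpM2l // -natrM -natrX ler_nat.
have -> : ('C(3 + K, 3) * 6 = (3 + K) * (2 + K) * (1 + K))%N.
  by have := bin_ffact (3 + K) 3; rewrite !ffactnS ffactn0 muln1 mulnA.
rewrite !expnS expn0 muln1 mulnA.
by apply: leq_mul; [apply: leq_mul|]; rewrite -[K.+1]add1n leq_add2r.
Qed.

End Volume.

(** * Sharpness *)

(** Stage [Z l] is correct below [l + K], and z reads each value at the first stage where it is
    final. *)
Lemma course_of_values (T : Type) (K : nat) (init : nat -> T) (F : nat -> (nat -> T) -> T) :
  (forall l z z', (forall j, (j < l + K)%N -> z j = z' j) -> F l z = F l z') ->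
  exists z, (forall j, (j < K)%N -> z j = init j) /\ forall l, z (l + K)%N = F l z.
Proof.
move=> FE.
pose next (z : nat -> T) l := fun j => if j == (l + K)%N then F l z else z j.
pose Z := fix Z l := if l is l'.+1 then next (Z l') l' else init.
pose z j := Z (j.+1 - K)%N j.
have stable l m j : (j < l + K)%N -> Z (l + m)%N j = Z l j.
  move=> jl; elim: m => [|m IH]; first by rewrite addn0.
  rewrite addnS /= /next; case: eqP => // E.
  by move: jl; rewrite E ltn_add2r ltnNge leq_addr.
have zE l j : (j < l + K)%N -> z j = Z l j.
  move=> jl; rewrite /z; have le : (j.+1 - K <= l)%N by rewrite leq_subLR addnC.
  by rewrite -(subnKC le) stable // addnC -leq_subLR.
exists z; split=> [j jK|l].
  by rewrite (zE 0%N).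
rewrite (zE l.+1) ?addSn // /= /next eqxx; apply: FE => j jl.
by rewrite (zE l).
Qed.

(** * Series supported on one facet *)

Section Facet.
Variables (C : fieldType) (k : nat) (p0 pe pg : C).
Hypothesis k0 : (k%:R : C) != 0.
Hypothesis p00 : p0 != 0.
Hypothesis pe0 : pe != 0.
Hypothesis pg0 : pg != 0.

Section Values.
Variable z : nat -> C.

(* [U i m l] is the value of u at i c0 + m e + l g, where c0 = (0,0,k), e is a unit vector and
   g = e + (0,0,1); the two Euler equations of the facet are solved from the values
   z l = u(l g). *)
Fixpoint U0 m l : C :=
  if m is m'.+1 then (- (m' + l)%:R * U0 m' l - pg * U0 m' l.+1) / pe else z l.

Fixpoint U i m l : C :=
  if i is i'.+1 then (- (k * i' + l)%:R * U i' m l - pg * U i' m l.+1) / (k%:R * p0)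
  else U0 m l.

Lemma U_row2 i m l :
  k%:R * p0 * U i.+1 m l + pg * U i m l.+1 = - (k * i + l)%:R * U i m l.
Proof. by rewrite /= mulrC divfK ?mulf_neq0 // subrK. Qed.

Lemma U_row1 i m l : pe * U i m.+1 l + pg * U i m l.+1 = - (m + l)%:R * U i m l.
Proof.
elim: i m l => [|i IH] m l; first by rewrite /= mulrC divfK // subrK.
have kp : k%:R * p0 != 0 by rewrite mulf_neq0.
apply: (mulfI kp).
have e1 := U_row2 i m.+1 l; have e2 := U_row2 i m l.+1; have e3 := U_row2 i m l.
have i1 := IH m l; have i2 := IH m l.+1.
have {}e1 : k%:R * p0 * U i.+1 m.+1 l = - (k * i + l)%:R * U i m.+1 l - pg * U i m.+1 l.+1.
  by rewrite -e1 addrK.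
have {}e2 : k%:R * p0 * U i.+1 m l.+1 = - (k * i + l.+1)%:R * U i m l.+1 - pg * U i m l.+2.
  by rewrite -e2 addrK.
have {}e3 : k%:R * p0 * U i.+1 m l = - (k * i + l)%:R * U i m l - pg * U i m l.+1.
  by rewrite -e3 addrK.
rewrite mulrDr [_ * (pe * _)]mulrCA [_ * (pg * _)]mulrCA e1 e2 mulrCA e3.
have {}i1 : pe * U i m.+1 l = - (m + l)%:R * U i m l - pg * U i m l.+1 by rewrite -i1 addrK.
have {}i2 : pe * U i m.+1 l.+1 = - (m + l.+1)%:R * U i m l.+1 - pg * U i m l.+2 by rewrite -i2 addrK.
rewrite mulrDr mulrCA i1 mulrN [pe * (pg * _)]mulrCA i2 !natrD -!natr1.
ring.
Qed.

(* The relation k g = k e + c0 among the columns makes (i + 1, m + k, l) and (i, m, l + k)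
   exponents of the same lattice point. *)
Definition defect i m l := U i.+1 (m + k) l - U i m (l + k).

Lemma defect_row1 i m l :
  pe * defect i m.+1 l + pg * defect i m l.+1 = - (m + l + k)%:R * defect i m l.
Proof.
have e1 := U_row1 i.+1 (m + k) l; have e2 := U_row1 i m (l + k).
rewrite /defect addSn addSn !mulrBr addrACA -opprD e1 e2.
by rewrite !natrD; ring.
Qed.

Lemma defect_row2 i m l :
  k%:R * p0 * defect i.+1 m l + pg * defect i m l.+1 = - (k * i.+1 + l)%:R * defect i m l.
Proof.
have e1 := U_row2 i.+1 (m + k) l; have e2 := U_row2 i m (l + k).
rewrite /defect addSn !mulrBr addrACA -opprD e1 e2.
by rewrite mulnS !natrD; ring.
Qed.

(** The defect satisfies the recurrences of [U] with shifted constants, so it vanishes once it does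
    on the line i = m = 0. *)
Lemma defect_eq0 : (forall l, defect 0 0 l = 0) -> forall i m l, defect i m l = 0.
Proof.
move=> h; have h0 m l : defect 0 m l = 0.
  elim: m l => [|m IH] l //; have := defect_row1 0 m l; rewrite !IH !mulr0 addr0.
  by move/eqP; rewrite mulf_eq0 (negPf pe0) => /eqP.
elim=> [|i IH] m l //; have := defect_row2 i m l; rewrite !IH !mulr0 addr0.
by move/eqP; rewrite !mulf_eq0 (negPf p00) (negPf k0) => /eqP.
Qed.

Lemma U_fibre : (forall l, defect 0 0 l = 0) -> forall i m l i' m' l',
  (m + l = m' + l')%N -> (k * i + l = k * i' + l')%N -> U i m l = U i' m' l'.
Proof.
move=> /defect_eq0 h.
have shift t i m l : U (i + t) (m + k * t) l = U i m (l + k * t).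
  elim: t i m l => [|t IH] i m l; first by rewrite muln0 !addn0.
  have := h (i + t)%N (m + k * t)%N l; move/eqP; rewrite subr_eq0 => /eqP.
  rewrite addnS mulnS [(k + _)%N]addnC !addnA => ->.
  by rewrite IH addnAC.
have k1 : (0 < k)%N by move: k0; case: (k) => //; rewrite eqxx.
suff H i m l i' m' l' : (i <= i')%N -> (m + l = m' + l')%N -> (k * i + l = k * i' + l')%N -> U i m l = U i' m' l'.
  move=> i m l i' m' l' e1 e2; case: (leqP i i') => [|/ltnW] le; first exact: H.
  exact/esym/H.
move=> le e1 e2; rewrite -(subnKC le) in e2 *.
move: (i' - i)%N e2 => t; rewrite mulnDr -addnA => /addnI lE.
rewrite lE in e1 *.
have -> : m' = (m + k * t)%N by apply/eqP; rewrite -(eqn_add2r l') -e1 -addnA.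
by rewrite shift addnC.
Qed.

End Values.

Lemma U0_last z z' m l : (forall j, (l <= j < l + m)%N -> z j = z' j) ->
  U0 z m l - U0 z' m l = (- pg / pe) ^+ m * (z (l + m)%N - z' (l + m)%N).
Proof.
elim: m l => [|m IH] l h; first by rewrite expr0 mul1r addn0.
have e1 : U0 z m l - U0 z' m l = 0.
  rewrite IH => [|j /andP[h1 h2]]; last by rewrite h // h1 addnS ltnW.
  by rewrite h ?leq_addr ?addnS //= subrr mulr0.
have e2 := IH l.+1; rewrite addSnnS in e2.
have {}e2 : U0 z m l.+1 - U0 z' m l.+1 = (- pg / pe) ^+ m * (z (l + m.+1)%N - z' (l + m.+1)%N).
  by apply: e2 => j /andP[h1 h2]; rewrite h // ltnW.
rewrite /= -mulrBl exprS -mulrA -e2.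
have -> : U0 z m l = U0 z' m l by apply/eqP; rewrite -subr_eq0 e1.
by field.
Qed.

(** The condition [defect 0 0 l = 0] with denominators cleared. It links z l up to z (l + k + 1),
    and its top coefficient [pg * (- pg / pe) ^+ k] is nonzero: a recurrence of order k + 1, whence
    the k + 1 solutions of a facet. *)
Definition recur z l := pg * U0 z k l.+1 + l%:R * U0 z k l + k%:R * p0 * z (l + k)%N.

Lemma defectE z l : recur z l = 0 -> defect z 0 0 l = 0.
Proof.
move=> r0; rewrite /defect add0n /= muln0 add0n.
apply/eqP; rewrite subr_eq0; apply/eqP; apply: (mulIf (mulf_neq0 k0 p00)).
rewrite divfK ?mulf_neq0 //; apply/eqP; rewrite -subr_eq0 -oppr_eq0; apply/eqP.
by rewrite -r0 /recur; ring.
Qed.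

Lemma facet_sequence (init : nat -> C) : exists z,
  (forall j, (j <= k)%N -> z j = init j) /\ forall l, defect z 0 0 l = 0.
Proof.
(* Entries from [l + k.+1] on are set to 0, so that the top term of the recurrence at l is expressed
   by earlier values only. *)
pose cut l (z : nat -> C) j := if (j < l + k.+1)%N then z j else 0.
pose cf := pg * (- pg / pe) ^+ k.
have cf0 : cf != 0 by rewrite mulf_neq0 // expf_neq0 // mulf_neq0 ?oppr_eq0 ?invr_eq0.
have [l z z' h|z [zi zr]] := @course_of_values C k.+1 init (fun l z => - recur (cut l z) l / cf).
  by congr (- recur _ _ / _); apply: funext => j; rewrite /cut; case: ifP => // /h.
exists z; split=> [j jk|l]; first exact: zi.
apply: defectE.
have E j : (j < l + k.+1)%N -> cut l z j = z j by rewrite /cut => ->.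
have d1 : U0 z k l.+1 - U0 (cut l z) k l.+1 = (- pg / pe) ^+ k * z (l + k.+1)%N.
  rewrite U0_last => [|j /andP[_ h]]; last by rewrite E // -addSnnS.
  by rewrite addSnnS [cut _ _ _]/cut ltnn subr0.
have d2 : U0 z k l - U0 (cut l z) k l = 0.
  rewrite U0_last => [|j /andP[_ h]]; last by rewrite E // addnS ltnW.
  by rewrite E ?addnS // subrr mulr0.
have : recur z l - recur (cut l z) l = cf * z (l + k.+1)%N.
  transitivity (pg * (U0 z k l.+1 - U0 (cut l z) k l.+1)); last by rewrite d1 mulrA.
  rewrite /recur E ?addnS //.
  have -> : U0 z k l = U0 (cut l z) k l by apply/eqP; rewrite -subr_eq0 d2.
  by ring.
by rewrite zr mulrC divfK // => /eqP; rewrite subr_eq addNr => /eqP.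
Qed.

End Facet.

Definition wedge (k : nat) : 'M[int]_(3, 5) := \matrix_(i, j)
  nth 0 (nth [::] [:: [:: 0; 1; 0; 1; 0]; [:: 0; 0; 1; 0; 1]; [:: k%:Z; 0; 0; 1; 1]] i) j.

Lemma sum_ord5 (V : nmodType) (F : 'I_5 -> V) :
  \sum_j F j = F 0 + F 1 + F 2%:R + F 3%:R + F 4%:R.
Proof.
rewrite !big_ord_recl big_ord0 addr0 !addrA.
by congr (_ + F _ + F _ + F _ + F _); apply: val_inj.
Qed.

Section Wedge.
Variables (R : realType) (k : nat) (p : 'I_5 -> R[i]).
Notation C := R[i].
Notation A := (wedge k).
Hypothesis k0 : (0 < k)%N.
Hypothesis pn0 : forall j, p j != 0.

Let kC : (k%:R : C) != 0. Proof. by rewrite pnatr_eq0 -lt0n. Qed.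

Definition ei (f : bool) : 'I_5 := if f then 1 else 2%:R.
Definition gi (f : bool) : 'I_5 := if f then 3%:R else 4%:R.
Notation Uf f z := (U k (p 0) (p (ei f)) (p (gi f)) z).
Definition onfacet f (a : mi 5) : bool := (a (ei (~~ f)) == 0%N) && (a (gi (~~ f)) == 0%N).
Definition fcoef f z (a : mi 5) : C := if onfacet f a then Uf f z (a 0) (a (ei f)) (a (gi f)) else 0.
Definition fser f z : series R 5 := fun a => fcoef f z a / (mi_fact a)%:R.

Lemma norm_coef_fser f z a : norm_coef (fser f z) a = fcoef f z a.
Proof. by rewrite /norm_coef /fser mulrC divfK // mi_fact_neq0. Qed.

Lemma wedge_lcomb (a : mi 5) : [/\ lcomb A a 0 0 = addn (a 1) (a 3%:R),
  lcomb A a 1 0 = addn (a 2%:R) (a 4%:R) &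
  lcomb A a 2%:R 0 = addn (addn (muln k (a 0)) (a 3%:R)) (a 4%:R)].
Proof.
by split; rewrite -AmulE /Amul sum_ord5 !mxE /= ?mul0r ?mul1r ?add0r ?addr0 ?PoszD ?PoszM.
Qed.

Lemma fcoef_fibre f z a a' : (forall l, defect k (p 0) (p (ei f)) (p (gi f)) z 0 0 l = 0) ->
  lcomb A a = lcomb A a' -> fcoef f z a = fcoef f z a'.
Proof.
move=> d0 E; have [h0 h1 h2] := wedge_lcomb a; have [h0' h1' h2'] := wedge_lcomb a'.
rewrite E in h0 h1 h2; rewrite h0 in h0'; rewrite h1 in h1'; rewrite h2 in h2'.
case: h0' => e0; case: h1' => e1; case: h2' => e2.
have on : onfacet f a = onfacet f a'.
  by rewrite /onfacet -!addn_eq0; case: f {d0}; rewrite /= ?e0 ?e1.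
rewrite /fcoef on; case: ifP => // fa'; have fa : onfacet f a by rewrite on.
move/andP: fa => [/eqP x1 /eqP x2]; move/andP: fa' => [/eqP y1 /eqP y2].
case: f d0 x1 x2 y1 y2 {on} => /= d0 x1 x2 y1 y2;
  rewrite x1 x2 y1 y2 ?addn0 in e0 e1 e2; exact: U_fibre.
Qed.

Lemma fcoef_out f z a j : onfacet f a = false -> fcoef f z (mi_inc a j) = 0.
Proof.
move=> oa; rewrite /fcoef /onfacet !ffunE !addn_eq0.
by move/negbT: oa; rewrite /onfacet negb_and => /orP[/negPf->|/negPf->] //=; rewrite andbF.
Qed.

(** Extension by zero is consistent because adding columns never leads back to a facet once it is
    left, and because beta = 0: on the facet the Euler equation of the transversal coordinate reads
    0 = 0. *)
Lemma fser_formal f z : (forall l, defect k (p 0) (p (ei f)) (p (gi f)) z 0 0 l = 0) ->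
  formal A (fun=> 0) p (fser f z).
Proof.
move=> d0; split=> [u v E a|i a].
  apply: (@norm_coef_inj R 5 (pdpow u (fser f z)) (pdpow v (fser f z))).
  rewrite !norm_coef_pdpow !norm_coef_fser; apply: fcoef_fibre => //.
  rewrite !lcombD; congr (_ + _); apply/colP => i.
  by rewrite -!AmulE.
apply: (mulfI (mi_fact_neq0 R a)); rewrite norm_coef_euler norm_coef_fser mul0r mulr0.
under eq_bigr do rewrite norm_coef_fser.
have [oa|oa] := boolP (onfacet f a); last first.
  rewrite /fcoef (negPf oa) mulr0 addr0 big1 // => j _.
  by rewrite -/(fcoef f z _) fcoef_out ?mulr0 //; apply/negbTE.
have [h0 h1 h2] := wedge_lcomb a.
have r1 := U_row1 (p (gi f)) kC (pn0 0) (pn0 (ei f)) z (a 0) (a (ei f)) (a (gi f)).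
have r2 := U_row2 (p (ei f)) (p (gi f)) kC (pn0 0) z (a 0) (a (ei f)) (a (gi f)).
rewrite sum_ord5 /fcoef oa; move: (Uf f z) r1 r2 => V; move/andP: oa => [/eqP x1 /eqP x2].
rewrite /onfacet !ffunE.
move: i; apply: ord3_ind; rewrite ?h0 ?h1 ?h2 !mxE; case: f {d0} x1 x2 => /= -> ->; rewrite /= => r1 r2.
all: rewrite ?addn0 ?add0n ?addn1 -?pmulrn ?mulr0z ?mulr1z ?mulr0 ?mul0r ?mul1r ?addr0 ?add0r ?mulrA //.
all: by rewrite ?r1 ?r2 mulNr addNr.
Qed.

Definition gpoint f t : mi 5 := [ffun j => if j == gi f then t else 0%N].

Lemma fser_eval f z f' t : norm_coef (fser f z) (gpoint f' t) =
  if (f == f') || (t == 0%N) then z t else 0.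
Proof.
rewrite norm_coef_fser /fcoef /onfacet !ffunE.
by case: f f' => [] [] /=; rewrite ?eqxx //=; case: t.
Qed.

Lemma wedge_formal : exists F : 'I_(k.+1 + k) -> series R 5,
  (forall l, formal A (fun=> 0) p (F l)) /\ lin_indep F.
Proof.
have ex f init := @facet_sequence C k (p 0) (p (ei f)) (p (gi f)) kC (pn0 _) (pn0 _) (pn0 _) init.
have [z1 z1P] := choice (fun m : 'I_k.+1 => ex true (fun t => (t == m)%:R)).
(* On the second facet the initial value at 0 is left out: these solutions vanish at the origin, the
   only test point common to both facets. *)
have [z2 z2P] := choice (fun m : 'I_k => ex false (fun t => (t == m.+1)%:R)).
pose F l := match fintype.split l with inl m => fser true (z1 m) | inr m => fser false (z2 m) end.
have F1 m : F (lshift _ m) = fser true (z1 m) by rewrite /F (fintype.unsplitK (inl m)).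
have F2 m : F (rshift _ m) = fser false (z2 m) by rewrite /F (fintype.unsplitK (inr m)).
exists F; split=> [l|lam lam0].
  by rewrite /F; case: fintype.split => m; apply: fser_formal; [have [_] := z1P m|have [_] := z2P m].
have E a : \sum_(m < k.+1) lam (lshift _ m) * norm_coef (fser true (z1 m)) a +
    \sum_(m < k) lam (rshift _ m) * norm_coef (fser false (z2 m)) a = 0.
  have := congr1 (fun x => (mi_fact a)%:R * x) (lam0 a).
  rewrite mulr0 big_split_ord /= mulrDr !mulr_sumr => E; apply: etrans E.
  by congr (_ + _); apply: eq_bigr => m _; rewrite ?F1 ?F2 mulrCA.
have E1 (t : 'I_k.+1) : lam (lshift _ t) = 0.
  have := E (gpoint true t).
  rewrite [X in _ + X]big1 ?addr0 => [|m _]; last first.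
    rewrite fser_eval /=; case: eqP => [t0|_]; last by rewrite mulr0.
    by have [zE _] := z2P m; rewrite t0 zE // mulr0.
  rewrite (bigD1 t) //= big1 ?addr0 => [|m mt].
    have tk : (t <= k)%N by rewrite -ltnS.
    by rewrite fser_eval eqxx orTb; have [zE _] := z1P t; rewrite (zE _ tk) eqxx mulr1.
  have tk : (t <= k)%N by rewrite -ltnS.
  rewrite fser_eval eqxx orTb; have [zE _] := z1P m; rewrite (zE _ tk).
  by rewrite [_ == _]val_eqE eq_sym (negPf mt) mulr0.
have E2 (t : 'I_k) : lam (rshift _ t) = 0.
  have := E (gpoint false t.+1).
  rewrite [X in X + _]big1 ?add0r => [|m _]; last by rewrite E1 mul0r.
  rewrite (bigD1 t) //= big1 ?addr0 => [|m mt].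
    by rewrite fser_eval eqxx; have [zE _] := z2P t; rewrite orTb (zE _ (ltn_ord t)) eqxx mulr1.
  rewrite fser_eval eqxx orTb; have [zE _] := z2P m; rewrite (zE _ (ltn_ord t)).
  by rewrite eqSS [_ == _]val_eqE eq_sym (negPf mt) mulr0.
by move=> l; rewrite -(fintype.splitK l); case: fintype.split => m /=.
Qed.

End Wedge.

Lemma wedge_pointed (R : realType) k : (0 < k)%N -> pointed R (wedge k).
Proof.
move=> k0; exists (fun=> 1) => j; rewrite !big_ord_recl big_ord0 !mxE !mul1r addr0 /=.
case: j => [[|[|[|[|[|//]]]]] lt] /=; rewrite ?mulr0z ?mulr1z ?add0r ?addr0 ?addr_gt0 //.
by rewrite -pmulrn ltr0n.
Qed.

Lemma wedge_spans k : spans_lattice (wedge k).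
Proof.
move=> z; exists (fun j : 'I_5 => nth 0 [:: 0; z 0 - z 2%:R; z 1; z 2%:R; 0] j).
apply: ord3_ind; rewrite sum_ord5 !mxE /=; lia.
Qed.

(** Truncated subtraction discards the pairs with i + j above N, so the double sum is a tetrahedral
    number. *)
Lemma sum_staircase N :
  ((\sum_(i < N) \sum_(j < N) (N - i - j)) * 6 = N * N.+1 * N.+2)%N.
Proof.
have row M : (M <= N)%N -> ((\sum_(j < N) (M - j)) * 2 = M * M.+1)%N.
  elim: M N => [|M IH] [|N'] //.
  - by rewrite big_ord0.
  - by move=> _; rewrite big1 // => j _; rewrite sub0n.
  rewrite ltnS => le; rewrite big_ord_recl subn0 mulnDl.
  under eq_bigr do rewrite lift0 subSS.
  by rewrite IH //; ring.
have col M : ((\sum_(i < M) (M - i) * (M - i).+1) * 3 = M * M.+1 * M.+2)%N.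
  elim: M => [|M IH]; first by rewrite big_ord0.
  rewrite big_ord_recl subn0 mulnDl.
  under eq_bigr do rewrite lift0 subSS.
  by rewrite IH; ring.
rewrite -[6%N]/(2 * 3)%N mulnA -col; congr (_ * 3)%N.
by rewrite big_distrl /=; apply: eq_bigr => i _; apply: row; apply: leq_subr.
Qed.

(** * Rank against volume, and the volume of the example *)

Section Main.
Variable R : realType.
Notation T := (g_sigma_algebraType (R.-ocitv.-measurable)).

Lemma Delta_measurable n (A : 'M[int]_(3, n)) : pointed R A -> spans_lattice A ->
  measurable (@DeltaA3 R n A : set (T * T * T)).
Proof.
move=> ptA spA; have [wn [q [cov gen_q col_le1 cost_int]]] := triangulation ptA spA.
exact: (measurable_Delta cov col_le1).
Qed.

Lemma rank_lt_volume n (A : 'M[int]_(3, n)) (beta : 'I_3 -> R[i]) :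
  pointed R A -> spans_lattice A -> exists (r : nat) (h : seq (R[i] * mi n)),
  [/\ (exists p, peval h p != 0),
    (forall p, peval h p != 0 -> sol_dim A beta p r /\
       forall c, formal A beta p c -> convergent c),
    0 < vol3 R A & r%:R < 2 * vol3 R A].
Proof.
move=> ptA spA; have [wn [q [cov gen_q col_le1 cost_int]]] := triangulation ptA spA.
have [r [h [hp hs rlt]]] := generic_rank_lt spA cov gen_q col_le1 cost_int beta.
have vol := volume_ge spA cov gen_q col_le1.
exists r, h; split=> //.
  by apply: lt_le_trans vol; rewrite ltr0n -double_gt0; apply: leq_ltn_trans rlt.
apply: (@lt_le_trans _ _ ((\sum_(s | Fan A (fun j => (wn j)%:R : R) s) size (boxseq R A s)).*2)%:R).
  by rewrite ltr_nat.
by rewrite -mul2n natrM ler_pM2l.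
Qed.

Lemma wedge_volume_le k : (0 < k)%N -> vol3 R (wedge k) <= (k + 59)%:R.
Proof.
move=> k0; have K0 : 0 < k%:R :> R by rewrite ltr0n.
(* Over the grid square (i, j) the third coordinate is at most k - i - j + 1; the slack 2 leaves
   room for boxes that are open above. *)
pose N := k.+2.
pose F (i j : nat) : set (T * T * T) := box3 (i%:R / k%:R) (j%:R / k%:R) 0
  (i.+1%:R / k%:R) (j.+1%:R / k%:R) (N - i - j)%:R.
have mF i j : measurable (F i j) by exact: measurable_box3.
have fE i j : leb3 R (F i j) = ((N - i - j)%:R / k%:R ^+ 2)%:E.
  have le (m : nat) : m%:R / k%:R <= m.+1%:R / k%:R :> R.
    by rewrite ler_pM2r ?invr_gt0 // ler_nat.
  rewrite leb3_box3 //; congr (_%:E); rewrite subr0.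
  have E (m : nat) : m.+1%:R / k%:R - m%:R / k%:R = k%:R^-1 :> R.
    by rewrite -mulrBl -natrB // subSnn mul1r.
  by rewrite !E mulrC expr2 invfM.
have sub : ((@DeltaA3 R 5 (wedge k) : set (T * T * T)) `<=`
    \big[setU/set0]_(i < N) \big[setU/set0]_(j < N) F i j)%classic.
  move=> x [lam [l0 [l1 ->]]]; rewrite !sum_ord5 !mxE /= in l1 *.
  rewrite !mulr0z !mulr1z !mulr0 !mulr1 ?addr0 ?add0r.
  have a0 := l0 0; have a1 := l0 1; have a2 := l0 2%:R; have a3 := l0 3%:R; have a4 := l0 4%:R.
  move: (lam 0) (lam 1) (lam 2%:R) (lam 3%:R) (lam 4%:R) a0 a1 a2 a3 a4 l1
    => b0 b1 b2 b3 b4 a0 a1 a2 a3 a4 l1 {lam l0}.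
  pose i := Num.truncn (k%:R * (b1 + b3)); pose j := Num.truncn (k%:R * (b2 + b4)).
  have /andP[i1 i2] : i%:R <= k%:R * (b1 + b3) < i.+1%:R.
    by apply: truncn_itv; rewrite mulr_ge0 ?addr_ge0 // ltW.
  have /andP[j1 j2] : j%:R <= k%:R * (b2 + b4) < j.+1%:R.
    by apply: truncn_itv; rewrite mulr_ge0 ?addr_ge0 // ltW.
  have ij : (i + j <= k)%N.
    rewrite -(ler_nat R) natrD; apply: le_trans (lerD i1 j1) _.
    by rewrite -mulrDr ler_piMr ?ler0n //; lra.
  have iN : (i < N)%N by rewrite ltnS ltnW // ltnS (leq_trans _ ij) // leq_addr.
  have jN : (j < N)%N by rewrite ltnS ltnW // ltnS (leq_trans _ ij) // leq_addl.
  rewrite -bigcup_seq; exists (Ordinal iN); first exact: mem_index_enum.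
  rewrite -bigcup_seq; exists (Ordinal jN); first exact: mem_index_enum.
  apply/in_box3; split=> /=.
  - by rewrite ler_pdivrMr // ltr_pdivlMr // mulrC i1 i2.
  - by rewrite ler_pdivrMr // ltr_pdivlMr // mulrC j1 j2.
  rewrite -pmulrn !addr_ge0 ?mulr_ge0 ?ler0n //=.
  have -> : (N - i - j = k - (i + j) + 2)%N by rewrite /N -subnDA -addn2 addnBAC.
  rewrite natrD natrB // natrD.
  have kb : b0 * k%:R <= (1 - (b1 + b3) - (b2 + b4)) * k%:R by rewrite ler_pM2r //; lra.
  move: kb i1 j1; rewrite !mulrBl mul1r [(b1 + b3) * _]mulrC [(b2 + b4) * _]mulrC; lra.
have : (leb3 R (@DeltaA3 R 5 (wedge k)) <= ((\sum_(i < N) \sum_(j < N) (N - i - j))%:R / k%:R ^+ 2)%:E)%E.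
  have mG i : measurable (\big[setU/set0]_(j < N) F i j) by apply: bigsetU_measurable.
  have mD := Delta_measurable (wedge_pointed R k0) (wedge_spans k).
  have S1 := @content_subadditive _ R _ (leb3 R) _ (fun i => \big[setU/set0]_(j < N) F i j) N (fun i _ => mG i) mD sub.
  apply: le_trans S1 _.
  rewrite natr_sum mulr_suml -sumEFin; apply: lee_sum => i _.
  have S2 := @content_subadditive _ R _ (leb3 R) _ (F i) N (fun j _ => mF i j) (mG i) (fun x => id).
  apply: le_trans S2 _.
  by rewrite natr_sum mulr_suml -sumEFin; apply: lee_sum => j _; rewrite le_eqVlt; apply/orP; left; apply/eqP; exact: fE.
move=> H; have {}H : vol3 R (wedge k) <= 6%:R * ((\sum_(i < N) \sum_(j < N) (N - i - j))%:R / k%:R ^+ 2).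
  rewrite ler_pM2l ?ltr0n // -lee_fin fineK //.
  by rewrite ge0_fin_numE ?measure_ge0 //; apply: le_lt_trans H _; rewrite ltry.
apply: le_trans H _; rewrite mulrA ler_pdivrMr ?exprn_gt0 // -natrM -natrX -natrM ler_nat.
(* The product of k + 2, k + 3 and k + 4 is at most [k ^ 2 * (k + 59)] for k positive, as 9 + 26 +
   24 = 59. *)
rewrite mulnC sum_staircase /N; nia.
Qed.

End Main.

Lemma lin_indep_widen (R : realType) n m m' (f : 'I_m -> series R n) (le : (m' <= m)%N) :
  lin_indep f -> lin_indep (fun l => f (widen_ord le l)).
Proof.
move=> fi lam lam0 l.
pose lam' (i : 'I_m) := if insub (i : nat) is Some l' then lam l' else 0.
have lamE l' : lam' (widen_ord le l') = lam l' by rewrite /lam' /= valK.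
rewrite -lamE; apply: fi => a; apply: etrans (lam0 a).
rewrite (bigID (fun i : 'I_m => i < m')%N) /= [X in _ + X]big1 ?addr0.
  by rewrite (big_ord_narrow le); apply: eq_bigr => l' _; rewrite lamE.
by move=> i im; rewrite /lam' insubN ?mul0r.
Qed.

Theorem theorem1p2 (R : realType) :
  (forall (n : nat) (A : 'M[int]_(3, n)),
      pointed R A -> spans_lattice A ->
      forall beta : 'I_3 -> R[i],
        exists r : nat, gkz_rank A beta r /\ r%:R / vol3 R A < 2)
  /\
  (forall eps : R, 0 < eps ->
     exists (n : nat) (A : 'M[int]_(3, n)) (beta : 'I_3 -> R[i]) (r : nat),
       [/\ pointed R A, spans_lattice A, gkz_rank A beta r &
           2 - eps < r%:R / vol3 R A]).
Proof.
split=> [n A ptA spA beta|eps eps0].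
  have [r [h [hp hs v0 rv]]] := rank_lt_volume beta ptA spA.
  exists r; split; last by rewrite ltr_pdivrMr.
  by exists h; split=> // p /hs[].
(* 117 is twice 59 minus 1: a ratio of 2k + 1 to k + 59 above 2 - eps amounts to 117 being less than
   eps times k + 59. *)
pose k := (Num.truncn (117%:R / eps)).+1.
have kP : 117%:R / eps < k%:R by apply: truncnS_gt.
have ptA := wedge_pointed R (ltn0Sn _ : (0 < k)%N); have spA := wedge_spans k.
have [r [h [hp hs v0 rv]]] := rank_lt_volume (fun=> 0) ptA spA.
exists 5%N, (wedge k), (fun=> 0), r; split=> //.
  by exists h; split=> // p /hs[].
have [h' hE'] : polyfun (fun p : 'I_5 -> R[i] => \prod_j p j).
  exists [:: (1, [ffun=> 1%N])] => p.
  rewrite /peval big_seq1 mul1r; apply: eq_bigr => j _.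
  by rewrite ffunE expr1.
(* The facet series divide by coordinates of p, so the point is also taken off the coordinate
   hyperplanes. *)
have [p] : exists p, peval h p * (\prod_j p j) != 0.
  apply: (@polyfun_mul_neq0 R 5 (fun p => peval h p) (fun p => \prod_j p j)) => //.
  - by exists h.
  - by exists h'.
  by exists (fun=> 1); rewrite big1 ?oner_eq0.
rewrite mulf_eq0 negb_or => /andP[/hs[[_ rmax] conv] /prodf_neq0 pn0].
have [F [Ff Fi]] := wedge_formal (ltn0Sn _ : (0 < k)%N) (fun j => pn0 j isT).
have Fs l : gkz_solution (wedge k) (fun=> 0) p (F l).
  by have [h1 h2] := Ff l; split=> //; apply: conv.
have rk : (k.+1 + k <= r)%N.
  rewrite leqNgt; apply/negP => lt.
  by apply: (rmax (fun l => F (widen_ord lt l))) => //; apply: lin_indep_widen.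
have v59 := wedge_volume_le R (ltn0Sn _ : (0 < k)%N).
have k59 : 0 < (k + 59)%:R :> R by rewrite ltr0n addnS.
apply: (@lt_le_trans _ _ ((k.+1 + k)%:R / (k + 59)%:R)); last first.
  by rewrite ler_pM ?invr_ge0 ?ler0n ?lef_pV2 ?posrE // ler_nat.
rewrite ltr_pdivlMr // -addn1 !natrD.
move: kP; rewrite ltr_pdivrMr //; have := ltW eps0; rewrite -[59%:R]/(59 : R) => e0 kP.
have : 0 <= eps * 59 by rewrite mulr_ge0.
lra.
Qed.
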